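(* Let $P_{XY_1Y_2Z_1Z_2}$ be an arbitrary pmf on a finite product alphabet $\mathcal{X}\times\mathcal{Y}_1\times\mathcal{Y}_2\times\mathcal{Z}_1\times\mathcal{Z}_2$. For all nonnegative rates $(R_0,R_1,R_2)$, $$\mathcal{E}_{\mathrm{GW}}^{\mathrm{SI,in}}(R_0,R_1,R_2)\subseteq \mathcal{E}_{\mathrm{GW}}^{\mathrm{SI}}(R_0,R_1,R_2),$$ where $\mathcal{E}_{\mathrm{GW}}^{\mathrm{SI}}(R_0,R_1,R_2)$ is the (operational) exponents region of the hypothesis testing problem over the Gray-Wyner network with side information, and $\mathcal{E}_{\mathrm{GW}}^{\mathrm{SI,in}}(R_0,R_1,R_2)$ is the set of all pairs $(\theta_1,\theta_2)$ with $\theta_1\ge 0$, $\theta_2\ge 0$ for which there exist auxiliary random variables $(U_0,U_1,U_2)$ over finite alphabets, forming the Markov chain $(U_0,U_1,U_2)\to X\to (Y_1,Y_2,Z_1,Z_2)$, such that $$R_0+R_1\ge I(U_0,U_1;X|Z_1),$$ $$R_0+R_2\ge I(U_0,U_2;X|Z_2),$$ $$R_0+R_1+R_2\ge \max_{i\in\{1,2\}} I(U_0;X|Z_i)+I(U_1;X|U_0,Z_1)+I(U_2;X|U_0,Z_2),$$ and $$\theta_1\le I(U_1;Y_1|Z_1),\qquad \theta_2\le I(U_2;Y_2|Z_2).$$ Here $(X,Y_1,Y_2,Z_1,Z_2)\sim P_{XY_1Y_2Z_1Z_2}$ in all mutual informations.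
   Context: Logarithms are to base 2. All entropies and mutual informations are computed under hypothesis $\mathcal{H}=0$, i.e. with $(X,Y_1,Y_2,Z_1,Z_2)\sim P_{XY_1Y_2Z_1Z_2}$. Hypothesis testing over the Gray-Wyner network with side information. A transmitter observes $X^n$; Receiver $i\in\{1,2\}$ observes $(Y_i^n,Z_i^n)$. Under $\mathcal{H}=0$, $(X^n,Y_1^n,Y_2^n,Z_1^n,Z_2^n)$ is i.i.d. according to $P_{XY_1Y_2Z_1Z_2}$. Under $\mathcal{H}=1$, it is i.i.d. according to $P_{XZ_1Z_2}P_{Y_1|Z_1}P_{Y_2|Z_2}$, where $P_{XZ_1Z_2}$, $P_{Y_1|Z_1}$, $P_{Y_2|Z_2}$ are the marginal and conditional marginals of $P_{XY_1Y_2Z_1Z_2}$. The transmitter computes $(M_0,M_1,M_2)=\phi^{(n)}(X^n)$ with a possibly stochastic encoding function $\phi^{(n)}:\mathcal{X}^n\to\{0,\dots,2^{nR_0}\}\times\{0,\dots,2^{nR_1}\}\times\{0,\dots,2^{nR_2}\}$ (where $\{0,\dots,2^{nR}\}$ means the integers between $0$ and $2^{nR}$; the encoder's randomness is independent of everything else). Receiver $i$ observes $M_0$ and $M_i$ noiselessly and outputs the decision $\hat{\mathcal{H}}_i=g_i^{(n)}(Y_i^n,Z_i^n,M_0,M_i)\in\{0,1\}$. The error probabilities are $\alpha_{i,n}=\Pr[\hat{\mathcal{H}}_i=1|\mathcal{H}=0]$ (type I) and $\beta_{i,n}=\Pr[\hat{\mathcal{H}}_i=0|\mathcal{H}=1]$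 (type II). For $\epsilon\in(0,1)$, the tuple $(\theta_1,\theta_2,R_0,R_1,R_2)$ is $\epsilon$-achievable if there is a sequence $\{(\phi^{(n)},g_1^{(n)},g_2^{(n)})\}_{n\ge1}$ such that for $i\in\{1,2\}$: $\alpha_{i,n}\le\epsilon$ for all positive integers $n$, and $-\limsup_{n\to\infty}\frac1n\log\beta_{i,n}\ge\theta_i$. The exponents region $\mathcal{E}_{\mathrm{GW}}^{\mathrm{SI}}(R_0,R_1,R_2)$ is the closure of the set of all nonnegative pairs $(\theta_1,\theta_2)$ such that $(\theta_1,\theta_2,R_0,R_1,R_2)$ is $\epsilon$-achievable for every $\epsilon\in(0,1)$. *)

(* Defs.v *)
From HB Require Import structures.
From mathcomp Require Import all_boot all_order all_algebra.
From mathcomp Require Import all_classical all_reals all_analysis.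

Set Implicit Arguments.
Unset Strict Implicit.
Unset Printing Implicit Defensive.
Import Order.TTheory GRing.Theory Num.Theory.
Import numFieldNormedType.Exports.

Local Open Scope classical_set_scope.
Local Open Scope ring_scope.

(* Probability on finite alphabets. A random variable on the sample space T is
   a function A : T -> TA. *)

Record finpmf (R : realType) (T : finType) := Pmf {
  mass :> T -> R;
  mass_ge0 : forall t, 0 <= mass t;
  mass_sum1 : \sum_t mass t = 1 }.

Notation "[% A , B , .. , C ]" :=
  (fun w => pair .. (pair (A w) (B w)) .. (C w)) (only parsing).

Section FiniteProbability.
Context {R : realType} {T : finType}.

Definition log2 (x : R) : R := ln x / ln 2.

Definition prob (p : T -> R) (E : pred T) : R := \sum_(t | E t) p t.

Definition law {TA : finType} (p : T -> R) (A : T -> TA) (a : TA) : R :=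
  prob p (fun t => A t == a).

(* P_{A|B}(a|b); it is 0 when P_B(b) = 0. *)
Definition claw {TA TB : finType} (p : T -> R) (A : T -> TA) (B : T -> TB)
    (a : TA) (b : TB) : R :=
  law p (fun t => (A t, B t)) (a, b) / law p B b.

(* I(A;B|C). A summand with P_{ABC}(a,b,c) = 0 vanishes; otherwise both the
   numerator and the denominator inside the logarithm are positive. *)
Definition cond_mutual_info {TA TB TC : finType} (p : T -> R)
    (A : T -> TA) (B : T -> TB) (C : T -> TC) : R :=
  \sum_a \sum_b \sum_c
    law p (fun t => (A t, B t, C t)) (a, b, c) *
    log2 (law p (fun t => (A t, B t, C t)) (a, b, c) * law p C c /
          (law p (fun t => (A t, C t)) (a, c) *
           law p (fun t => (B t, C t)) (b, c))).

(* A -> B -> C : A and C are conditionally independent given B. *)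
Definition markov_chain {TA TB TC : finType} (p : T -> R)
    (A : T -> TA) (B : T -> TB) (C : T -> TC) : Prop :=
  forall b, 0 < law p B b ->
  forall a c, claw p (fun t => (A t, C t)) B (a, c) b =
              claw p A B a b * claw p C B c b.

Definition iid (p : T -> R) (n : nat) (s : {ffun 'I_n -> T}) : R :=
  \prod_(i < n) p (s i).

End FiniteProbability.

(* Logarithm to base 2 with log 0 = -oo, so that a vanishing error probability
   has an infinite exponent. *)
Definition elog2 {R : realType} (x : R) : \bar R :=
  (lne x%:E * ((ln 2)^-1)%:E)%E.

(* The integers 0, ..., floor (2 ^ (n r)). *)
Definition msg {R : realType} (n : nat) (r : R) : finType :=
  'I_(Num.truncn (2 `^ (n%:R * r))).+1.

Definition block {S A : finType} (n : nat) (f : S -> A)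
    (s : {ffun 'I_n -> S}) : {ffun 'I_n -> A} := [ffun i => f (s i)].

Section GrayWyner.
Context {R : realType} {TX TY1 TY2 TZ1 TZ2 : finType}.

Local Notation S := (TX * TY1 * TY2 * TZ1 * TZ2)%type.

Definition rvX (s : S) : TX := let: (x, _, _, _, _) := s in x.
Definition rvY1 (s : S) : TY1 := let: (_, y1, _, _, _) := s in y1.
Definition rvY2 (s : S) : TY2 := let: (_, _, y2, _, _) := s in y2.
Definition rvZ1 (s : S) : TZ1 := let: (_, _, _, z1, _) := s in z1.
Definition rvZ2 (s : S) : TZ2 := let: (_, _, _, _, z2) := s in z2.

(* Single-letter law under H = 1: P_{X Z1 Z2} P_{Y1|Z1} P_{Y2|Z2}. *)
Definition alt_law (P : S -> R) (s : S) : R :=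
  law P [% rvX, rvZ1, rvZ2] (rvX s, rvZ1 s, rvZ2 s) *
  claw P rvY1 rvZ1 (rvY1 s) (rvZ1 s) *
  claw P rvY2 rvZ2 (rvY2 s) (rvZ2 s).

(* A stochastic encoder is a transition kernel from source blocks to message
   triples. A decision of [true] stands for 1, [false] for 0. *)
Record code (R0 R1 R2 : R) (n : nat) := Code {
  enc : {ffun 'I_n -> TX} -> finpmf R (msg n R0 * msg n R1 * msg n R2)%type;
  dec1 : {ffun 'I_n -> TY1} -> {ffun 'I_n -> TZ1} ->
    msg n R0 -> msg n R1 -> bool;
  dec2 : {ffun 'I_n -> TY2} -> {ffun 'I_n -> TZ2} ->
    msg n R0 -> msg n R2 -> bool }.

Section Errors.
Context {R0 R1 R2 : R} {n : nat}.
Variable c : code R0 R1 R2 n.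

Local Notation outcome :=
  ({ffun 'I_n -> S} * (msg n R0 * msg n R1 * msg n R2))%type.

(* Joint law of the source blocks, i.i.d. with single-letter law p, and of the
   messages. *)
Definition network_law (p : S -> R) (w : outcome) : R :=
  iid p w.1 * enc c (block rvX w.1) w.2.

Definition decision1 (w : outcome) : bool :=
  let: (s, (m0, m1, _)) := w in dec1 c (block rvY1 s) (block rvZ1 s) m0 m1.

Definition decision2 (w : outcome) : bool :=
  let: (s, (m0, _, m2)) := w in dec2 c (block rvY2 s) (block rvZ2 s) m0 m2.

Definition type1_error (P : S -> R) (decision : outcome -> bool) : R :=
  prob (network_law P) (fun w => decision w == true).

Definition type2_error (P : S -> R) (decision : outcome -> bool) : R :=
  prob (network_law (alt_law P)) (fun w => decision w == false).

End Errors.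

Definition eps_achievable (P : S -> R) (eps theta1 theta2 R0 R1 R2 : R) : Prop :=
  exists c : forall n, code R0 R1 R2 n,
    (forall n, (0 < n)%N ->
       type1_error (c n) P (decision1 (c n)) <= eps /\
       type1_error (c n) P (decision2 (c n)) <= eps) /\
    (theta1%:E <= - limn_esup (fun n =>
       (n%:R^-1)%:E * elog2 (type2_error (c n) P (decision1 (c n)))))%E /\
    (theta2%:E <= - limn_esup (fun n =>
       (n%:R^-1)%:E * elog2 (type2_error (c n) P (decision2 (c n)))))%E.

Definition exponents_region (P : finpmf R S) (R0 R1 R2 : R) : set (R * R) :=
  closure [set theta : R * R |
    0 <= theta.1 /\ 0 <= theta.2 /\
    forall eps : R, 0 < eps < 1 ->
      eps_achievable P eps theta.1 theta.2 R0 R1 R2].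

Definition inner_region (P : finpmf R S) (R0 R1 R2 : R) : set (R * R) :=
  [set theta : R * R |
    0 <= theta.1 /\ 0 <= theta.2 /\
    exists (TU0 TU1 TU2 : finType) (Q : finpmf R (TU0 * TU1 * TU2 * S)%type),
      let U0 (w : TU0 * TU1 * TU2 * S) := w.1.1.1 in
      let U1 (w : TU0 * TU1 * TU2 * S) := w.1.1.2 in
      let U2 (w : TU0 * TU1 * TU2 * S) := w.1.2 in
      let X (w : TU0 * TU1 * TU2 * S) := rvX w.2 in
      let Y1 (w : TU0 * TU1 * TU2 * S) := rvY1 w.2 in
      let Y2 (w : TU0 * TU1 * TU2 * S) := rvY2 w.2 in
      let Z1 (w : TU0 * TU1 * TU2 * S) := rvZ1 w.2 in
      let Z2 (w : TU0 * TU1 * TU2 * S) := rvZ2 w.2 in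
      (forall s, law Q [% X, Y1, Y2, Z1, Z2] s = P s) /\
      markov_chain Q [% U0, U1, U2] X [% Y1, Y2, Z1, Z2] /\
      R0 + R1 >= cond_mutual_info Q [% U0, U1] X Z1 /\
      R0 + R2 >= cond_mutual_info Q [% U0, U2] X Z2 /\
      R0 + R1 + R2 >= Num.max (cond_mutual_info Q U0 X Z1)
                              (cond_mutual_info Q U0 X Z2)
                      + cond_mutual_info Q U1 X [% U0, Z1]
                      + cond_mutual_info Q U2 X [% U0, Z2] /\
      theta.1 <= cond_mutual_info Q U1 Y1 Z1 /\
      theta.2 <= cond_mutual_info Q U2 Y2 Z2].

End GrayWyner.

(* Main.v *)
Require Import Defs.
From HB Require Import structures.
From mathcomp Require Import all_boot all_order all_algebra.
From mathcomp Require Import all_classical all_reals all_analysis.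
From mathcomp Require Import ring lra.

Set Implicit Arguments.
Unset Strict Implicit.
Unset Printing Implicit Defensive.
Import Order.TTheory GRing.Theory Num.Theory.
Import numFieldNormedType.Exports.

Local Open Scope classical_set_scope.
Local Open Scope ring_scope.

(* Under both hypotheses the pair (X, Z_i) and the messages have the same law;
   only Y_i differs, being drawn from P(Y_i | Z_i) independently of the rest
   under the alternative.  If receiver i computes from Z_i and its messages an
   estimate of U_i^n and accepts exactly when the product of the ratios
   P(y | u, z) / P(y | z) is at least 2^(n theta_i), a change of measure bounds
   the type II error by 2^(- n theta_i) whether or not the estimate is correct.
   So only the type I error requires coding: U_0^n, U_1^n, U_2^n have to be
   generated from X^n and recovered at the receivers.

   This is done by random binning with a stochastic encoder.  Uniform hashes are
   drawn on the sequences u0, on the pairs (u0, u1) and on the pairs (u0, u2).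
   One component of each hash is frozen, at rate about H(U_0 | X),
   H(U_1 | U_0, X) and H(U_2 | U_0, X), and the encoder draws u0, then u1 and u2,
   from the conditional laws restricted to the frozen bins; the other component
   is transmitted.  Freezing at these rates hardly biases the encoder, and the
   transmitted rates I(U_0 ; X | Z_i) + I(U_i ; X | U_0, Z_i) (in total) and
   I(U_i ; X | U_0, Z_i) (for the hash of (u0, ui) alone) let receiver i decode.
   Message 0 carries the bin of u0 and a share of the bins of the two pairs;
   eliminating the three shares gives the stated rate constraints.  Finally,
   erasing all the auxiliaries simultaneously with a small probability gives
   the slack required on the boundary of the rate constraints. *)

(** * Product measures and the law of large numbers *)

(** Freezing part of the hashes takes the place of a codebook and of a covering argument: the
    encoder samples the true conditional laws restricted to a bin. Its output law is then a ratio
    whose denominator is a random normalising sum, and the obstacle is to average this ratio over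
    the hashes. A tangent inequality for 1 / D turns the average into moments of indicators, which
    pairwise independence computes. Every estimate is one-sided: a lower bound on the weight of the
    triples that are typical, kept and free of collisions at both receivers. The encoder makes U_1
    and U_2 conditionally independent given (U_0, X), whatever their original coupling. This loses
    nothing, because each information term and each exponent involves only one of them, together
    with U_0 and the source. *)

Lemma ler_natb {R : realType} (a b : bool) : (a -> b) -> a%:R <= b%:R :> R.
Proof. by case: a b => [] [] // /(_ isT). Qed.

Section ProductMeasure.
Context {R : realType} {I K : finType} (q : K -> R).
Hypothesis q1 : \sum_k q k = 1.

Local Notation mean F := (\sum_(g : {ffun I -> K}) (\prod_l q (g l)) * F g).

Lemma prod_measure1 : \sum_(g : {ffun I -> K}) \prod_l q (g l) = 1.
Proof. by rewrite -(bigA_distr_bigA (fun _ => q)) big1. Qed.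

Lemma mean_coord (a : K -> R) (i : I) :
  mean (fun g => a (g i)) = \sum_k q k * a k.
Proof.
pose F l k := q k * (if l == i then a k else 1).
transitivity (\sum_(g : {ffun I -> K}) \prod_l F l (g l)).
  apply: eq_bigr => g _; rewrite big_split/=; congr (_ * _).
  by rewrite (bigD1 i)//= eqxx big1 ?mulr1// => l /negbTE ->.
rewrite -(bigA_distr_bigA F) (bigD1 i)//= [X in _ * X]big1 ?mulr1.
  by apply: eq_bigr => k _; rewrite /F eqxx.
by move=> l /negbTE li; rewrite -q1; apply: eq_bigr => k _; rewrite /F li mulr1.
Qed.

Lemma mean_coordM (a b : K -> R) (i j : I) : i != j ->
  mean (fun g => a (g i) * b (g j)) =
  (\sum_k q k * a k) * (\sum_k q k * b k).
Proof.
move=> ij.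
have ji : (j == i) = false by rewrite eq_sym; exact: negbTE.
pose F l k := q k * ((if l == i then a k else 1) * (if l == j then b k else 1)).
transitivity (\sum_(g : {ffun I -> K}) \prod_l F l (g l)).
  apply: eq_bigr => g _; rewrite big_split/=; congr (_ * _).
  rewrite big_split/=; congr (_ * _).
    by rewrite (bigD1 i)//= eqxx big1 ?mulr1// => l /negbTE ->.
  by rewrite (bigD1 j)//= eqxx big1 ?mulr1// => l /negbTE ->.
rewrite -(bigA_distr_bigA F) (bigD1 i)//= (bigD1 j)/=; last by rewrite ji.
rewrite [X in _ * (_ * X)]big1 ?mulr1; last first.
  move=> l /andP[/negbTE li /negbTE lj]; rewrite -q1.
  by apply: eq_bigr => k _; rewrite /F li lj !mulr1.
congr (_ * _); apply: eq_bigr => k _; rewrite /F eqxx ?ji ?mul1r//.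
by rewrite (negbTE ij) mulr1.
Qed.

Lemma mean_coord2 (phi : K -> K -> R) (i j : I) : i != j ->
  mean (fun g => phi (g i) (g j)) = \sum_k \sum_l q k * q l * phi k l.
Proof.
move=> ij; transitivity
  (\sum_k mean (fun g : {ffun I -> K} => (k == g i)%:R * phi k (g j))).
  rewrite exchange_big/=; apply: eq_bigr => g _.
  rewrite -mulr_sumr; congr (_ * _); rewrite (bigD1 (g i))//= eqxx mul1r.
  by rewrite big1 ?addr0// => k /negbTE ->; rewrite mul0r.
apply: eq_bigr => k _; rewrite (mean_coordM (fun c => (k == c)%:R) _ ij).
rewrite (bigD1 k)//= eqxx mulr1 big1 ?addr0; last first.
  by move=> c; rewrite eq_sym => /negbTE ->; rewrite mulr0.
by rewrite mulr_sumr; apply: eq_bigr => l _; rewrite mulrA.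
Qed.

End ProductMeasure.

Section LawOfLargeNumbers.
Context {R : realType} {T : finType} (p : finpmf R T).

Lemma iid_ge0 n (s : {ffun 'I_n -> T}) : 0 <= iid p s.
Proof. by apply: prodr_ge0 => i _; exact: mass_ge0. Qed.

Lemma iid_sum1 n : \sum_(s : {ffun 'I_n -> T}) iid p s = 1.
Proof. exact/prod_measure1/mass_sum1. Qed.

Lemma iid_gt0 n (s : {ffun 'I_n -> T}) : iid p s != 0 -> forall i, 0 < p (s i).
Proof.
by move=> s0 i; rewrite lt0r mass_ge0 andbT; apply: contra_neq s0 => si0;
  rewrite /iid (bigD1 i)//= si0 mul0r.
Qed.

Lemma chebyshev n (h : T -> R) (d : R) : (0 < n)%N -> 0 < d ->
  \sum_t p t * h t = 0 ->
  \sum_(s : {ffun 'I_n -> T}) iid p s * (n%:R * d < `|\sum_i h (s i)|)%R%:R <=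
  (\sum_t p t * h t ^+ 2) / d ^+ 2 / n%:R.
Proof.
move=> n0 d0 h0; have n0' : 0 < n%:R :> R by rewrite ltr0n.
have var : \sum_(s : {ffun 'I_n -> T}) iid p s * (\sum_i h (s i)) ^+ 2 =
    n%:R * \sum_t p t * h t ^+ 2.
  under eq_bigr => s _ do rewrite expr2 mulr_suml mulr_sumr.
  rewrite exchange_big/=.
  transitivity (\sum_(i < n) \sum_t p t * h t ^+ 2); last first.
    by rewrite sumr_const card_ord mulr_natl.
  apply: eq_bigr => i _; under eq_bigr => s _ do rewrite mulr_sumr mulr_sumr.
  rewrite exchange_big/= (bigD1 i)//= [X in _ + X]big1 ?addr0; last first.
    move=> j ji; have ij : i != j by rewrite eq_sym.
    by apply: etrans (mean_coordM (mass_sum1 p) h h ij) _; rewrite h0 mul0r.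
  under eq_bigr => s _ do rewrite -expr2.
  exact: (mean_coord (mass_sum1 p) (fun t => h t ^+ 2)).
rewrite -[leRHS](_ : n%:R * (\sum_t p t * h t ^+ 2) / (n%:R * d) ^+ 2 = _);
  last by field; rewrite !gt_eqF.
rewrite ler_pdivlMr ?exprn_gt0 ?mulr_gt0// -var mulr_suml ler_sum// => s _.
rewrite -mulrA ler_wpM2l ?iid_ge0//.
case: ltP => [H|_]; last by rewrite mul0r sqr_ge0.
rewrite mul1r -[leRHS]real_normK ?num_real// ler_pXn2r ?nnegrE//; first exact: ltW.
by rewrite mulr_ge0// ltW.
Qed.

Lemma log2K (x : R) : 0 < x -> 2 `^ (log2 x) = x.
Proof.
move=> x0; rewrite /powR pnatr_eq0/= /log2 divfK ?lnK ?posrE//.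
by rewrite gt_eqF// ln_gt0// ltr1n.
Qed.

(** Here [k] is any function positive on the support, not necessarily a law, so that conditional
    laws and likelihood ratios are covered alike. Chebyshev applied to the centred logarithm of [k]
    gives a constant that depends on [k] and [d] but not on [n]. *)
Lemma aep (k : T -> R) (d : R) : 0 < d -> (forall t, 0 < p t -> 0 < k t) ->
  let mu := \sum_t p t * log2 (k t) in
  exists C : R, forall n, (0 < n)%N ->
    \sum_(s : {ffun 'I_n -> T}) iid p s *
      (~~ (2 `^ (n%:R * (mu - d)) <= \prod_i k (s i) <=
           2 `^ (n%:R * (mu + d)))%R)%:R <= C / n%:R.
Proof.
move=> d0 k0 mu; pose h t := log2 (k t) - mu.
exists ((\sum_t p t * h t ^+ 2) / d ^+ 2) => n n0.
have h0 : \sum_t p t * h t = 0.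
  rewrite /h; under eq_bigr => t _ do rewrite mulrBr.
  by rewrite sumrB -mulr_suml mass_sum1 mul1r subrr.
apply: le_trans (chebyshev n0 d0 h0); apply: ler_sum => s _.
have [->|s0] := eqVneq (iid p s) 0; first by rewrite !mul0r.
rewrite ler_wpM2l ?iid_ge0//.
have ks i : 0 < k (s i) by apply/k0/iid_gt0.
have prodE : \prod_i k (s i) = 2 `^ (\sum_i h (s i) + n%:R * mu).
  rewrite /h sumrB sumr_const card_ord mulr_natl subrK.
  elim/big_ind2: _ => [|x a y b -> ->|i _]; first by rewrite powRr0.
    by rewrite powRD// pnatr_eq0 implybT.
  by rewrite log2K.
apply/ler_natb; apply: contraNT; rewrite -leNgt ler_norml => /andP[lo hi].
by rewrite prodE !ler_powR ?ler1n//; lra.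
Qed.

End LawOfLargeNumbers.

(** * Random hashing *)

Section Expectation.
Context {R : realType}.

Definition expect {T : finType} (w F : T -> R) : R := \sum_t w t * F t.

Lemma expect_sum {T J : finType} (w : T -> R) (Q : pred J) (F : J -> T -> R) :
  expect w (fun t => \sum_(j | Q j) F j t) = \sum_(j | Q j) expect w (F j).
Proof.
rewrite /expect exchange_big/=; apply: eq_bigr => t _; exact: mulr_sumr.
Qed.

Lemma expectZ {T : finType} (w F : T -> R) c :
  expect w (fun t => c * F t) = c * expect w F.
Proof. by rewrite mulr_sumr; apply: eq_bigr => t _; rewrite mulrCA. Qed.

Lemma expectB {T : finType} (w F G : T -> R) :
  expect w (fun t => F t - G t) = expect w F - expect w G.
Proof. by rewrite -sumrB; apply: eq_bigr => t _; rewrite mulrBr. Qed.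

Lemma expectD {T : finType} (w F G : T -> R) :
  expect w (fun t => F t + G t) = expect w F + expect w G.
Proof. by rewrite -big_split; apply: eq_bigr => t _; rewrite mulrDr. Qed.

Lemma expect_le {T : finType} (w F G : T -> R) : (forall t, 0 <= w t) ->
  (forall t, F t <= G t) -> expect w F <= expect w G.
Proof. by move=> w0 FG; apply: ler_sum => t _; exact: ler_wpM2l. Qed.

Lemma expect_attained {T : finType} (w F : T -> R) (c : R) :
  (forall t, 0 <= w t) -> \sum_t w t = 1 -> c <= expect w F ->
  exists t, c <= F t.
Proof.
move=> w0 w1 cF; have [/existsP//|] := boolP [exists t, c <= F t].
rewrite negb_exists => /forallP Fc; exfalso.
have H t : 0 <= w t * (c - F t).
  by rewrite mulr_ge0// subr_ge0 ltW// ltNge.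
have : \sum_t w t * (c - F t) <= 0.
  under eq_bigr => t _ do rewrite mulrBr.
  by rewrite sumrB -mulr_suml w1 mul1r subr_le0.
move=> le0; have /eqP : \sum_t w t * (c - F t) = 0.
  by apply/eqP; rewrite eq_le le0 sumr_ge0.
rewrite psumr_eq0// => /allP zero.
have : \sum_t w t = 0.
  apply: big1 => t _; have := zero t (mem_index_enum t).
  by rewrite /= mulf_eq0 subr_eq0 => /orP[/eqP//|/eqP cE]; have := Fc t; rewrite cE lexx.
by move/eqP; rewrite w1 oner_eq0.
Qed.

Lemma expect_pair {T J : finType} (v : T -> R) (w : J -> R) (F : T -> R) (G : J -> R) :
  expect (fun a : T * J => v a.1 * w a.2) (fun a => F a.1 * G a.2) =
  expect v F * expect w G.
Proof.
rewrite /expect mulr_suml -(pair_bigA _ (fun t j => v t * w j * (F t * G j)))/=.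
apply: eq_bigr => t _; rewrite mulr_sumr; apply: eq_bigr => j _; ring.
Qed.

(** Regroups the outer coordinates: the decoding event of receiver 2 involves the hashes of u0 and
    of (u0, u2), and is independent of the middle one. *)
Lemma expect_pair13 {T J L : finType} (u : T -> R) (v : J -> R) (w : L -> R)
    (F : T -> L -> R) (G : J -> R) :
  expect (fun a : T * J * L => u a.1.1 * v a.1.2 * w a.2)
    (fun a => F a.1.1 a.2 * G a.1.2) =
  expect (fun a : T * L => u a.1 * w a.2) (fun a => F a.1 a.2) * expect v G.
Proof.
transitivity (\sum_t \sum_l \sum_j u t * v j * w l * (F t l * G j)).
  rewrite /expect -(pair_bigA _ (fun (a : T * J) l =>
    u a.1 * v a.2 * w l * (F a.1 l * G a.2)))/=.
  rewrite -(pair_bigA _ (fun t j => \sum_l u t * v j * w l * (F t l * G j)))/=.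
  by apply: eq_bigr => t _; exact: exchange_big.
rewrite /expect -(pair_bigA _ (fun t l => u t * w l * F t l))/= mulr_suml.
apply: eq_bigr => t _; rewrite mulr_suml; apply: eq_bigr => l _.
by rewrite mulr_sumr; apply: eq_bigr => j _; ring.
Qed.

End Expectation.

Section Hashing.
Context {R : realType} {T F B : finType} (f : F) (b : B).

(* A hash value is a pair: its component in [F] is frozen to [f] and shared by
   encoder and decoders, its component in [B] is the transmitted bin. *)
Definition unif_hash (g : {ffun T -> F * B}) : R :=
  \prod_(t : T) (#|{: F * B}|%:R)^-1.

Definition kept (g : {ffun T -> F * B}) (t : T) : bool := (g t).1 == f.

Let cardF : 0 < #|F|%:R :> R.
Proof. by rewrite ltr0n; apply/card_gt0P; exists f. Qed.

Let cardB : 0 < #|B|%:R :> R.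
Proof. by rewrite ltr0n; apply/card_gt0P; exists b. Qed.

Let unif1 : \sum_(k : F * B) (#|{: F * B}|%:R)^-1 = 1 :> R.
Proof.
rewrite sumr_const -[_ *+ _]mulr_natl divff//.
by rewrite card_prod natrM mulf_neq0 ?gt_eqF.
Qed.

Let unif_kept : \sum_(k : F * B) (#|{: F * B}|%:R)^-1 * (k.1 == f)%:R = #|F|%:R^-1 :> R.
Proof.
rewrite -(pair_bigA _ (fun a c => (#|{: F * B}|%:R)^-1 * (a == f)%:R))/=.
rewrite (bigD1 f)//= [X in _ + X]big1 ?addr0; last first.
  by move=> a /negbTE af; rewrite big1// => c _; rewrite af mulr0.
rewrite eqxx mulr1 sumr_const card_prod natrM -(mulr_natr (_^-1)); field.
by rewrite !gt_eqF.
Qed.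

Lemma unif_hash_ge0 g : 0 <= unif_hash g.
Proof. by apply: prodr_ge0 => t _; rewrite invr_ge0. Qed.

Lemma unif_hash_sum1 : \sum_g unif_hash g = 1.
Proof. exact: (prod_measure1 unif1). Qed.

Lemma expect_kept t : expect unif_hash (fun g => (kept g t)%:R) = #|F|%:R^-1.
Proof. by rewrite -unif_kept; exact: (mean_coord unif1 (fun k => (k.1 == f)%:R)). Qed.

Lemma expect_kept2 t t' : t != t' ->
  expect unif_hash (fun g => (kept g t)%:R * (kept g t')%:R) =
  #|F|%:R^-1 * #|F|%:R^-1.
Proof.
move=> tt'; rewrite -unif_kept.
exact: (mean_coordM unif1 (fun k => (k.1 == f)%:R) (fun k => (k.1 == f)%:R)).
Qed.

Lemma expect_kept_collision t t' : t != t' ->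
  expect unif_hash (fun g => (kept g t)%:R * (g t' == g t)%:R) =
  #|F|%:R^-1 * #|{: F * B}|%:R^-1.
Proof.
move=> tt'.
apply: etrans (mean_coord2 unif1 (fun k l => (k.1 == f)%:R * (l == k)%:R) tt') _.
rewrite -unif_kept mulr_suml; apply: eq_bigr => k _.
rewrite (bigD1 k)//= eqxx mulr1 big1 ?addr0; first by rewrite mulrAC.
by move=> l /negbTE ->; rewrite !mulr0.
Qed.

Context {V : finType} (j : V -> T) (p : V -> R).
Hypotheses (j_inj : injective j) (p0 : forall v, 0 <= p v) (p1 : \sum_v p v <= 1).

Definition kept_mass (g : {ffun T -> F * B}) : R :=
  \sum_v p v * (kept g (j v))%:R.

Lemma kept_mass_ge0 g : 0 <= kept_mass g.
Proof. by apply: sumr_ge0 => v _; rewrite mulr_ge0. Qed.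

Lemma kept_mass_ge g v : kept g (j v) -> p v <= kept_mass g.
Proof.
move=> kv; rewrite /kept_mass (bigD1 v)//= kv mulr1 lerDl sumr_ge0// => v' _.
by rewrite mulr_ge0.
Qed.

Definition thinned (g : {ffun T -> F * B}) (v : V) : R :=
  p v * (kept g (j v))%:R / kept_mass g.

Lemma thinned_ge0 g v : 0 <= thinned g v.
Proof. by rewrite divr_ge0 ?mulr_ge0 ?kept_mass_ge0. Qed.

Lemma thinned_sum_le1 g : \sum_v thinned g v <= 1.
Proof.
rewrite -mulr_suml -/(kept_mass g).
by have [->|/divff ->//] := eqVneq (kept_mass g) 0; rewrite mul0r.
Qed.

(** Given that [v] is kept, the diagonal term contributes p v and, by pairwise independence, the
    others at most (1 - p v) / #|F|. So the normalising sum is about 1 / #|F| on average once (#|F|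
    - 1) p v is small; the factor #|F| - 1 makes this condition void for a single frozen bin. *)
Lemma expect_kept_mass v :
  #|F|%:R ^+ 2 * expect unif_hash (fun g => (kept g (j v))%:R * kept_mass g) <=
  1 + (#|F|%:R - 1) * p v.
Proof.
have -> : (fun g => (kept g (j v))%:R * kept_mass g) =
    fun g => p v * (kept g (j v))%:R +
      \sum_(v' | v' != v) p v' * ((kept g (j v))%:R * (kept g (j v'))%:R).
  apply/funext => g; rewrite /kept_mass (bigD1 v)//= mulrDr; congr (_ + _).
    by case: kept; rewrite ?mulr0 ?mul0r// !mulr1 mul1r.
  by rewrite mulr_sumr; apply: eq_bigr => v' _; ring.
have -> : expect unif_hash (fun g => p v * (kept g (j v))%:R +
      \sum_(v' | v' != v) p v' * ((kept g (j v))%:R * (kept g (j v'))%:R)) =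
    p v * #|F|%:R^-1 + (\sum_(v' | v' != v) p v') * (#|F|%:R^-1 * #|F|%:R^-1).
  rewrite expectD expectZ expect_kept; congr (_ + _).
  rewrite mulr_suml /expect; under eq_bigr => g _ do rewrite mulr_sumr.
  rewrite exchange_big/=; apply: eq_bigr => v' v'v.
  rewrite -(@expect_kept2 (j v) (j v')) -?expectZ//.
  by rewrite eq_sym (inj_eq j_inj).
have : \sum_(v' | v' != v) p v' <= 1 - p v.
  by move: p1; rewrite (bigD1 v)//= lerBrDl.
set s := \sum_(_ | _) _ => s1.
rewrite (_ : _ * _ = #|F|%:R * p v + s); first by lra.
by field; rewrite gt_eqF.
Qed.

End Hashing.

Section Collision.
Context {R : realType} {U V F0 B0 F1 B1 : finType}.
Variables (f0 : F0) (b0 : B0) (f1 : F1) (b1 : B1) (T : U -> V -> bool).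

(** Only competitors are excluded: the true pair may itself fail [T], and then the decoder finds no
    candidate. This separates collisions from atypicality and allows an empty [T] for a receiver
    that does not decode. *)
Definition uncollided (g0 : {ffun U -> F0 * B0}) (g1 : {ffun U * V -> F1 * B1})
    (u : U) (v : V) : bool :=
  [forall c : U * V, [&& T c.1 c.2, g0 c.1 == g0 u & g1 c == g1 (u, v)] ==>
    (c == (u, v))].

(** Competitors with another u must collide in both hashes, those with the same u only in the hash
    of pairs. The first sum runs over all pairs, an overcount that makes it independent of [u]. *)
Definition collision_bound (u : U) : R :=
  (\sum_(c : U * V) (T c.1 c.2)%:R) * (#|{: F0 * B0}|%:R^-1 * #|{: F1 * B1}|%:R^-1)
  + (\sum_v (T u v)%:R) * #|{: F1 * B1}|%:R^-1.

Lemma expect_collision u v :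
  expect (fun h => unif_hash h.1 * unif_hash h.2)
    (fun h : {ffun U -> F0 * B0} * {ffun U * V -> F1 * B1} =>
      (kept f0 h.1 u)%:R * (kept f1 h.2 (u, v))%:R *
      (~~ uncollided h.1 h.2 u v)%:R) <=
  #|F0|%:R^-1 * #|F1|%:R^-1 * collision_bound u.
Proof.
pose k0 (g : {ffun U -> F0 * B0}) : R := (kept f0 g u)%:R.
pose k1 (g : {ffun U * V -> F1 * B1}) : R := (kept f1 g (u, v))%:R.
pose e0 c (g : {ffun U -> F0 * B0}) : R := (g c == g u)%:R.
pose e1 c (g : {ffun U * V -> F1 * B1}) : R := (g c == g (u, v))%:R.
have union h : k0 h.1 * k1 h.2 * (~~ uncollided h.1 h.2 u v)%:R <=
    \sum_(c : U * V | c.1 != u) (T c.1 c.2)%:R *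
      ((k0 h.1 * e0 c.1 h.1) * (k1 h.2 * e1 c h.2)) +
    \sum_(v' | v' != v) (T u v')%:R * (k0 h.1 * (k1 h.2 * e1 (u, v') h.2)).
  have pos1 c : 0 <= (T c.1 c.2)%:R *
      ((k0 h.1 * e0 c.1 h.1) * (k1 h.2 * e1 c h.2)).
    by rewrite !mulr_ge0 ?ler0n.
  have pos2 v' : 0 <= (T u v')%:R * (k0 h.1 * (k1 h.2 * e1 (u, v') h.2)).
    by rewrite !mulr_ge0 ?ler0n.
  case: (boolP (uncollided _ _ _ _)) => [_|]; first by rewrite mulr0 addr_ge0 ?sumr_ge0.
  rewrite negb_forall => /existsP[[u' v']]; rewrite negb_imply /=.
  case/andP=> /and3P[Tc eq0 eq1] ne; rewrite mulr1.
  have [eu|nu] := eqVneq u' u.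
    rewrite eu in Tc eq1 ne *; rewrite ler_wpDl ?sumr_ge0//.
    rewrite (bigD1 v')/=; last by apply: contraNneq ne => ->.
    rewrite Tc /e1 eq1 mul1r mulr1 lerDl sumr_ge0//.
  rewrite ler_wpDr ?sumr_ge0// (bigD1 (u', v'))//= Tc /e0 /e1 eq0 eq1 mul1r !mulr1.
  by rewrite lerDl sumr_ge0.
apply: le_trans (expect_le _ union) _.
  by move=> h; rewrite mulr_ge0 ?unif_hash_ge0.
rewrite expectD !expect_sum /collision_bound mulrDr; apply: lerD.
  rewrite -(mulrCA (\sum_c _)) mulr_suml.
  rewrite [leRHS](bigID (fun c : U * V => c.1 != u))/= ler_wpDr//.
    by rewrite sumr_ge0// => c _; rewrite !mulr_ge0 ?invr_ge0.
  apply: ler_sum => c cu; rewrite expectZ (expect_pair unif_hash unif_hash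
    (fun g => k0 g * e0 c.1 g) (fun g => k1 g * e1 c g)).
  rewrite (expect_kept_collision f0 b0); last by rewrite eq_sym.
  rewrite (expect_kept_collision f1 b1); last first.
    by apply: contraNneq cu => <-.
  by rewrite le_eqVlt; apply/orP; left; apply/eqP; ring.
rewrite -(mulrCA (\sum_c _)) mulr_suml.
rewrite [leRHS](bigID (fun c : V => c != v))/= ler_wpDr//.
  by rewrite sumr_ge0// => c _; rewrite !mulr_ge0 ?invr_ge0.
apply: ler_sum => c cv; rewrite expectZ (expect_pair unif_hash unif_hash
  k0 (fun g => k1 g * e1 (u, c) g)).
rewrite (expect_kept f0 b0) (expect_kept_collision f1 b1); last first.
  by apply: contraNneq cv => -[->].
by rewrite le_eqVlt; apply/orP; left; apply/eqP; ring.
Qed.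

End Collision.

(** * One-shot coding *)

Section OneShot.
Context {R : realType} {U V1 V2 F0 B0 F1 B1 F2 B2 : finType}.
Variables (f0 : F0) (b0 : B0) (f1 : F1) (b1 : B1) (f2 : F2) (b2 : B2).

Local Notation G0 := {ffun U -> F0 * B0}.
Local Notation G1 := {ffun U * V1 -> F1 * B1}.
Local Notation G2 := {ffun U * V2 -> F2 * B2}.

Definition unif_hash3 (g : G0 * G1 * G2) : R :=
  unif_hash g.1.1 * unif_hash g.1.2 * unif_hash g.2.

Lemma unif_hash3_ge0 g : 0 <= unif_hash3 g.
Proof. by rewrite !mulr_ge0 ?unif_hash_ge0. Qed.

Lemma unif_hash3_sum1 : \sum_g unif_hash3 g = 1.
Proof.
rewrite -(pair_bigA _ (fun (h : G0 * G1) g2 =>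
  unif_hash h.1 * unif_hash h.2 * unif_hash g2))/=.
under eq_bigr => h _ do rewrite -mulr_sumr (unif_hash_sum1 f2 b2) mulr1.
rewrite -(pair_bigA _ (fun (g0 : G0) (g1 : G1) => unif_hash g0 * unif_hash g1))/=.
under eq_bigr => h _ do rewrite -mulr_sumr (unif_hash_sum1 f1 b1) mulr1.
exact: unif_hash_sum1.
Qed.

Lemma expect_pair3 (F : G0 -> R) (G : G1 -> R) (H : G2 -> R) :
  expect unif_hash3 (fun g => F g.1.1 * G g.1.2 * H g.2) =
  expect unif_hash F * expect unif_hash G * expect unif_hash H.
Proof.
rewrite -(expect_pair unif_hash unif_hash F G).
by rewrite -(expect_pair (fun h => unif_hash h.1 * unif_hash h.2) unif_hash
  (fun h => F h.1 * G h.2) H).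
Qed.

Definition enc_weight (p0 : U -> R) (p1 : U -> V1 -> R) (p2 : U -> V2 -> R)
    (g : G0 * G1 * G2) (u : U) (v1 : V1) (v2 : V2) : R :=
  thinned f0 id p0 g.1.1 u * thinned f1 (pair u) (p1 u) g.1.2 v1 *
  thinned f2 (pair u) (p2 u) g.2 v2.

Section Term.
Variables (p0 : U -> R) (p1 : U -> V1 -> R) (p2 : U -> V2 -> R).
Hypotheses (p0_ge0 : forall u, 0 <= p0 u) (p1_ge0 : forall u v, 0 <= p1 u v)
  (p2_ge0 : forall u v, 0 <= p2 u v).
Hypotheses (p0_le1 : \sum_u p0 u <= 1) (p1_le1 : forall u, \sum_v p1 u v <= 1)
  (p2_le1 : forall u, \sum_v p2 u v <= 1).

Lemma enc_weight_ge0 g u v1 v2 : 0 <= enc_weight p0 p1 p2 g u v1 v2.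
Proof. by apply: mulr_ge0; [apply: mulr_ge0|]; apply: thinned_ge0. Qed.

Lemma enc_weight_le1 g :
  \sum_u \sum_v1 \sum_v2 enc_weight p0 p1 p2 g u v1 v2 <= 1.
Proof.
apply: le_trans (thinned_sum_le1 f0 id p0 g.1.1).
apply: ler_sum => u _.
rewrite -[leRHS]mulr1 -[leRHS]mulr1.
under eq_bigr => v1 _ do rewrite -mulr_sumr -mulrA.
rewrite -mulr_sumr -mulrA ler_wpM2l ?thinned_ge0// -mulr_suml.
by rewrite ler_pM ?sumr_ge0 ?thinned_sum_le1// => v _; rewrite thinned_ge0.
Qed.

Variables (T1 : U -> V1 -> bool) (T2 : U -> V2 -> bool).

Local Notation N0 := (#|F0|%:R : R).
Local Notation N1 := (#|F1|%:R : R).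
Local Notation N2 := (#|F2|%:R : R).

(* The encoder weight is [p / D] on the kept triples, and
   [1 / D >= 2 c - c ^ 2 D] for every [c], here for [c = N0 N1 N2]: this makes
   the bound linear in the random hashes. *)
Lemma enc_weight_lower (g : G0 * G1 * G2) u v1 v2 :
  p0 u * p1 u v1 * p2 u v2 *
    (2 * (N0 * N1 * N2) * ((kept f0 g.1.1 u)%:R * (kept f1 g.1.2 (u, v1))%:R *
       (kept f2 g.2 (u, v2))%:R)
     - 2 * (N0 * N1 * N2) * ((kept f0 g.1.1 u)%:R * (kept f1 g.1.2 (u, v1))%:R *
       (~~ uncollided T1 g.1.1 g.1.2 u v1)%:R * (kept f2 g.2 (u, v2))%:R)
     - 2 * (N0 * N1 * N2) * ((kept f0 g.1.1 u)%:R * (kept f2 g.2 (u, v2))%:R *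
       (~~ uncollided T2 g.1.1 g.2 u v2)%:R * (kept f1 g.1.2 (u, v1))%:R)
     - (N0 * N1 * N2) ^+ 2 *
       (((kept f0 g.1.1 u)%:R * kept_mass f0 id p0 g.1.1) *
        ((kept f1 g.1.2 (u, v1))%:R * kept_mass f1 (pair u) (p1 u) g.1.2) *
        ((kept f2 g.2 (u, v2))%:R * kept_mass f2 (pair u) (p2 u) g.2))) <=
  enc_weight p0 p1 p2 g u v1 v2 *
    (uncollided T1 g.1.1 g.1.2 u v1 && uncollided T2 g.1.1 g.2 u v2)%:R.
Proof.
set c := N0 * N1 * N2.
have [z0|nz] := eqVneq (p0 u * p1 u v1 * p2 u v2) 0.
  by rewrite z0 mul0r mulr_ge0 ?enc_weight_ge0 ?ler0n.
have : 0 < p0 u by rewrite lt0r p0_ge0 andbT; apply: contraNneq nz => ->; rewrite !mul0r.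
have : 0 < p1 u v1.
  by rewrite lt0r p1_ge0 andbT; apply: contraNneq nz => ->; rewrite mulr0 mul0r.
have : 0 < p2 u v2.
  by rewrite lt0r p2_ge0 andbT; apply: contraNneq nz => ->; rewrite mulr0.
move=> pos2 pos1 pos0.
rewrite /enc_weight /thinned.
(* A kept symbol of positive mass makes its normalising sum positive; a symbol that is not kept
   makes both sides vanish. *)
have m0 : kept f0 g.1.1 (id u) -> _ := kept_mass_ge p0_ge0 (v := u).
have m1 : kept f1 g.1.2 (pair u v1) -> _ := kept_mass_ge (p1_ge0 u) (v := v1).
have m2 : kept f2 g.2 (pair u v2) -> _ := kept_mass_ge (p2_ge0 u) (v := v2).
case: (kept f0 g.1.1 u) m0 => m0; last by rewrite !(mulr0, mul0r, subr0).
case: (kept f1 g.1.2 (u, v1)) m1 => m1; last by rewrite !(mulr0, mul0r, subr0).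
case: (kept f2 g.2 (u, v2)) m2 => m2; last by rewrite !(mulr0, mul0r, subr0).
have {m0} := lt_le_trans pos0 (m0 isT).
have {m1} := lt_le_trans pos1 (m1 isT).
have {m2} := lt_le_trans pos2 (m2 isT).
move: (kept_mass f2 _ _ _) (kept_mass f1 _ _ _) (kept_mass f0 _ _ _) => D2 D1 D0.
move=> D2p D1p D0p; rewrite !(mulr1, mul1r).
rewrite [leRHS](_ : _ = p0 u * p1 u v1 * p2 u v2 *
  ((D0 * D1 * D2)^-1 * (uncollided T1 g.1.1 g.1.2 u v1 && uncollided T2 g.1.1 g.2 u v2)%:R)); last first.
  by field; rewrite !gt_eqF.
apply: ler_wpM2l; first by rewrite !mulr_ge0.
have : 0 < D0 * D1 * D2 by rewrite !mulr_gt0.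
have : 0 <= c by rewrite !mulr_ge0.
move: (D0 * D1 * D2) => D c0 Dp.
have tangent : 2 * c - c ^+ 2 * D <= D^-1.
  rewrite -subr_ge0 (_ : _ - _ = (1 - c * D) ^+ 2 / D).
    by rewrite mulr_ge0 ?sqr_ge0 ?invr_ge0 ?ltW.
  by field; rewrite gt_eqF.
have sq : 0 <= c ^+ 2 * D by rewrite mulr_ge0 ?sqr_ge0// ltW.
have Vp : 0 <= D^-1 by rewrite invr_ge0 ltW.
case: uncollided; case: uncollided => /=;
  rewrite ?(mulr0n, mulr1n, mulr1, mulr0, mul0r, subr0); lra.
Qed.

(** With c = N0 N1 N2 the main term averages to 2, the collision terms to at most 2 kappa1 and 2
    kappa2, and the quadratic term, a product of second moments over three independent hashes, to at
    most (1 + eta) ^ 3. When the errors vanish, the tangent bound gives back 2 - 1 = 1. *)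
Lemma enc_weight_success u v1 v2 (eta kappa1 kappa2 : R) :
  (N0 - 1) * p0 u <= eta -> (N1 - 1) * p1 u v1 <= eta ->
  (N2 - 1) * p2 u v2 <= eta ->
  collision_bound (F0 := F0) (B0 := B0) (F1 := F1) (B1 := B1) T1 u <= kappa1 ->
  collision_bound (F0 := F0) (B0 := B0) (F1 := F2) (B1 := B2) T2 u <= kappa2 ->
  p0 u * p1 u v1 * p2 u v2 * (2 - 2 * kappa1 - 2 * kappa2 - (1 + eta) ^+ 3) <=
  expect unif_hash3 (fun g => enc_weight p0 p1 p2 g u v1 v2 *
    (uncollided T1 g.1.1 g.1.2 u v1 && uncollided T2 g.1.1 g.2 u v2)%:R).
Proof.
move=> e0 e1 e2 c1 c2.
apply: le_trans (expect_le unif_hash3_ge0 (fun g => enc_weight_lower g u v1 v2)).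
rewrite expectZ ler_wpM2l ?mulr_ge0// !expectB !expectZ.
have N0p : 0 < N0 by rewrite ltr0n; apply/card_gt0P; exists f0.
have N1p : 0 < N1 by rewrite ltr0n; apply/card_gt0P; exists f1.
have N2p : 0 < N2 by rewrite ltr0n; apply/card_gt0P; exists f2.
have N0k : 1 <= N0 by rewrite ler1n -(ltr_nat R).
have N1k : 1 <= N1 by rewrite ler1n -(ltr_nat R).
have N2k : 1 <= N2 by rewrite ler1n -(ltr_nat R).
set c := N0 * N1 * N2.
have cp : 0 < c by rewrite !mulr_gt0.
have E1 : 2 * c * expect unif_hash3 (fun g => (kept f0 g.1.1 u)%:R *
    (kept f1 g.1.2 (u, v1))%:R * (kept f2 g.2 (u, v2))%:R) = 2.
  rewrite (expect_pair3 (fun g => (kept f0 g u)%:R)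
    (fun g => (kept f1 g (u, v1))%:R) (fun g => (kept f2 g (u, v2))%:R)).
  by rewrite !expect_kept// /c; field; rewrite !gt_eqF.
have E2 : 2 * c * expect unif_hash3 (fun g => (kept f0 g.1.1 u)%:R *
    (kept f1 g.1.2 (u, v1))%:R * (~~ uncollided T1 g.1.1 g.1.2 u v1)%:R *
    (kept f2 g.2 (u, v2))%:R) <= 2 * kappa1.
  rewrite (expect_pair (fun h => unif_hash h.1 * unif_hash h.2) unif_hash
    (fun h => (kept f0 h.1 u)%:R * (kept f1 h.2 (u, v1))%:R *
      (~~ uncollided T1 h.1 h.2 u v1)%:R) (fun g => (kept f2 g (u, v2))%:R)).
  rewrite (expect_kept f2 b2).
  apply: (@le_trans _ _ (2 * c * (N0^-1 * N1^-1 * collision_bound (F0 := F0) (B0 := B0) (F1 := F1) (B1 := B1) T1 u * N2^-1))).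
    apply: ler_wpM2l; first by rewrite mulr_ge0// ltW.
    by apply: ler_wpM2r; [rewrite invr_ge0|exact: expect_collision].
  rewrite [leLHS](_ : _ = 2 * collision_bound (F0 := F0) (B0 := B0) (F1 := F1) (B1 := B1) T1 u); last first.
    by rewrite /c; field; rewrite !gt_eqF.
  by rewrite ler_wpM2l.
have E3 : 2 * c * expect unif_hash3 (fun g => (kept f0 g.1.1 u)%:R *
    (kept f2 g.2 (u, v2))%:R * (~~ uncollided T2 g.1.1 g.2 u v2)%:R *
    (kept f1 g.1.2 (u, v1))%:R) <= 2 * kappa2.
  rewrite (expect_pair13 unif_hash unif_hash unif_hash
    (fun g0 g2 => (kept f0 g0 u)%:R * (kept f2 g2 (u, v2))%:R *
      (~~ uncollided T2 g0 g2 u v2)%:R) (fun g => (kept f1 g (u, v1))%:R)).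
  rewrite (expect_kept f1 b1).
  apply: (@le_trans _ _ (2 * c * (N0^-1 * N2^-1 * collision_bound (F0 := F0) (B0 := B0) (F1 := F2) (B1 := B2) T2 u * N1^-1))).
    apply: ler_wpM2l; first by rewrite mulr_ge0// ltW.
    by apply: ler_wpM2r; [rewrite invr_ge0|exact: expect_collision].
  rewrite [leLHS](_ : _ = 2 * collision_bound (F0 := F0) (B0 := B0) (F1 := F2) (B1 := B2) T2 u); last first.
    by rewrite /c; field; rewrite !gt_eqF.
  by rewrite ler_wpM2l.
have E4 : c ^+ 2 * expect unif_hash3 (fun g =>
    ((kept f0 g.1.1 u)%:R * kept_mass f0 id p0 g.1.1) *
    ((kept f1 g.1.2 (u, v1))%:R * kept_mass f1 (pair u) (p1 u) g.1.2) *
    ((kept f2 g.2 (u, v2))%:R * kept_mass f2 (pair u) (p2 u) g.2)) <= (1 + eta) ^+ 3.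
  rewrite (expect_pair3 (fun g => (kept f0 g u)%:R * kept_mass f0 id p0 g)
    (fun g => (kept f1 g (u, v1))%:R * kept_mass f1 (pair u) (p1 u) g)
    (fun g => (kept f2 g (u, v2))%:R * kept_mass f2 (pair u) (p2 u) g)).
  have i1 : injective (@pair U V1 u) by move=> ? ? [].
  have i2 : injective (@pair U V2 u) by move=> ? ? [].
  have M0 := expect_kept_mass f0 b0 (@inj_id U) p0_le1 u.
  have M1 := expect_kept_mass f1 b1 i1 (p1_le1 u) v1.
  have M2 := expect_kept_mass f2 b2 i2 (p2_le1 u) v2.
  have pos (T F B V : finType) (f : F) (j : V -> T) (p : V -> R) v :
      (forall v, 0 <= p v) -> 0 <= expect unif_hash
      (fun g : {ffun T -> F * B} => (kept f g (j v))%:R * kept_mass f j p g).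
    move=> pp; apply: sumr_ge0 => g _.
    by rewrite !mulr_ge0 ?unif_hash_ge0 ?kept_mass_ge0.
  have H0 := pos _ _ B0 _ f0 id p0 u p0_ge0.
  have H1 := pos _ _ B1 _ f1 (pair u) _ v1 (p1_ge0 u).
  have H2 := pos _ _ B2 _ f2 (pair u) _ v2 (p2_ge0 u).
  have key (X0 X1 X2 : R) : 0 <= X0 -> 0 <= X1 -> 0 <= X2 ->
      N0 ^+ 2 * X0 <= 1 + eta -> N1 ^+ 2 * X1 <= 1 + eta ->
      N2 ^+ 2 * X2 <= 1 + eta -> c ^+ 2 * (X0 * X1 * X2) <= (1 + eta) ^+ 3.
    move=> X0p X1p X2p h0 h1 h2.
    rewrite (_ : c ^+ 2 * _ =
      (N0 ^+ 2 * X0) * (N1 ^+ 2 * X1) * (N2 ^+ 2 * X2)); last by rewrite /c; ring.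
    rewrite (_ : (1 + eta) ^+ 3 = (1 + eta) * (1 + eta) * (1 + eta)); last by ring.
    by do 2 ?apply: ler_pM; rewrite // ?mulr_ge0 ?sqr_ge0.
  apply: key => //.
  - by apply: le_trans M0 _; rewrite lerD2l.
  - by apply: le_trans M1 _; rewrite lerD2l.
  - by apply: le_trans M2 _; rewrite lerD2l.
lra.
Qed.

End Term.
End OneShot.

(** * Mean of a likelihood ratio evaluated at an estimate *)

Section ChangeOfMeasure.
Context {R : realType} {T TX TY TZ V M : finType}.
Variables (a : T -> R) (X : T -> TX) (Y : T -> TY) (Z : T -> TZ)
  (tau : TY -> TZ -> V -> R).
Hypotheses (a_ge0 : forall t, 0 <= a t) (a_sum1 : \sum_t a t = 1)
  (tau_ge0 : forall y z v, 0 <= tau y z v).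
Hypothesis tau_mean : forall x z v,
  \sum_(t | (X t, Z t) == (x, z)) a t * tau (Y t) z v <=
  \sum_(t | (X t, Z t) == (x, z)) a t.
Variables (n : nat) (e : {ffun 'I_n -> TX} -> finpmf R M)
  (est : {ffun 'I_n -> TZ} -> M -> option {ffun 'I_n -> V}).

Definition block_ratio (s : {ffun 'I_n -> T}) (ov : option {ffun 'I_n -> V}) : R :=
  if ov is Some v then \prod_i tau (Y (s i)) (Z (s i)) (v i) else 0.

(** The message depends on the source block through X only, the estimate on Z and the message. On a
    fibre of (X, Z) with the message fixed, the estimate is thus a fixed sequence chosen without
    looking at Y, and the mean of the ratio factors into single-letter means controlled by
    [tau_mean]. *)
Lemma change_of_measure :
  \sum_s \sum_m iid a s * e (block X s) m *
    block_ratio s (est (block Z s) m) <= 1.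
Proof.
pose q (s : {ffun 'I_n -> T}) : {ffun 'I_n -> TX * TZ} := [ffun i => (X (s i), Z (s i))].
rewrite (partition_big q xpredT)//=.
pose al (r : TX * TZ) := \sum_(t | (X t, Z t) == r) a t.
have al_ge0 r : 0 <= al r by apply: sumr_ge0.
apply: (@le_trans _ _ (\sum_(r : {ffun 'I_n -> TX * TZ}) \prod_i al (r i))); last first.
  rewrite -(bigA_distr_bigA (fun _ => al))/= big1// => i _.
  rewrite -a_sum1 [RHS](partition_big (fun t => (X t, Z t)) xpredT)//=.
apply: ler_sum => r _.
pose rx : {ffun 'I_n -> TX} := [ffun i => (r i).1].
pose rz : {ffun 'I_n -> TZ} := [ffun i => (r i).2].
have qx s : q s == r -> block X s = rx.
  by move=> /eqP qr; apply/ffunP => i; rewrite !ffunE -qr ffunE.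
have qz s : q s == r -> block Z s = rz.
  by move=> /eqP qr; apply/ffunP => i; rewrite !ffunE -qr ffunE.
rewrite exchange_big/=.
apply: (@le_trans _ _ (\sum_m e rx m * \prod_i al (r i))); last first.
  by rewrite -mulr_suml mass_sum1 mul1r.
apply: ler_sum => m _.
have -> : \sum_(s | q s == r) iid a s * e (block X s) m *
      block_ratio s (est (block Z s) m) =
    e rx m * \sum_(s | q s == r) iid a s * block_ratio s (est rz m).
  by rewrite mulr_sumr; apply: eq_bigr => s sr; rewrite qx// qz//; ring.
rewrite ler_wpM2l ?mass_ge0//.
case: (est rz m) => [v|]; last by rewrite big1 ?prodr_ge0// => s _; rewrite mulr0.
(* The indicator of the fibre is put inside each coordinate, so that the sum over blocks becomes a
   product of single-letter sums. *)
pose G i t := if (X t, Z t) == r i then a t * tau (Y t) (r i).2 (v i) else 0.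
have -> : \sum_(s | q s == r) iid a s * block_ratio s (Some v) =
    \sum_(s : {ffun 'I_n -> T}) \prod_i G i (s i).
  rewrite [RHS](bigID (fun s => q s == r))/= [X in _ + X]big1 ?addr0; last first.
    move=> s /eqP sr; apply/eqP; rewrite prodf_seq_eq0; apply/hasP.
    have [i si] : exists i, (X (s i), Z (s i)) != r i.
      apply/existsP; rewrite -negb_forall; apply/negP => /forallP H.
      by apply: sr; apply/ffunP => i; rewrite ffunE; exact/eqP.
    by exists i; rewrite ?mem_index_enum//= /G (negbTE si).
  apply: eq_bigr => s /eqP sr; rewrite -big_split/=; apply: eq_bigr => i _.
  by rewrite /G -sr !ffunE eqxx.
rewrite -(bigA_distr_bigA G)/=; apply: ler_prod => i _; apply/andP; split.
  by apply: sumr_ge0 => t _; rewrite /G; case: ifP => // _; rewrite mulr_ge0.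
rewrite -big_mkcond/= /al; case: (r i) => x z /=; exact: tau_mean.
Qed.

End ChangeOfMeasure.

Section Pushforward.
Context {R : realType} {W M : finType} (w : W -> R) (mu : W -> M) (m0 : M).
Hypotheses (w_ge0 : forall t, 0 <= w t) (w_le1 : \sum_t w t <= 1).

Let push (m : M) : R :=
  \sum_t w t * (mu t == m)%:R + (1 - \sum_t w t) * (m0 == m)%:R.

Let push_ge0 m : 0 <= push m.
Proof.
rewrite addr_ge0 ?mulr_ge0 ?subr_ge0//.
by apply: sumr_ge0 => t _; rewrite mulr_ge0.
Qed.

Let indic_sum1 (a : M) : \sum_m (a == m)%:R = 1 :> R.
Proof.
by rewrite (bigD1 a)//= eqxx big1 ?addr0// => m; rewrite eq_sym => /negbTE ->.
Qed.

Let push_sum1 : \sum_m push m = 1.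
Proof.
rewrite big_split/= -mulr_sumr indic_sum1 mulr1 exchange_big/=.
under eq_bigr => t _ do rewrite -mulr_sumr indic_sum1 mulr1.
by rewrite addrC subrK.
Qed.

Definition push_pmf : finpmf R M := Pmf push_ge0 push_sum1.

(** The missing mass goes to the default message [m0]; it only adds to the right-hand side because
    [phi] is nonnegative. *)
Lemma push_pmf_ge (phi : M -> R) : (forall m, 0 <= phi m) ->
  \sum_t w t * phi (mu t) <= \sum_m push_pmf m * phi m.
Proof.
move=> phi0; rewrite /push_pmf /= /push.
under [leRHS]eq_bigr => m _ do rewrite mulrDl.
rewrite big_split/= ler_wpDr//.
  by apply: sumr_ge0 => m _; rewrite !mulr_ge0// subr_ge0.
under [leRHS]eq_bigr => m _ do rewrite mulr_suml.
rewrite exchange_big/=; apply: ler_sum => t _.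
rewrite (bigD1 (mu t))//= eqxx mulr1 lerDl sumr_ge0// => m _.
by rewrite !mulr_ge0.
Qed.

End Pushforward.

Section Decode.
Context {U V F0 B0 F1 B1 : finType} (f0 : F0) (f1 : F1) (T : U -> V -> bool).

Definition hash_decode (g0 : {ffun U -> F0 * B0}) (g1 : {ffun U * V -> F1 * B1})
    (b0 : B0) (b1 : B1) : option (U * V) :=
  [pick c | [&& T c.1 c.2, g0 c.1 == (f0, b0) & g1 c == (f1, b1)]].

Lemma hash_decodeP g0 g1 u v : kept f0 g0 u -> kept f1 g1 (u, v) ->
  uncollided T g0 g1 u v ->
  hash_decode g0 g1 (g0 u).2 (g1 (u, v)).2 = if T u v then Some (u, v) else None.
Proof.
rewrite /kept => /eqP k0 /eqP k1 /forallP unc.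
have g0u : g0 u = (f0, (g0 u).2) by rewrite -k0 -surjective_pairing.
have g1u : g1 (u, v) = (f1, (g1 (u, v)).2) by rewrite -k1 -surjective_pairing.
rewrite /hash_decode -g0u -g1u; case: pickP => [c /and3P[Tc e0 e1]|none].
  have := unc c; rewrite Tc e0 e1 /= => /eqP cE.
  by rewrite cE /= in Tc *; rewrite Tc.
by have := none (u, v); rewrite /= !eqxx !andbT => ->.
Qed.

End Decode.

Section SubProbability.
Context {R : realType}.

(** Total mass below 1 has to be allowed: a conditional law given a null event is identically
    zero. *)
Record subpmf {U : finType} (p : U -> R) : Prop := SubPmf {
  subpmf_ge0 : forall u, 0 <= p u;
  subpmf_le1 : \sum_u p u <= 1 }.

End SubProbability.

(** * Fixing the hashes *)

Section Derandomisation.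
Context {R : realType} {S A C1 C2 U V1 V2 F0 B0 F1 B1 F2 B2 : finType}.
Variables (f0 : F0) (b0 : B0) (f1 : F1) (b1 : B1) (f2 : F2) (b2 : B2).
Variables (P : finpmf R S) (xs : S -> A) (z1 : S -> C1) (z2 : S -> C2).
Variables (p0 : A -> U -> R) (p1 : A -> U -> V1 -> R) (p2 : A -> U -> V2 -> R).
Hypotheses (p0_sub : forall x, subpmf (p0 x))
  (p1_sub : forall x u, subpmf (p1 x u)) (p2_sub : forall x u, subpmf (p2 x u)).
Variables (T1 : C1 -> U -> V1 -> bool) (T2 : C2 -> U -> V2 -> bool).

Local Notation W := (U * V1 * V2)%type.

Definition channel_weight (x : A) (t : W) : R :=
  p0 x t.1.1 * p1 x t.1.1 t.1.2 * p2 x t.1.1 t.2.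

Lemma channel_weight_ge0 x t : 0 <= channel_weight x t.
Proof.
by rewrite !mulr_ge0 ?(subpmf_ge0 (p0_sub _)) ?(subpmf_ge0 (p1_sub _ _))
  ?(subpmf_ge0 (p2_sub _ _)).
Qed.

Lemma channel_weight_le1 x : \sum_t channel_weight x t <= 1.
Proof.
rewrite /channel_weight -(pair_bigA _ (fun (c : U * V1) v2 =>
  p0 x c.1 * p1 x c.1 c.2 * p2 x c.1 v2))/=.
rewrite -(pair_bigA _ (fun u v1 => \sum_v2 p0 x u * p1 x u v1 * p2 x u v2))/=.
apply: le_trans (subpmf_le1 (p0_sub x)); apply: ler_sum => u _.
under eq_bigr => v1 _ do rewrite -mulr_sumr.
rewrite -mulr_suml -mulr_sumr -mulrA -[leRHS]mulr1.
apply: ler_wpM2l; first exact: subpmf_ge0 (p0_sub x) u.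
have h1 := subpmf_le1 (p1_sub x u); have h2 := subpmf_le1 (p2_sub x u).
by rewrite mulr_ile1 ?sumr_ge0// => v _;
  [exact: subpmf_ge0 (p1_sub x u) v|exact: subpmf_ge0 (p2_sub x u) v].
Qed.

Definition hash_success g (s : S) (t : W) : bool :=
  uncollided (F0 := F0) (B0 := B0) (F1 := F1) (B1 := B1) (T1 (z1 s)) g.1.1 g.1.2 t.1.1 t.1.2 &&
  uncollided (F0 := F0) (B0 := B0) (F1 := F2) (B1 := B2) (T2 (z2 s)) g.1.1 g.2 t.1.1 t.2.

Definition hash_weight g (x : A) (t : W) : R :=
  enc_weight f0 f1 f2 (B0 := B0) (B1 := B1) (B2 := B2) (p0 x) (p1 x) (p2 x) g t.1.1 t.1.2 t.2.

Lemma hash_weight_ge0 g x t : 0 <= hash_weight g x t.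
Proof.
apply: enc_weight_ge0; [exact: subpmf_ge0 (p0_sub _)|move=> ?|move=> ?].
  exact: subpmf_ge0 (p1_sub _ _).
exact: subpmf_ge0 (p2_sub _ _).
Qed.

Lemma hash_weight_le1 g x : \sum_t hash_weight g x t <= 1.
Proof.
rewrite /hash_weight -(pair_bigA _ (fun (c : U * V1) v2 =>
  enc_weight f0 f1 f2 (p0 x) (p1 x) (p2 x) g c.1 c.2 v2))/=.
rewrite -(pair_bigA _ (fun u v1 => \sum_v2
  enc_weight f0 f1 f2 (p0 x) (p1 x) (p2 x) g u v1 v2))/=.
apply: enc_weight_le1; [exact: subpmf_ge0 (p0_sub _)|move=> ?|move=> ?].
  exact: subpmf_ge0 (p1_sub _ _).
exact: subpmf_ge0 (p2_sub _ _).
Qed.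

Variables (Gam : S -> W -> bool) (eta kappa1 kappa2 : R).
Hypotheses (eta_ge0 : 0 <= eta) (kappa1_ge0 : 0 <= kappa1) (kappa2_ge0 : 0 <= kappa2).
Hypotheses
  (Gam0 : forall s t, Gam s t -> (#|F0|%:R - 1) * p0 (xs s) t.1.1 <= eta)
  (Gam1 : forall s t, Gam s t -> (#|F1|%:R - 1) * p1 (xs s) t.1.1 t.1.2 <= eta)
  (Gam2 : forall s t, Gam s t -> (#|F2|%:R - 1) * p2 (xs s) t.1.1 t.2 <= eta)
  (GamT1 : forall s t, Gam s t ->
    collision_bound (F0 := F0) (B0 := B0) (F1 := F1) (B1 := B1) (T1 (z1 s)) t.1.1 <= kappa1)
  (GamT2 : forall s t, Gam s t ->
    collision_bound (F0 := F0) (B0 := B0) (F1 := F2) (B1 := B2) (T2 (z2 s)) t.1.1 <= kappa2).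

(** Pointwise, averaging over the hashes preserves at least a fraction 1 - kap of the channel weight
    on [Gam]; as that weight totals at most 1, the loss is at most kap. One choice of hashes, common
    to all source blocks, does as well as the average. *)
Lemma good_hash : exists g,
  (\sum_s \sum_t P s * channel_weight (xs s) t * (Gam s t)%:R) -
    (2 * kappa1 + 2 * kappa2 + ((1 + eta) ^+ 3 - 1)) <=
  \sum_s \sum_t P s * hash_weight g (xs s) t * (Gam s t && hash_success g s t)%:R.
Proof.
pose kap := 2 * kappa1 + 2 * kappa2 + ((1 + eta) ^+ 3 - 1).
have kap0 : 0 <= kap.
  have H : 1 <= (1 + eta) ^+ 3 by rewrite exprn_ege1// lerDl.
  by rewrite /kap addr_ge0 ?subr_ge0 ?addr_ge0 ?mulr_ge0.
pose val g := \sum_s \sum_t P s * hash_weight g (xs s) t *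
  (Gam s t && hash_success g s t)%:R.
apply: (expect_attained (w := unif_hash3)).
- exact: unif_hash3_ge0.
- exact: unif_hash3_sum1.
rewrite expect_sum.
under [leRHS]eq_bigr => s _ do rewrite expect_sum.
apply: (@le_trans _ _ (\sum_s \sum_t P s * channel_weight (xs s) t * (Gam s t)%:R * (1 - kap))).
  have tot : \sum_s \sum_t P s * channel_weight (xs s) t * (Gam s t)%:R <= 1.
    rewrite -[leRHS](mass_sum1 P); apply: ler_sum => s _.
    rewrite -[leRHS]mulr1.
    apply: le_trans (ler_wpM2l (mass_ge0 P s) (channel_weight_le1 (xs s))).
    rewrite mulr_sumr; apply: ler_sum => t _.
    rewrite -[leRHS]mulr1; apply: ler_wpM2l.
      by apply: mulr_ge0; [exact: mass_ge0|exact: channel_weight_ge0].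
    by case: Gam; rewrite ?ler01.
  under [leRHS]eq_bigr => s _ do rewrite -mulr_suml.
  rewrite -mulr_suml -/kap mulrBr mulr1 lerD2l lerN2.
  by rewrite -[leRHS]mul1r ler_wpM2r.
apply: ler_sum => s _; apply: ler_sum => t _.
have -> : expect unif_hash3 (fun g => P s * hash_weight g (xs s) t *
    (Gam s t && hash_success g s t)%:R) =
    P s * ((Gam s t)%:R * expect unif_hash3 (fun g => hash_weight g (xs s) t *
    (hash_success g s t)%:R)).
  rewrite -!expectZ; congr expect; apply/funext => g.
  by case: Gam; rewrite /= ?mul1r ?mul0r ?mulr0// mulrA.
case: (boolP (Gam s t)) => G; last by rewrite !(mulr0, mul0r).
rewrite mulr1 mul1r -mulrA ler_wpM2l ?mass_ge0//.
have := enc_weight_success f0 b0 f1 b1 f2 b2 _ _ _ _ _ _ (Gam0 G) (Gam1 G) (Gam2 G)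
  (GamT1 G) (GamT2 G).
rewrite (_ : 2 - 2 * kappa1 - 2 * kappa2 - (1 + eta) ^+ 3 = 1 - kap); last by rewrite /kap; ring.
apply.
- exact: subpmf_ge0 (p0_sub _).
- by move=> u; exact: subpmf_ge0 (p1_sub _ _).
- by move=> u; exact: subpmf_ge0 (p2_sub _ _).
- exact: subpmf_le1 (p0_sub _).
- by move=> u; exact: subpmf_le1 (p1_sub _ _).
- by move=> u; exact: subpmf_le1 (p2_sub _ _).
Qed.

End Derandomisation.

Section NetworkLaw.
Context {R : realType} {TX TY1 TY2 TZ1 TZ2 : finType} {R0 R1 R2 : R} {n : nat}.
Local Notation S := (TX * TY1 * TY2 * TZ1 * TZ2)%type.
Variables (c : Defs.code (TX := TX) (TY1 := TY1) (TY2 := TY2) (TZ1 := TZ1) (TZ2 := TZ2) R0 R1 R2 n)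
  (P : finpmf R S).

Lemma network_law_ge0 w : 0 <= network_law c P w.
Proof. by rewrite mulr_ge0 ?mass_ge0 ?iid_ge0. Qed.

Lemma network_law_sum1 : \sum_w network_law c P w = 1.
Proof.
rewrite -(iid_sum1 P n) -(pair_bigA _ (fun s m => network_law c P (s, m)))/=.
by apply: eq_bigr => s _; rewrite /network_law /= -mulr_sumr mass_sum1 mulr1.
Qed.

End NetworkLaw.

(** * The code attached to fixed hashes *)

Section HashCode.
Context {R : realType} {TX TY1 TY2 TZ1 TZ2 : finType}.
Local Notation S := (TX * TY1 * TY2 * TZ1 * TZ2)%type.
Variables (R0 R1 R2 : R) (n : nat).
Context {U V1 V2 F0 B0 F1 A1 F2 A2 : finType}.
Local Notation B1 := (A1 * msg n R1)%type.
Local Notation B2 := (A2 * msg n R2)%type.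
Local Notation BX := {ffun 'I_n -> TX}.
Local Notation BY1 := {ffun 'I_n -> TY1}.
Local Notation BY2 := {ffun 'I_n -> TY2}.
Local Notation BZ1 := {ffun 'I_n -> TZ1}.
Local Notation BZ2 := {ffun 'I_n -> TZ2}.
Local Notation BU := {ffun 'I_n -> U}.
Local Notation BV1 := {ffun 'I_n -> V1}.
Local Notation BV2 := {ffun 'I_n -> V2}.
Local Notation W := (BU * BV1 * BV2)%type.
Variables (f0 : F0) (f1 : F1) (f2 : F2).
Variables (split0 : msg n R0 -> B0 * A1 * A2) (join0 : B0 * A1 * A2 -> msg n R0).
Hypothesis join0K : cancel join0 split0.
Variables (p0 : BX -> BU -> R) (p1 : BX -> BU -> BV1 -> R) (p2 : BX -> BU -> BV2 -> R).
Hypotheses (p0_sub : forall x, subpmf (p0 x))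
  (p1_sub : forall x u, subpmf (p1 x u)) (p2_sub : forall x u, subpmf (p2 x u)).
Variables (T1 : BZ1 -> BU -> BV1 -> bool) (T2 : BZ2 -> BU -> BV2 -> bool).
Variables (acc1 : BY1 -> BZ1 -> BV1 -> bool) (acc2 : BY2 -> BZ2 -> BV2 -> bool).
Variables (d1 d2 : bool).
Variable g : {ffun BU -> F0 * B0} * {ffun BU * BV1 -> F1 * B1} *
  {ffun BU * BV2 -> F2 * B2}.

Definition hash_message (t : W) : msg n R0 * msg n R1 * msg n R2 :=
  (join0 ((g.1.1 t.1.1).2, (g.1.2 (t.1.1, t.1.2)).2.1, (g.2 (t.1.1, t.2)).2.1),
   (g.1.2 (t.1.1, t.1.2)).2.2, (g.2 (t.1.1, t.2)).2.2).

Definition estimate1 (z : BZ1) (m0 : msg n R0) (m1 : msg n R1) :=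
  hash_decode f0 f1 (T1 z) g.1.1 g.1.2 (split0 m0).1.1 ((split0 m0).1.2, m1).

Definition estimate2 (z : BZ2) (m0 : msg n R0) (m2 : msg n R2) :=
  hash_decode f0 f2 (T2 z) g.1.1 g.2 (split0 m0).1.1 ((split0 m0).2, m2).

(** [d1] and [d2] are the decisions taken when no candidate is found: [true] rejects, while [false]
    makes a receiver that never decodes accept always. *)
Definition hash_code : Defs.code R0 R1 R2 n := Code
  (fun x => push_pmf hash_message (ord0, ord0, ord0)
    (hash_weight_ge0 f0 f1 f2 p0_sub p1_sub p2_sub g x)
    (hash_weight_le1 f0 f1 f2 p0_sub p1_sub p2_sub g x))
  (fun y z m0 m1 =>
    if estimate1 z m0 m1 is Some c then ~~ acc1 y z c.2 else d1)
  (fun y z m0 m2 =>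
    if estimate2 z m0 m2 is Some c then ~~ acc2 y z c.2 else d2).

Variables (P : finpmf R S) (Gam : {ffun 'I_n -> S} -> W -> bool).
Hypotheses
  (Gam1 : forall s t, Gam s t -> if T1 (block rvZ1 s) t.1.1 t.1.2
     then acc1 (block rvY1 s) (block rvZ1 s) t.1.2 else ~~ d1)
  (Gam2 : forall s t, Gam s t -> if T2 (block rvZ2 s) t.1.1 t.2
     then acc2 (block rvY2 s) (block rvZ2 s) t.2 else ~~ d2).

Local Notation success s t :=
  (Gam s t && hash_success (block rvZ1) (block rvZ2) T1 T2 g s t).

(** Correctness is asked only on kept triples, since the others have encoder weight zero; the mass
    moved to the default message is counted entirely as error. *)
Lemma hash_code_error
    (dec : {ffun 'I_n -> S} * (msg n R0 * msg n R1 * msg n R2) -> bool) :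
  (forall s t, success s t -> kept f0 g.1.1 t.1.1 ->
     kept f1 g.1.2 (t.1.1, t.1.2) -> kept f2 g.2 (t.1.1, t.2) ->
     dec (s, hash_message t) = false) ->
  type1_error hash_code P dec <=
  1 - \sum_s \sum_t iid P s * hash_weight f0 f1 f2 p0 p1 p2 g (block rvX s) t *
    (success s t)%:R.
Proof.
move=> ok; rewrite /type1_error /prob.
rewrite -[X in X - _](network_law_sum1 hash_code P).
rewrite [X in _ <= X - _](bigID (fun w => dec w == true))/= -addrA lerDl subr_ge0.
rewrite [leRHS](_ : _ = \sum_s \sum_m
    if dec (s, m) != true then network_law hash_code P (s, m) else 0); last first.
  by rewrite pair_bigA big_mkcond; apply: eq_bigr => -[].
apply: ler_sum => s _; rewrite /network_law /=.
under eq_bigr => t _ do rewrite -mulrA.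
rewrite -mulr_sumr.
apply: (@le_trans _ _ (iid P s * \sum_m enc hash_code (block rvX s) m * (~~ dec (s, m))%:R)); last first.
  rewrite mulr_sumr; apply: ler_sum => m _; rewrite eqb_id.
  by case: (dec (s, m)); rewrite /= ?mulr1 ?mulr0.
rewrite ler_wpM2l ?iid_ge0//.
apply: le_trans (push_pmf_ge _ _ _ _ _) => //.
apply: ler_sum => t _; have [kt|nk] := boolP [&& kept f0 g.1.1 t.1.1,
    kept f1 g.1.2 (t.1.1, t.1.2) & kept f2 g.2 (t.1.1, t.2)].
  apply: ler_wpM2l; first exact: hash_weight_ge0.
  by apply: ler_natb => H; case/and3P: kt => k0 k1 k2; rewrite ok.
have -> : hash_weight f0 f1 f2 p0 p1 p2 g (block rvX s) t = 0; last by rewrite !mul0r.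
rewrite /hash_weight /enc_weight /thinned.
case/nandP: nk => [/negbTE ->|/nandP[/negbTE ->|/negbTE ->]];
  by rewrite ?(mulr0, mul0r).
Qed.

Lemma hash_code_error1 : type1_error hash_code P (decision1 hash_code) <=
  1 - \sum_s \sum_t iid P s * hash_weight f0 f1 f2 p0 p1 p2 g (block rvX s) t *
    (success s t)%:R.
Proof.
apply: hash_code_error => s t /andP[G /andP[u1 u2]] k0 k1 k2 /=.
rewrite /estimate1 join0K /= -surjective_pairing hash_decodeP//.
have := Gam1 G; case: (T1 _ _ _) => /= [->//|]; exact: negbTE.
Qed.

Lemma hash_code_error2 : type1_error hash_code P (decision2 hash_code) <=
  1 - \sum_s \sum_t iid P s * hash_weight f0 f1 f2 p0 p1 p2 g (block rvX s) t *
    (success s t)%:R.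
Proof.
apply: hash_code_error => s t /andP[G /andP[u1 u2]] k0 k1 k2 /=.
rewrite /estimate2 join0K /= -surjective_pairing hash_decodeP//.
have := Gam2 G; case: (T2 _ _ _) => /= [->//|]; exact: negbTE.
Qed.

End HashCode.

(** * The type II error *)

Section TypeTwo.
Context {R : realType} {TX TY1 TY2 TZ1 TZ2 : finType}.
Local Notation S := (TX * TY1 * TY2 * TZ1 * TZ2)%type.
Variable P : finpmf R S.

Lemma law_ge0 {T TA : finType} (p : finpmf R T) (A : T -> TA) a : 0 <= law p A a.
Proof. by apply: sumr_ge0 => t _; exact: mass_ge0. Qed.

Lemma law_sum1 {T TA : finType} (p : finpmf R T) (A : T -> TA) :
  \sum_a law p A a = 1.
Proof. by rewrite -(mass_sum1 p) [RHS](partition_big A xpredT). Qed.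

Lemma law_fst {T TA TB : finType} (p : T -> R) (A : T -> TA) (B : T -> TB) b :
  \sum_a law p (fun t => (A t, B t)) (a, b) = law p B b.
Proof.
rewrite /law /prob [RHS](partition_big A xpredT)//=.
by apply: eq_bigr => a _; apply: eq_bigl => t; rewrite xpair_eqE andbC.
Qed.

Lemma claw_ge0 {T TA TB : finType} (p : finpmf R T) (A : T -> TA) (B : T -> TB) a b :
  0 <= claw p A B a b.
Proof. by rewrite divr_ge0 ?law_ge0. Qed.

Lemma claw_sum {T TA TB : finType} (p : finpmf R T) (A : T -> TA) (B : T -> TB) b :
  \sum_a claw p A B a b = (law p B b != 0)%:R.
Proof.
rewrite -mulr_suml law_fst.
by have [->|/divff ->] := eqVneq (law p B b) 0; rewrite ?mul0r.
Qed.

Lemma claw_subpmf {T TA TB : finType} (p : finpmf R T) (A : T -> TA) (B : T -> TB) b :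
  subpmf (fun a => claw p A B a b).
Proof.
split=> [a|]; first exact: claw_ge0.
by rewrite claw_sum; case: (_ != _); rewrite ?ler01.
Qed.

Lemma law_snd {T TA TB : finType} (p : T -> R) (A : T -> TA) (B : T -> TB) a :
  \sum_b law p (fun t => (A t, B t)) (a, b) = law p A a.
Proof.
by rewrite /law /prob [RHS](partition_big B xpredT).
Qed.

Lemma alt_law_ge0 s : 0 <= alt_law P s.
Proof.
by apply: mulr_ge0; [apply: mulr_ge0|]; [exact: law_ge0|exact: claw_ge0..].
Qed.

Lemma law_pair0 {T TA TB : finType} (p : finpmf R T) (A : T -> TA) (B : T -> TB) a b :
  law p B b = 0 -> law p (fun t => (A t, B t)) (a, b) = 0.
Proof.
move=> z; apply/eqP; rewrite eq_le law_ge0 andbT -z -(law_fst p A B) (bigD1 a)//= lerDl.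
by rewrite sumr_ge0// => c _; exact: law_ge0.
Qed.

Lemma alt_law_marginal1 x z (phi : TY1 -> R) :
  \sum_(t | (rvX t, rvZ1 t) == (x, z)) alt_law P t * phi (rvY1 t) =
  law P [% rvX, rvZ1] (x, z) * \sum_y claw P rvY1 rvZ1 y z * phi y.
Proof.
pose h (q : TY1 * TY2 * TZ2) : S := (x, q.1.1, q.1.2, z, q.2).
rewrite (reindex_onto h (fun t => (rvY1 t, rvY2 t, rvZ2 t)))/=; last first.
  by case=> [[[[a b] c] d] e] /eqP[-> ->].
rewrite (eq_bigl xpredT); last by case=> [[a b] c]; rewrite /h /= !eqxx.
rewrite -(pair_bigA _ (fun c z2 => alt_law P (x, c.1, c.2, z, z2) * phi c.1))/=.
rewrite -(pair_bigA _ (fun y1 y2 => \sum_z2 alt_law P (x, y1, y2, z, z2) * phi y1))/=.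
rewrite mulr_sumr; apply: eq_bigr => y1 _; rewrite exchange_big/=.
rewrite -(law_snd P [% rvX, rvZ1] rvZ2) mulr_suml; apply: eq_bigr => z2 _.
rewrite /alt_law /=.
transitivity (\sum_y2 law P [% rvX, rvZ1, rvZ2] (x, z, z2) *
    (claw P rvY1 rvZ1 y1 z * phi y1) * claw P rvY2 rvZ2 y2 z2).
  by apply: eq_bigr => y2 _; ring.
(* The law of Y2 given Z2 sums to 0 instead of 1 at a null z2, but there the law of (X, Z1, Z2)
   vanishes too. *)
rewrite -mulr_sumr claw_sum; have [z0|_] := eqVneq; last by rewrite mulr1.
by rewrite (law_pair0 _ _ z0) !mul0r.
Qed.

Lemma alt_law_marginal2 x z (phi : TY2 -> R) :
  \sum_(t | (rvX t, rvZ2 t) == (x, z)) alt_law P t * phi (rvY2 t) =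
  law P [% rvX, rvZ2] (x, z) * \sum_y claw P rvY2 rvZ2 y z * phi y.
Proof.
pose h (q : TY1 * TY2 * TZ1) : S := (x, q.1.1, q.1.2, q.2, z).
rewrite (reindex_onto h (fun t => (rvY1 t, rvY2 t, rvZ1 t)))/=; last first.
  by case=> [[[[a b] c] d] e] /eqP[-> ->].
rewrite (eq_bigl xpredT); last by case=> [[a b] c]; rewrite /h /= !eqxx.
rewrite -(pair_bigA _ (fun c z1 => alt_law P (x, c.1, c.2, z1, z) * phi c.2))/=.
rewrite -(pair_bigA _ (fun y1 y2 => \sum_z1 alt_law P (x, y1, y2, z1, z) * phi y2))/=.
rewrite exchange_big mulr_sumr; apply: eq_bigr => y2 _; rewrite exchange_big/=.
have -> : law P [% rvX, rvZ2] (x, z) =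
    \sum_z1 law P [% rvX, rvZ1, rvZ2] (x, z1, z).
  rewrite /law /prob [LHS](partition_big rvZ1 xpredT)//=.
  apply: eq_bigr => z1 _; apply: eq_bigl => t.
  by rewrite !xpair_eqE andbAC.
rewrite mulr_suml; apply: eq_bigr => z1 _.
rewrite /alt_law /=.
transitivity (\sum_y1 law P [% rvX, rvZ1, rvZ2] (x, z1, z) *
    (claw P rvY2 rvZ2 y2 z * phi y2) * claw P rvY1 rvZ1 y1 z1).
  by apply: eq_bigr => y1 _; ring.
rewrite -mulr_sumr claw_sum; have [z0|_] := eqVneq; last by rewrite mulr1.
suff -> : law P [% rvX, rvZ1, rvZ2] (x, z1, z) = 0 by rewrite !mul0r.
have le : law P [% rvX, rvZ1, rvZ2] (x, z1, z) <= law P rvZ1 z1.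
  rewrite /law /prob [leRHS](bigID (fun t => (rvX t, rvZ1 t, rvZ2 t) == (x, z1, z)))/=.
  rewrite (eq_bigl (fun t => (rvZ1 t == z1) && ((rvX t, rvZ1 t, rvZ2 t) == (x, z1, z)))).
    by rewrite lerDl sumr_ge0// => t _; exact: mass_ge0.
  by move=> t; rewrite !xpair_eqE; do 3 case: eqP.
by apply/eqP; rewrite eq_le law_ge0 andbT -z0.
Qed.

Lemma alt_law_sum1 : \sum_s alt_law P s = 1.
Proof.
rewrite (partition_big [% rvX, rvZ1] xpredT)//= -(law_sum1 P [% rvX, rvZ1]).
apply: eq_bigr => -[x z] _; under eq_bigr => t _ do rewrite -[alt_law P t]mulr1.
rewrite (alt_law_marginal1 x z (fun _ => 1)).
under eq_bigr => y _ do rewrite mulr1.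
rewrite claw_sum; have [z0|_] := eqVneq; last by rewrite mulr1.
by rewrite (law_pair0 _ _ z0) mul0r.
Qed.

Definition alt_pmf : finpmf R S := Pmf alt_law_ge0 alt_law_sum1.

Section Bound.
Context {R0 R1 R2 : R} {n : nat} 
  (c : Defs.code (TX := TX) (TY1 := TY1) (TY2 := TY2) (TZ1 := TZ1) (TZ2 := TZ2) R0 R1 R2 n).

Lemma type2_error_le1 dec : type2_error c P dec <= 1.
Proof.
rewrite /type2_error /prob -(network_law_sum1 c alt_pmf) [leRHS](bigID (fun w => dec w == false))/=.
by rewrite lerDl sumr_ge0// => w _; exact: (network_law_ge0 c alt_pmf).
Qed.

(* Under the alternative, the statistic is a likelihood ratio of mean at most
   one given everything the receiver knows besides its observation [Y]. *)
Lemma type2_error_le {TY TZ V : finType} (Y : S -> TY) (Z : S -> TZ)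
    (tau : TY -> TZ -> V -> R) est (th : R) dec :
  (forall x z (phi : TY -> R),
    \sum_(t | (rvX t, Z t) == (x, z)) alt_law P t * phi (Y t) =
    law P [% rvX, Z] (x, z) * \sum_y claw P Y Z y z * phi y) ->
  (forall y z v, 0 <= tau y z v) ->
  (forall z v, \sum_y claw P Y Z y z * tau y z v <= 1) ->
  0 < th ->
  (forall s m, dec (s, m) = false ->
    th <= block_ratio Y Z tau s (est (block Z s) m)) ->
  type2_error c P dec <= th^-1.
Proof.
move=> marg tau0 tau1 th0 ok.
have mean1 x z v : \sum_(t | (rvX t, Z t) == (x, z)) alt_law P t * tau (Y t) z v <=
    \sum_(t | (rvX t, Z t) == (x, z)) alt_law P t.
  have -> : \sum_(t | (rvX t, Z t) == (x, z)) alt_law P t =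
      law P [% rvX, Z] (x, z) * (law P Z z != 0)%:R.
    rewrite -(claw_sum P Y).
    transitivity (\sum_(t | (rvX t, Z t) == (x, z)) alt_law P t * 1).
      by apply: eq_bigr => t _; rewrite mulr1.
    rewrite (marg x z (fun _ => 1)); congr (_ * _).
    by apply: eq_bigr => y _; rewrite mulr1.
  rewrite (marg x z (fun y => tau y z v)); have [z0|_] := eqVneq (law P Z z) 0.
    by rewrite (law_pair0 _ _ z0) !mul0r.
  by rewrite ler_wpM2l ?law_ge0.
have := change_of_measure alt_law_ge0 alt_law_sum1 tau0 mean1 (enc c) est.
move=> le1; rewrite -[leRHS]mul1r ler_pdivlMr//; apply: le_trans le1.
rewrite [leLHS](_ : _ = \sum_s \sum_m if dec (s, m) == false then
    network_law c (alt_law P) (s, m) * th else 0); last first.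
  by rewrite /type2_error /prob mulr_suml pair_bigA big_mkcond; apply: eq_bigr => -[].
apply: ler_sum => s _; apply: ler_sum => m _.
have r0 : 0 <= block_ratio Y Z tau s (est (block Z s) m).
  by rewrite /block_ratio; case: (est _ _) => // v; apply: prodr_ge0.
have := network_law_ge0 c alt_pmf (s, m); rewrite /network_law /= => w0.
case: eqP => [E|_]; last by rewrite mulr_ge0.
by rewrite ler_wpM2l// ok.
Qed.

End Bound.
End TypeTwo.

(** * Typical blocks *)

Section Blocks.
Context {R : realType}.

Lemma pow2D (a b : R) : 2 `^ (a + b) = 2 `^ a * 2 `^ b.
Proof. by rewrite powRD// pnatr_eq0 implybT. Qed.

Lemma pow2_gt0 (a : R) : 0 < 2 `^ a.
Proof. exact: powR_gt0. Qed.

Lemma ler_pow2 (a b : R) : a <= b -> 2 `^ a <= 2 `^ b.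
Proof. by move=> ab; apply: ler_powR; rewrite ?ler1n. Qed.

Definition block_kernel {A B : finType} (k : A -> B -> R) n
    (a : {ffun 'I_n -> A}) (b : {ffun 'I_n -> B}) : R := \prod_i k (a i) (b i).

Definition block_kernel2 {A B C : finType} (k : A -> B -> C -> R) n
    (a : {ffun 'I_n -> A}) (b : {ffun 'I_n -> B}) (c : {ffun 'I_n -> C}) : R :=
  \prod_i k (a i) (b i) (c i).

Lemma block_subpmf {B : finType} n (k : 'I_n -> B -> R) :
  (forall i, subpmf (k i)) ->
  subpmf (fun b : {ffun 'I_n -> B} => \prod_i k i (b i)).
Proof.
move=> kp; split=> [b|]; first by apply: prodr_ge0 => i _; exact: subpmf_ge0.
rewrite -(bigA_distr_bigA k); apply: prodr_ile1 => i _.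
rewrite subpmf_le1// andbT; apply: sumr_ge0 => b _; exact: subpmf_ge0.
Qed.

Lemma subpmf_count {B : finType} (k : B -> R) (c : R) (T : pred B) :
  subpmf k -> 0 < c -> (forall b, T b -> c <= k b) ->
  \sum_b (T b)%:R <= c^-1.
Proof.
move=> kp c0 Tc; rewrite -[leRHS]mul1r ler_pdivlMr// mulr_suml.
apply: le_trans (subpmf_le1 kp); apply: ler_sum => b _.
by case: (boolP (T b)) => [/Tc|_]; rewrite ?mul1r// mul0r subpmf_ge0.
Qed.

(* For [0 <= r] the number of bins is exactly the floor of [2 `^ (n * r)]; the
   predecessor only serves to make the type inhabited for every [r]. *)
Definition bins (n : nat) (r : R) : finType := 'I_(Num.truncn (2 `^ (n%:R * r))).-1.+1.

(** The upper bound carries no rounding term, so that products of bins fit into one message; the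
    price is the factor 2 in the lower bound. *)
Lemma card_bins n r : 0 <= r ->
  2 `^ (n%:R * r) / 2 <= #|bins n r|%:R <= 2 `^ (n%:R * r).
Proof.
move=> r0; have ge1 : 1 <= 2 `^ (n%:R * r).
  by rewrite -[leLHS](powRr0 2) ler_pow2// mulr_ge0.
have /andP[lo hi] := truncn_itv (le_trans ler01 ge1).
have t0 : (0 < Num.truncn (2 `^ (n%:R * r)))%N by rewrite truncn_gt0.
rewrite card_ord prednK// lo andbT.
have t1 : 1 <= (Num.truncn (2 `^ (n%:R * r)))%:R :> R by rewrite ler1n.
by rewrite -natr1 in hi; rewrite ler_pdivrMr//; lra.
Qed.

Lemma card_msg n (r : R) :
  2 `^ (n%:R * r) <= #|msg n r|%:R <= 1 + 2 `^ (n%:R * r).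
Proof.
have /andP[lo hi] := truncn_itv (ltW (pow2_gt0 (n%:R * r))).
by rewrite card_ord (ltW hi) -natr1 addrC lerD2l.
Qed.

Lemma retraction {A B : finType} (a0 : A) : (#|A| <= #|B|)%N ->
  exists (f : A -> B) (h : B -> A), cancel f h.
Proof.
move=> AB; pose f a := enum_val (widen_ord AB (enum_rank a)).
have f_inj : injective f.
  by move=> a b /enum_val_inj/(congr1 val)/= /val_inj/enum_rank_inj.
exists f, (fun b => odflt a0 [pick a | f a == b]) => a.
by case: pickP => [b /eqP/f_inj//|/(_ a)]; rewrite eqxx.
Qed.

End Blocks.

Section TestChannel.
Context {R : realType} {TX TY1 TY2 TZ1 TZ2 U V1 V2 : finType}.
Local Notation S := (TX * TY1 * TY2 * TZ1 * TZ2)%type.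
Local Notation W := (U * V1 * V2)%type.

Definition joint_law (P : S -> R) (q0 : TX -> U -> R) (q1 : TX -> U -> V1 -> R)
    (q2 : TX -> U -> V2 -> R) (w : S * W) : R :=
  P w.1 * channel_weight q0 q1 q2 (rvX w.1) w.2.

Definition zip_blocks n (s : {ffun 'I_n -> S})
    (t : {ffun 'I_n -> U} * {ffun 'I_n -> V1} * {ffun 'I_n -> V2}) :
    {ffun 'I_n -> S * W} := [ffun i => (s i, (t.1.1 i, t.1.2 i, t.2 i))].

Lemma sum_zip_blocks n (F : {ffun 'I_n -> S * W} -> R) :
  \sum_w F w = \sum_s \sum_t F (zip_blocks s t).
Proof.
rewrite pair_bigA; apply: (reindex (fun a => zip_blocks a.1 a.2)).
exists (fun w : {ffun 'I_n -> S * W} => ([ffun i => (w i).1], ([ffun i => (w i).2.1.1],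
  [ffun i => (w i).2.1.2], [ffun i => (w i).2.2]))).
  by case=> s [[u v1] v2] _ /=; do !congr pair; apply/ffunP => i; rewrite !ffunE.
move=> w _; apply/ffunP => i; rewrite !ffunE /=.
by case: (w i) => s [[u v1] v2].
Qed.

Lemma iid_joint_law P q0 q1 q2 n s t :
  iid (joint_law P q0 q1 q2) (zip_blocks s t) =
  iid P s * channel_weight (block_kernel q0 (n := n)) (block_kernel2 q1 (n := n))
    (block_kernel2 q2 (n := n)) (block rvX s) t.
Proof.
rewrite /iid /joint_law /channel_weight /block_kernel /block_kernel2.
rewrite -!big_split/=; apply: eq_bigr => i _; rewrite !ffunE/=; ring.
Qed.

End TestChannel.

(* [k0], [k1] play the role of P(u0 | z), P(u_i | u0, z), and [tau] that of the
   likelihood ratio P(y | u_i, z) / P(y | z). *)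
Record side_kernels {R : realType} {T TY TZ U V : finType} (P : T -> R)
    (Y : T -> TY) (Z : T -> TZ) (k0 : TZ -> U -> R) (k1 : TZ -> U -> V -> R)
    (tau : TY -> TZ -> V -> R) : Prop := SideKernels {
  side_sub0 : forall z, subpmf (k0 z);
  side_sub1 : forall z u, subpmf (k1 z u);
  side_tau_ge0 : forall y z v, 0 <= tau y z v;
  side_tau_mean : forall z v, \sum_y claw P Y Z y z * tau y z v <= 1 }.

Definition mean_log {R : realType} {T : finType} (p : T -> R) (k : T -> R) : R :=
  \sum_t p t * log2 (k t).

Section TypicalBlocks.
Context {R : realType} {T : finType}.

Definition typical (p : T -> R) (d : R) (k : T -> R) n (s : {ffun 'I_n -> T}) : bool :=
  2 `^ (n%:R * (mean_log p k - d)) <= \prod_i k (s i)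
    <= 2 `^ (n%:R * (mean_log p k + d)).

Lemma aep_all (p : finpmf R T) (d : R) (ks : seq (T -> R)) : 0 < d ->
  foldr (fun k Q => (forall t, 0 < p t -> 0 < k t) /\ Q) True ks ->
  exists C : R, forall n, (0 < n)%N ->
    \sum_(s : {ffun 'I_n -> T}) iid p s *
      (~~ all (fun k => typical p d k s) ks)%:R <= C / n%:R.
Proof.
move=> d0; elim: ks => [_|k ks IH [k0 /IH[C HC]]].
  by exists 0 => n n0; rewrite mul0r big1// => s _; rewrite mulr0.
have [C' HC'] := aep d0 k0; exists (C' + C) => n n0.
rewrite mulrDl; apply: le_trans (lerD (HC' n n0) (HC n n0)).
rewrite -big_split/=; apply: ler_sum => s _; rewrite -mulrDr ler_wpM2l ?iid_ge0//.
by rewrite negb_and -natrD ler_nat /typical /mean_log; do 2 case: (~~ _).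
Qed.

End TypicalBlocks.

Section Candidates.
Context {R : realType} {TZ U V F0 B0 F1 B1 : finType}.
Variables (k0 : TZ -> U -> R) (k1 : TZ -> U -> V -> R).
Hypotheses (k0_sub : forall z, subpmf (k0 z)) (k1_sub : forall z u, subpmf (k1 z u)).
Variables (active : bool) (a b d : R) (n : nat).

(** Lower bounds on the kernels limit the number of candidates through [subpmf_count]. With [active]
    false there are none, so a receiver that does not decode imposes no condition on the rates. *)
Definition candidate (z : {ffun 'I_n -> TZ}) (u : {ffun 'I_n -> U})
    (v : {ffun 'I_n -> V}) : bool :=
  [&& active, 2 `^ (n%:R * (a - d)) <= block_kernel k0 z u &
      2 `^ (n%:R * (b - d)) <= block_kernel2 k1 z u v].

Lemma candidate_count1 z u :
  \sum_v (candidate z u v)%:R <= 2 `^ (- (n%:R * (b - d))).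
Proof.
rewrite powRN; apply: (@subpmf_count _ _ (block_kernel2 k1 z u)); last 2 first.
- exact: pow2_gt0.
- by move=> v /and3P[].
exact: (@block_subpmf _ _ _ (fun i => k1 (z i) (u i))).
Qed.

Lemma candidate_count z :
  \sum_(c : {ffun 'I_n -> U} * {ffun 'I_n -> V}) (candidate z c.1 c.2)%:R <=
  2 `^ (- (n%:R * (a - d))) * 2 `^ (- (n%:R * (b - d))).
Proof.
rewrite -(pair_bigA _ (fun u v => (candidate z u v)%:R))/=.
pose Tu u := 2 `^ (n%:R * (a - d)) <= block_kernel k0 z u.
apply: (@le_trans _ _ (\sum_u (Tu u)%:R * 2 `^ (- (n%:R * (b - d))))).
  apply: ler_sum => u _; case: (boolP (Tu u)) => Hu.
    by rewrite mul1r; exact: candidate_count1.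
  by rewrite mul0r big1// => v _; rewrite /candidate -/(Tu u) (negbTE Hu) andbF.
rewrite -mulr_suml ler_wpM2r ?powR_ge0// powRN.
apply: (@subpmf_count _ _ (block_kernel k0 z)) (pow2_gt0 _) _ => //.
exact: (@block_subpmf _ _ _ (fun i => k0 (z i))).
Qed.

(** [r0] and [r1] are frozen rates, [rho] and [s] transmitted ones. Each transmitted part may lose a
    factor 2 by rounding: 4 for collisions in both hashes and 2 for the hash of pairs alone give 6.
    In the slack, one d per threshold undoes the deviation and one more yields the decay. *)
Lemma candidate_collision (r0 rho r1 s : R) z u :
  2 `^ (n%:R * r0) <= #|F0|%:R -> 2 `^ (n%:R * rho) / 2 <= #|B0|%:R ->
  2 `^ (n%:R * r1) <= #|F1|%:R -> 2 `^ (n%:R * s) / 2 <= #|B1|%:R ->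
  (active -> - a - b + 3 * d <= r0 + rho + r1 + s) ->
  (active -> - b + 2 * d <= r1 + s) ->
  collision_bound (F0 := F0) (B0 := B0) (F1 := F1) (B1 := B1) (candidate z) u
    <= 6 * 2 `^ (- (n%:R * d)).
Proof.
move=> hF0 hB0 hF1 hB1.
case act: active; last first.
  move=> _ _; rewrite /collision_bound !big1 ?mul0r ?addr0 ?mulr_ge0 ?powR_ge0//.
    by move=> v _; rewrite /candidate act.
  by move=> v _; rewrite /candidate act.
move=> /(_ isT) h1 /(_ isT) h2.
have K0 : 2 `^ (n%:R * (r0 + rho)) / 2 <= #|{: F0 * B0}|%:R.
  rewrite card_prod natrM mulrDr pow2D -mulrA.
  by apply: ler_pM; rewrite ?divr_ge0 ?powR_ge0.
have K1 : 2 `^ (n%:R * (r1 + s)) / 2 <= #|{: F1 * B1}|%:R.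
  rewrite card_prod natrM mulrDr pow2D -mulrA.
  by apply: ler_pM; rewrite ?divr_ge0 ?powR_ge0.
have inv (r N : R) : 2 `^ (n%:R * r) / 2 <= N -> N^-1 <= 2 * 2 `^ (- (n%:R * r)).
  move=> le; have p0 : 0 < 2 `^ (n%:R * r) / 2 by rewrite divr_gt0 ?pow2_gt0.
  rewrite powRN -[2 * _](_ : (2 `^ (n%:R * r) / 2)^-1 = _); last first.
    by rewrite invf_div.
  by rewrite lef_pV2 ?posrE// (lt_le_trans p0).
have i0 := inv _ _ K0; have i1 := inv _ _ K1.
have n0 : 0 <= n%:R :> R by [].
rewrite /collision_bound (_ : 6 * _ = 4 * 2 `^ (- (n%:R * d)) + 2 * 2 `^ (- (n%:R * d))); last by ring.
apply: lerD.
  apply: (@le_trans _ _ (2 `^ (- (n%:R * (a - d))) * 2 `^ (- (n%:R * (b - d))) *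
    ((2 * 2 `^ (- (n%:R * (r0 + rho)))) * (2 * 2 `^ (- (n%:R * (r1 + s))))))).
    apply: ler_pM; [exact: sumr_ge0|by rewrite mulr_ge0 ?invr_ge0|exact: candidate_count|].
    by apply: ler_pM; rewrite ?invr_ge0.
  rewrite [leLHS](_ : _ = 4 * 2 `^ (n%:R * (- a - b + 2 * d - (r0 + rho) - (r1 + s)))).
    rewrite ler_wpM2l// ler_pow2// -mulrN ler_wpM2l//; lra.
  rewrite (_ : n%:R * (- a - b + 2 * d - (r0 + rho) - (r1 + s)) = - (n%:R * (a - d)) +
    - (n%:R * (b - d)) + - (n%:R * (r0 + rho)) + - (n%:R * (r1 + s))); last by ring.
  by rewrite !pow2D; ring.
apply: (@le_trans _ _ (2 `^ (- (n%:R * (b - d))) * (2 * 2 `^ (- (n%:R * (r1 + s)))))).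
  by apply: ler_pM; [exact: sumr_ge0|rewrite invr_ge0|exact: candidate_count1|].
rewrite [leLHS](_ : _ = 2 * 2 `^ (n%:R * (- b + d - (r1 + s)))).
  rewrite ler_wpM2l// ler_pow2// -mulrN ler_wpM2l//; lra.
rewrite (_ : n%:R * (- b + d - (r1 + s)) =
  - (n%:R * (b - d)) + - (n%:R * (r1 + s))); last by ring.
by rewrite pow2D; ring.
Qed.

End Candidates.

Section Slack.
Context {R : realFieldType}.

(** 7 = 3 + 2 + 2: the collision bound asks for 3 d, and each of the two frozen rates stays 2 d
    below the conditional entropy - q or - q'. *)
Lemma slack_total (q k q' k' d x y : R) : (q - k) + (q' - k') + 7 * d <= x + y ->
  - k - k' + 3 * d <= (- q - 2 * d) + x + (- q' - 2 * d) + y.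
Proof. by move=> ?; lra. Qed.

Lemma slack_private (q k d y : R) : 0 < d -> q - k + 7 * d <= y ->
  - k + 2 * d <= (- q - 2 * d) + y.
Proof. by move=> ? ?; lra. Qed.

Lemma error_budget (x y c e : R) :
  y - (2 * (6 * e) + 2 * (6 * e) + ((1 + e) ^+ 3 - 1)) <= x -> 1 - y <= c ->
  1 - x <= c + (24 * e + ((1 + e) ^+ 3 - 1)).
Proof. by move=> ? ?; lra. Qed.

End Slack.

(** * Error probabilities of the block code *)

Section BlockCode.
Context {R : realType} {TX TY1 TY2 TZ1 TZ2 U V1 V2 : finType}.
Local Notation S := (TX * TY1 * TY2 * TZ1 * TZ2)%type.
Local Notation W := (U * V1 * V2)%type.
Variable P : finpmf R S.
Variables (q0 : TX -> U -> R) (q1 : TX -> U -> V1 -> R) (q2 : TX -> U -> V2 -> R).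
Hypotheses (q0_sub : forall x, subpmf (q0 x)) (q1_sub : forall x u, subpmf (q1 x u))
  (q2_sub : forall x u, subpmf (q2 x u)).
Local Notation J := (joint_law P q0 q1 q2).
Hypothesis J_sum1 : \sum_w J w = 1.
Variables (k01 : TZ1 -> U -> R) (k11 : TZ1 -> U -> V1 -> R) (tau1 : TY1 -> TZ1 -> V1 -> R).
Variables (k02 : TZ2 -> U -> R) (k12 : TZ2 -> U -> V2 -> R) (tau2 : TY2 -> TZ2 -> V2 -> R).
Hypotheses (side1 : side_kernels P rvY1 rvZ1 k01 k11 tau1)
  (side2 : side_kernels P rvY2 rvZ2 k02 k12 tau2).

Definition lq0 (w : S * W) := q0 (rvX w.1) w.2.1.1.
Definition lq1 (w : S * W) := q1 (rvX w.1) w.2.1.1 w.2.1.2.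
Definition lq2 (w : S * W) := q2 (rvX w.1) w.2.1.1 w.2.2.
Definition lk01 (w : S * W) := k01 (rvZ1 w.1) w.2.1.1.
Definition lk11 (w : S * W) := k11 (rvZ1 w.1) w.2.1.1 w.2.1.2.
Definition ltau1 (w : S * W) := tau1 (rvY1 w.1) (rvZ1 w.1) w.2.1.2.
Definition lk02 (w : S * W) := k02 (rvZ2 w.1) w.2.1.1.
Definition lk12 (w : S * W) := k12 (rvZ2 w.1) w.2.1.1 w.2.2.
Definition ltau2 (w : S * W) := tau2 (rvY2 w.1) (rvZ2 w.1) w.2.2.

Hypothesis pos1 : forall w, 0 < J w -> [/\ 0 < lk01 w, 0 < lk11 w & 0 < ltau1 w].
Hypothesis pos2 : forall w, 0 < J w -> [/\ 0 < lk02 w, 0 < lk12 w & 0 < ltau2 w].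

Lemma joint_law_ge0 w : 0 <= J w.
Proof. by rewrite mulr_ge0 ?mass_ge0//; exact: channel_weight_ge0. Qed.

Definition joint_pmf : finpmf R (S * W)%type := Pmf joint_law_ge0 J_sum1.

Lemma joint_law_pos w : 0 < J w ->
  [/\ 0 < P w.1, 0 < lq0 w, 0 < lq1 w & 0 < lq2 w].
Proof.
have ge0 (x y : R) : 0 <= x -> 0 < x * y -> 0 <= y -> 0 < x /\ 0 < y.
  by move=> x0 xy y0; apply/andP; rewrite !lt0r x0 y0 !andbT -negb_or -mulf_eq0 gt_eqF.
have a0 := subpmf_ge0 (q0_sub (rvX w.1)) w.2.1.1.
have a1 := subpmf_ge0 (q1_sub (rvX w.1) w.2.1.1) w.2.1.2.
have a2 := subpmf_ge0 (q2_sub (rvX w.1) w.2.1.1) w.2.2.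
rewrite /joint_law /channel_weight => J0.
have [Pp c012] := ge0 _ _ (mass_ge0 P w.1) J0 (mulr_ge0 (mulr_ge0 a0 a1) a2).
have [c01 c2] := ge0 _ _ (mulr_ge0 a0 a1) c012 a2.
by have [c0 c1] := ge0 _ _ a0 c01 a1.
Qed.

Variables (R0 R1 R2 th1 th2 rho s1 s2 d : R) (on1 on2 : bool).
Hypotheses (d_gt0 : 0 < d) (rho_ge0 : 0 <= rho) (s1_ge0 : 0 <= s1) (s2_ge0 : 0 <= s2).
Hypothesis split_rate : rho + s1 + s2 <= R0.
Local Notation M := (mean_log J).
Hypotheses
  (rate1 : on1 -> (M lq0 - M lk01) + (M lq1 - M lk11) + 7 * d <= rho + (s1 + R1))
  (rate1' : on1 -> M lq1 - M lk11 + 7 * d <= s1 + R1)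
  (expo1 : if on1 then th1 + d <= M ltau1 else th1 <= 0)
  (rate2 : on2 -> (M lq0 - M lk02) + (M lq2 - M lk12) + 7 * d <= rho + (s2 + R2))
  (rate2' : on2 -> M lq2 - M lk12 + 7 * d <= s2 + R2)
  (expo2 : if on2 then th2 + d <= M ltau2 else th2 <= 0).

Lemma block_code : exists C : R, forall n, (0 < n)%N ->
  exists c : Defs.code R0 R1 R2 n,
    [/\ type1_error c P (decision1 c) <= C / n%:R + (24 * 2 `^ (- (n%:R * d)) +
          ((1 + 2 `^ (- (n%:R * d))) ^+ 3 - 1)),
        type1_error c P (decision2 c) <= C / n%:R + (24 * 2 `^ (- (n%:R * d)) +
          ((1 + 2 `^ (- (n%:R * d))) ^+ 3 - 1)),
        type2_error c P (decision1 c) <= 2 `^ (- (n%:R * th1)) &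
        type2_error c P (decision2 c) <= 2 `^ (- (n%:R * th2))].
Proof.
pose ks := [:: lq0; lq1; lq2; lk01; lk11; ltau1; lk02; lk12; ltau2].
have [] := @aep_all _ _ joint_pmf d ks d_gt0.
  rewrite /=; do ![split; first by move=> w Jw;
    case: (joint_law_pos Jw) (pos1 Jw) (pos2 Jw) => ? ? ? ? [? ? ?] [? ? ?]].
  by [].
move=> C HC; exists C => n n0.
set eta := 2 `^ (- (n%:R * d)).
have eta0 : 0 <= eta by exact: powR_ge0.
(* - M lq0, - M lq1 and - M lq2 stand for H(U_0 | X), H(U_1 | U_0, X) and H(U_2 | U_0, X). Staying 2
   d below them keeps the normalising sums close to their means. *)
pose F0 := msg n (- M lq0 - 2 * d); pose F1 := msg n (- M lq1 - 2 * d).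
pose F2 := msg n (- M lq2 - 2 * d).
pose B0 := bins n rho; pose A1 := bins n s1; pose A2 := bins n s2.
have n0' : 0 <= n%:R :> R by [].
have [join0 [split0 join0K]] : exists (f : B0 * A1 * A2 -> msg n R0) (h : _ -> _), cancel f h.
  apply: (retraction (ord0, ord0, ord0)).
  (* Message 0 has one value more than the floor of 2 ^ (n R0); the triples of bins already fit into
     the floor. *)
  rewrite !card_prod [#|msg n R0|]card_ord ltnW// ltnS truncn_ge_nat ?powR_ge0// !natrM.
  have /andP[_ h0] := card_bins n rho_ge0; have /andP[_ h1] := card_bins n s1_ge0.
  have /andP[_ h2] := card_bins n s2_ge0.
  apply: le_trans (_ : 2 `^ (n%:R * (rho + s1 + s2)) <= _).
    by rewrite !mulrDr !pow2D; do 2 apply: ler_pM => //.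
  by rewrite ler_pow2// ler_wpM2l.
pose p0 := block_kernel q0 (n := n).
pose p1 := block_kernel2 q1 (n := n).
pose p2 := block_kernel2 q2 (n := n).
have p0_sub x : subpmf (p0 x) by apply: (@block_subpmf _ _ _ (fun i => q0 (x i))).
have p1_sub x u : subpmf (p1 x u).
  by apply: (@block_subpmf _ _ _ (fun i => q1 (x i) (u i))).
have p2_sub x u : subpmf (p2 x u).
  by apply: (@block_subpmf _ _ _ (fun i => q2 (x i) (u i))).
pose T1 := @candidate R TZ1 U V1 k01 k11 on1 (M lk01) (M lk11) d n.
pose T2 := @candidate R TZ2 U V2 k02 k12 on2 (M lk02) (M lk12) d n.
pose acc1 (y : {ffun 'I_n -> TY1}) (z : {ffun 'I_n -> TZ1}) (v : {ffun 'I_n -> V1}) :=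
  2 `^ (n%:R * th1) <= block_kernel2 tau1 y z v.
pose acc2 (y : {ffun 'I_n -> TY2}) (z : {ffun 'I_n -> TZ2}) (v : {ffun 'I_n -> V2}) :=
  2 `^ (n%:R * th2) <= block_kernel2 tau2 y z v.
pose Gam (s : {ffun 'I_n -> S}) (t : {ffun 'I_n -> U} * {ffun 'I_n -> V1} * {ffun 'I_n -> V2}) := all (fun k => typical J d k (zip_blocks s t)) ks.
have GamE s t : Gam s t ->
  [/\ [/\ p0 (block rvX s) t.1.1 <= 2 `^ (n%:R * (M lq0 + d)),
          p1 (block rvX s) t.1.1 t.1.2 <= 2 `^ (n%:R * (M lq1 + d)) &
          p2 (block rvX s) t.1.1 t.2 <= 2 `^ (n%:R * (M lq2 + d))],
      [/\ 2 `^ (n%:R * (M lk01 - d)) <= block_kernel k01 (block rvZ1 s) t.1.1,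
          2 `^ (n%:R * (M lk11 - d)) <= block_kernel2 k11 (block rvZ1 s) t.1.1 t.1.2 &
          2 `^ (n%:R * (M ltau1 - d)) <=
            block_kernel2 tau1 (block rvY1 s) (block rvZ1 s) t.1.2] &
      [/\ 2 `^ (n%:R * (M lk02 - d)) <= block_kernel k02 (block rvZ2 s) t.1.1,
          2 `^ (n%:R * (M lk12 - d)) <= block_kernel2 k12 (block rvZ2 s) t.1.1 t.2 &
          2 `^ (n%:R * (M ltau2 - d)) <=
            block_kernel2 tau2 (block rvY2 s) (block rvZ2 s) t.2]].
  have up (k : S * W -> R) b : typical J d k (zip_blocks s t) ->
      \prod_i k (zip_blocks s t i) = b -> b <= 2 `^ (n%:R * (M k + d)).
    by move=> /andP[_ le] <-.
  have dn (k : S * W -> R) b : typical J d k (zip_blocks s t) ->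
      \prod_i k (zip_blocks s t i) = b -> 2 `^ (n%:R * (M k - d)) <= b.
    by move=> /andP[le _] <-.
  case/andP=> g1 /andP[g2 /andP[g3 /andP[g4 /andP[g5 /andP[g6 /andP[g7 /andP[g8 /andP[g9 _]]]]]]]].
  by split; split; do [apply: up; first by eassumption|apply: dn; first by eassumption];
    apply: eq_bigr => i _; rewrite /lq0 /lq1 /lq2 /lk01 /lk11 /ltau1 /lk02 /lk12 /ltau2 !ffunE.
have small r N p : N <= 1 + 2 `^ (n%:R * (- r - 2 * d)) -> 0 <= p ->
    p <= 2 `^ (n%:R * (r + d)) -> (N - 1) * p <= eta.
  move=> hN hp0 hp; rewrite /eta.
  rewrite [leRHS](_ : _ = 2 `^ (n%:R * (- r - 2 * d)) * 2 `^ (n%:R * (r + d))); last first.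
    by rewrite -pow2D; congr powR; ring.
  apply: le_trans (_ : 2 `^ (n%:R * (- r - 2 * d)) * p <= _).
    by rewrite ler_wpM2r// lerBlDl.
  by rewrite ler_wpM2l ?powR_ge0.
pose iidP : finpmf R {ffun 'I_n -> S} := Pmf (iid_ge0 P (n := n)) (iid_sum1 P n).
have cardA (A : finType) (s r : R) : 2 `^ (n%:R * s) / 2 <= #|A|%:R ->
    2 `^ (n%:R * (s + r)) / 2 <= #|{: A * msg n r}|%:R.
  move=> hA; have /andP[hr _] := card_msg n r.
  rewrite card_prod natrM mulrDr pow2D mulrAC.
  by apply: ler_pM; rewrite ?divr_ge0 ?powR_ge0.
have /andP[F0lo F0hi] := card_msg n (- M lq0 - 2 * d).
have /andP[F1lo F1hi] := card_msg n (- M lq1 - 2 * d).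
have /andP[F2lo F2hi] := card_msg n (- M lq2 - 2 * d).
have /andP[B0lo _] := card_bins n rho_ge0.
have /andP[A1lo _] := card_bins n s1_ge0.
have /andP[A2lo _] := card_bins n s2_ge0.
have coll1 s t :
    Gam s t -> collision_bound (F0 := F0) (B0 := B0) (F1 := F1)
      (B1 := (A1 * msg n R1)%type) (T1 (block rvZ1 s)) t.1.1 <= 6 * eta.
  move=> _; have := candidate_collision (side_sub0 side1) (side_sub1 side1)
    (active := on1) (a := M lk01) (b := M lk11) (d := d)
    (block rvZ1 s) t.1.1 F0lo B0lo F1lo (cardA A1 _ R1 A1lo).
  apply=> on.
    exact: slack_total (rate1 on).
  exact: slack_private d_gt0 (rate1' on).
have coll2 s t :
    Gam s t -> collision_bound (F0 := F0) (B0 := B0) (F1 := F2)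
      (B1 := (A2 * msg n R2)%type) (T2 (block rvZ2 s)) t.1.1 <= 6 * eta.
  move=> _; have := candidate_collision (side_sub0 side2) (side_sub1 side2)
    (active := on2) (a := M lk02) (b := M lk12) (d := d)
    (block rvZ2 s) t.1.1 F0lo B0lo F2lo (cardA A2 _ R2 A2lo).
  apply=> on.
    exact: slack_total (rate2 on).
  exact: slack_private d_gt0 (rate2' on).
have eta6 : 0 <= 6 * eta by rewrite mulr_ge0.
have [] := good_hash (ord0 : F0) (ord0 : B0) (ord0 : F1)
  ((ord0, ord0) : A1 * msg n R1) (ord0 : F2) ((ord0, ord0) : A2 * msg n R2)
  iidP (xs := block rvX)
  p0_sub p1_sub p2_sub eta0 eta6 eta6 _ _ _ coll1 coll2.
- by move=> s t /GamE[[h _ _] _ _]; exact: small F0hi (subpmf_ge0 (p0_sub _) _) h.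
- by move=> s t /GamE[[_ h _] _ _]; exact: small F1hi (subpmf_ge0 (p1_sub _ _) _) h.
- by move=> s t /GamE[[_ _ h] _ _]; exact: small F2hi (subpmf_ge0 (p2_sub _ _) _) h.
move=> g Hg.
have GamT1 s t : Gam s t -> if T1 (block rvZ1 s) t.1.1 t.1.2
    then acc1 (block rvY1 s) (block rvZ1 s) t.1.2 else ~~ on1.
  move=> /GamE[_ [h0 h1 h2] _]; rewrite /T1 /candidate h0 h1 !andbT.
  case on: on1 => //; apply: le_trans h2; rewrite ler_pow2// ler_wpM2l//.
  by move: expo1; rewrite on lerBrDr.
have GamT2 s t : Gam s t -> if T2 (block rvZ2 s) t.1.1 t.2
    then acc2 (block rvY2 s) (block rvZ2 s) t.2 else ~~ on2.
  move=> /GamE[_ _ [h0 h1 h2]]; rewrite /T2 /candidate h0 h1 !andbT.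
  case on: on2 => //; apply: le_trans h2; rewrite ler_pow2// ler_wpM2l//.
  by move: expo2; rewrite on lerBrDr.
have success : 1 - \sum_s \sum_t iid P s * hash_weight (ord0 : F0) (ord0 : F1) (ord0 : F2)
      p0 p1 p2 g (block rvX s) t *
      (Gam s t && hash_success (block rvZ1) (block rvZ2) T1 T2 g s t)%:R <=
    C / n%:R + (24 * eta + ((1 + eta) ^+ 3 - 1)).
  have := HC n n0; rewrite sum_zip_blocks.
  have := iid_sum1 joint_pmf n; rewrite sum_zip_blocks.
  have -> : \sum_(s : {ffun 'I_n -> S}) \sum_t iid joint_pmf (zip_blocks s t) *
      (~~ all (fun k => typical joint_pmf d k (zip_blocks s t)) ks)%:R =
    \sum_(s : {ffun 'I_n -> S}) \sum_t iid joint_pmf (zip_blocks s t) -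
    \sum_s \sum_t iid P s * channel_weight p0 p1 p2 (block rvX s) t * (Gam s t)%:R.
    rewrite -sumrB; apply: eq_bigr => s _; rewrite -sumrB; apply: eq_bigr => t _.
    rewrite -iid_joint_law -/(Gam s t).
    by case: (Gam s t); rewrite ?mulr1 ?mulr0 ?subrr ?subr0.
  move=> -> le1.
  exact: error_budget Hg le1.
exists (hash_code (ord0 : F0) (ord0 : F1) (ord0 : F2) split0 join0 p0_sub p1_sub p2_sub
  T1 T2 acc1 acc2 on1 on2 g); split.
- by apply: le_trans success; exact: hash_code_error1.
- by apply: le_trans success; exact: hash_code_error2.
(* A receiver that is off has th1 <= 0, so the bound on its type II error is at least 1. *)
- case on: on1; last first.
    apply: le_trans (type2_error_le1 _ _ _) _.
    move: expo1; rewrite on => th0; rewrite -[leLHS](powRr0 2) ler_pow2//.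
    by rewrite oppr_ge0 mulr_ge0_le0.
  have bound := type2_error_le (hash_code (ord0 : F0) (ord0 : F1) (ord0 : F2)
    split0 join0 p0_sub p1_sub p2_sub T1 T2 acc1 acc2 true on2 g)
    (est := fun z m => omap snd
      (estimate1 (ord0 : F0) (ord0 : F1) split0 T1 g z m.1.1 m.1.2))
    (alt_law_marginal1 P) (side_tau_ge0 side1) (side_tau_mean side1) (pow2_gt0 (n%:R * th1)).
  rewrite powRN; apply: bound.
  move=> s [[m0 m1] m2] /=; case: estimate1 => //= c /negbFE; rewrite /acc1.
  move=> h; apply: le_trans h _; rewrite /block_ratio /block_kernel2 le_eqVlt.
  by apply/orP; left; apply/eqP; apply: eq_bigr => i _; rewrite !ffunE.
- case on: on2; last first.
    apply: le_trans (type2_error_le1 _ _ _) _.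
    move: expo2; rewrite on => th0; rewrite -[leLHS](powRr0 2) ler_pow2//.
    by rewrite oppr_ge0 mulr_ge0_le0.
  have bound := type2_error_le (hash_code (ord0 : F0) (ord0 : F1) (ord0 : F2)
    split0 join0 p0_sub p1_sub p2_sub T1 T2 acc1 acc2 on1 true g)
    (est := fun z m => omap snd
      (estimate2 (ord0 : F0) (ord0 : F2) split0 T2 g z m.1.1 m.2))
    (alt_law_marginal2 P) (side_tau_ge0 side2) (side_tau_mean side2) (pow2_gt0 (n%:R * th2)).
  rewrite powRN; apply: bound.
  move=> s [[m0 m1] m2] /=; case: estimate2 => //= c /negbFE; rewrite /acc2.
  move=> h; apply: le_trans h _; rewrite /block_ratio /block_kernel2 le_eqVlt.
  by apply/orP; left; apply/eqP; apply: eq_bigr => i _; rewrite !ffunE.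
Qed.

End BlockCode.

(** * Achievability for a test channel *)

Section Asymptotics.
Context {R : realType}.

Lemma exponent_limit (th : R) (beta : nat -> R) (n0 : nat) :
  (forall n, (n0 <= n)%N -> (0 < n)%N -> 0 <= beta n <= 2 `^ (- (n%:R * th))) ->
  (th%:E <= - limn_esup (fun n => (n%:R^-1)%:E * elog2 (beta n)))%E.
Proof.
move=> H; rewrite leeNr /limn_esup limf_esupE.
apply: ge_ereal_inf; exists (ereal_sup [set ((n%:R^-1)%:E * elog2 (beta n))%E |
    n in [set n | (maxn n0 1 <= n)%N]]).
  by exists [set n | (maxn n0 1 <= n)%N] => //; exists (maxn n0 1).
apply: ge_ereal_sup => _ [n /= + <-]; rewrite geq_max => /andP[n0n n1].
have n_gt0 : 0 < n%:R :> R by rewrite ltr0n.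
have ln2 : 0 < ln 2 :> R by rewrite ln_gt0// ltr1n.
have /andP[b0 b1] := H n n0n n1; rewrite /elog2.
have [->|bn0] := eqVneq (beta n) 0.
  rewrite le0_lneNy// gt0_mulNye ?lte_fin ?invr_gt0//.
  by rewrite gt0_muleNy ?lte_fin ?invr_gt0// leNye.
have bp : 0 < beta n by rewrite lt0r bn0.
rewrite lne_EFin// -!EFinM lee_fin.
have : ln (beta n) <= ln (2 `^ (- (n%:R * th))) by rewrite ler_ln ?posrE// pow2_gt0.
rewrite ln_powR => le.
rewrite (_ : _ * _ = ln (beta n) / (n%:R * ln 2)); last by field; rewrite !gt_eqF.
by rewrite ler_pdivrMr ?mulr_gt0//; apply: le_trans le _; rewrite le_eqVlt;
  apply/orP; left; apply/eqP; ring.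
Qed.

(** A decay in 1 / n is crude but has the form of the Chebyshev error, so that both are absorbed
    into one constant. *)
Lemma pow2N_le (d : R) (n : nat) : 0 < d -> (0 < n)%N ->
  2 `^ (- (n%:R * d)) <= (d * ln 2)^-1 / n%:R.
Proof.
move=> d0 n0; have n_gt0 : 0 < n%:R :> R by rewrite ltr0n.
have ln2 : 0 < ln 2 :> R by rewrite ln_gt0// ltr1n.
rewrite powRN -invfM lef_pV2 ?posrE ?pow2_gt0 ?mulr_gt0//.
rewrite /powR pnatr_eq0/=; apply: le_trans (expR_ge1Dx _).
by rewrite (_ : n%:R * d * ln 2 = d * ln 2 * n%:R) ?lerDr//; ring.
Qed.

End Asymptotics.

Section Achievability.
Context {R : realType} {TX TY1 TY2 TZ1 TZ2 : finType}.
Local Notation S := (TX * TY1 * TY2 * TZ1 * TZ2)%type.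
Variables (P : finpmf R S) (R0 R1 R2 : R).

Lemma type2_error_ge0 n (c : Defs.code R0 R1 R2 n) dec : 0 <= type2_error c P dec.
Proof. by apply: sumr_ge0 => w _; exact: (network_law_ge0 c (alt_pmf P)). Qed.

Lemma eps_achievable_of_codes (th1 th2 eps : R) (n0 : nat) : 0 < eps ->
  (forall n, (n0 <= n)%N -> (0 < n)%N -> exists c : Defs.code R0 R1 R2 n,
    [/\ type1_error c P (decision1 c) <= eps,
        type1_error c P (decision2 c) <= eps,
        type2_error c P (decision1 c) <= 2 `^ (- (n%:R * th1)) &
        type2_error c P (decision2 c) <= 2 `^ (- (n%:R * th2))]) ->
  eps_achievable P eps th1 th2 R0 R1 R2.
Proof.
move=> eps0 codes.
have all_codes n : exists c : Defs.code R0 R1 R2 n,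
    [/\ type1_error c P (decision1 c) <= eps,
        type1_error c P (decision2 c) <= eps &
        (n0 <= n)%N -> (0 < n)%N ->
          type2_error c P (decision1 c) <= 2 `^ (- (n%:R * th1)) /\
          type2_error c P (decision2 c) <= 2 `^ (- (n%:R * th2))].
  have [/andP[n0n n1]|small] := boolP ((n0 <= n)%N && (0 < n)%N).
    by have [c [? ? ? ?]] := codes n n0n n1; exists c.
  (* The remaining lengths get a code that always accepts: its type I error is 0, and finitely many
     type II errors do not affect the limit superior. Its encoder is a point mass, obtained by
     pushing forward the zero weight on an empty type so that all mass goes to the default
     message. *)
  pose e : finpmf R (msg n R0 * msg n R1 * msg n R2)%type :=
    push_pmf (W := 'I_0) (fun _ => (ord0, ord0, ord0)) (ord0, ord0, ord0)
      (w := fun _ => 0) (fun _ => lexx 0) (eq_ind_r (fun x => x <= 1) ler01 (big_ord0 _ _ _ _)).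
  exists (Code (fun _ => e) (fun _ _ _ _ => false) (fun _ _ _ _ => false)).
  split; last by move=> n0n n1; rewrite n0n n1 in small.
  - by rewrite /type1_error /prob big_pred0 ?ltW// => -[s [[m0 m1] m2]].
  - by rewrite /type1_error /prob big_pred0 ?ltW// => -[s [[m0 m1] m2]].
exists (fun n => sval (cid (all_codes n))); split.
  by move=> n _; case: cid => c [].
split; apply: (@exponent_limit _ _ _ n0) => n n0n n1; rewrite type2_error_ge0 /=;
  by case: cid => c /= [_ _ /(_ n0n n1)[]].
Qed.

End Achievability.

Section Core.
Context {R : realType} {TX TY1 TY2 TZ1 TZ2 U V1 V2 : finType}.
Local Notation S := (TX * TY1 * TY2 * TZ1 * TZ2)%type.

Record test_channel (P : finpmf R S) (q0 : TX -> U -> R) (q1 : TX -> U -> V1 -> R)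
    (q2 : TX -> U -> V2 -> R)
    (k01 : TZ1 -> U -> R) (k11 : TZ1 -> U -> V1 -> R) (tau1 : TY1 -> TZ1 -> V1 -> R)
    (k02 : TZ2 -> U -> R) (k12 : TZ2 -> U -> V2 -> R) (tau2 : TY2 -> TZ2 -> V2 -> R)
    : Prop := TestChannel {
  channel_sub0 : forall x, subpmf (q0 x);
  channel_sub1 : forall x u, subpmf (q1 x u);
  channel_sub2 : forall x u, subpmf (q2 x u);
  channel_sum1 : \sum_w joint_law P q0 q1 q2 w = 1;
  channel_side1 : side_kernels P rvY1 rvZ1 k01 k11 tau1;
  channel_side2 : side_kernels P rvY2 rvZ2 k02 k12 tau2;
  channel_pos1 : forall w, 0 < joint_law P q0 q1 q2 w ->
    [/\ 0 < lk01 k01 w, 0 < lk11 k11 w & 0 < ltau1 tau1 w];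
  channel_pos2 : forall w, 0 < joint_law P q0 q1 q2 w ->
    [/\ 0 < lk02 k02 w, 0 < lk12 k12 w & 0 < ltau2 tau2 w] }.

Context {P : finpmf R S} {q0 : TX -> U -> R} {q1 : TX -> U -> V1 -> R}
  {q2 : TX -> U -> V2 -> R}
  {k01 : TZ1 -> U -> R} {k11 : TZ1 -> U -> V1 -> R} {tau1 : TY1 -> TZ1 -> V1 -> R}
  {k02 : TZ2 -> U -> R} {k12 : TZ2 -> U -> V2 -> R} {tau2 : TY2 -> TZ2 -> V2 -> R}.
Hypothesis tc : test_channel P q0 q1 q2 k01 k11 tau1 k02 k12 tau2.
Local Notation J := (joint_law P q0 q1 q2).
Local Notation M := (mean_log J).

Lemma core_achievability (R0 R1 R2 th1 th2 rho s1 s2 eps : R) (on1 on2 : bool) :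
  0 < eps -> 0 <= rho -> 0 <= s1 -> 0 <= s2 -> rho + s1 + s2 <= R0 ->
  (on1 -> [/\ (M (lq0 q0) - M (lk01 k01)) + (M (lq1 q1) - M (lk11 k11)) < rho + (s1 + R1),
              M (lq1 q1) - M (lk11 k11) < s1 + R1 & th1 < M (ltau1 tau1)]) ->
  (~~ on1 -> th1 <= 0) ->
  (on2 -> [/\ (M (lq0 q0) - M (lk02 k02)) + (M (lq2 q2) - M (lk12 k12)) < rho + (s2 + R2),
              M (lq2 q2) - M (lk12 k12) < s2 + R2 & th2 < M (ltau2 tau2)]) ->
  (~~ on2 -> th2 <= 0) ->
  eps_achievable P eps th1 th2 R0 R1 R2.
Proof.
move=> eps0 rho0 s10 s20 split_rate c1 o1 c2 o2.
(* One d must serve both receivers, so the slack is stated for every d below a threshold and the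
   smaller threshold is taken afterwards. *)
have slack (on : bool) (a b a' b' t t' : R) : (on -> [/\ a < a', b < b' & t < t']) ->
    exists2 e, 0 < e & forall d, 0 < d <= e ->
      on -> [/\ a + 7 * d <= a', b + 7 * d <= b' & t + d <= t'].
  case: on => [/(_ isT)[aa' bb' tt']|_]; last by exists 1.
  exists (Num.min ((a' - a) / 7) (Num.min ((b' - b) / 7) (t' - t))).
    by rewrite !lt_min; apply/and3P; split; lra.
  by move=> d /andP[d0]; rewrite !le_min => /and3P[? ? ?] _; split; lra.
have [e1 e10 H1] := slack _ _ _ _ _ _ _ c1.
have [e2 e20 H2] := slack _ _ _ _ _ _ _ c2.
pose d := Num.min e1 e2.
have d0 : 0 < d by rewrite lt_min e10 e20.
have /H1 h1 : 0 < d <= e1 by rewrite d0 ge_min lexx.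
have /H2 h2 : 0 < d <= e2 by rewrite d0 ge_min lexx orbT.
have x1 : if on1 then th1 + d <= M (ltau1 tau1) else th1 <= 0.
  by case: (on1) h1 o1 => [/(_ isT)[]//|_ /(_ isT)].
have x2 : if on2 then th2 + d <= M (ltau2 tau2) else th2 <= 0.
  by case: (on2) h2 o2 => [/(_ isT)[]//|_ /(_ isT)].
have [C HC] := block_code (channel_sub0 tc) (channel_sub1 tc) (channel_sub2 tc)
  (channel_sum1 tc) (channel_side1 tc) (channel_side2 tc) (channel_pos1 tc)
  (channel_pos2 tc) d0 rho0 s10 s20 split_rate
  (fun o => let: And3 a _ _ := h1 o in a) (fun o => let: And3 _ a _ := h1 o in a) x1
  (fun o => let: And3 a _ _ := h2 o in a) (fun o => let: And3 _ a _ := h2 o in a) x2.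
(* 31 = 24 + 7: for 0 <= y <= 1 one has (1 + y) ^ 3 - 1 <= 7 y, and y = 2 ^ (- n d) is at most (d ln
   2)^-1 / n. *)
pose C' := C + 31 * (d * ln 2)^-1.
apply: (@eps_achievable_of_codes _ _ _ _ _ _ _ _ _ _ _ _ _ (Num.truncn (C' / eps)).+1) => // n n0n n1.
have n_gt0 : 0 < n%:R :> R by rewrite ltr0n.
have err : C / n%:R + (24 * 2 `^ (- (n%:R * d)) +
    ((1 + 2 `^ (- (n%:R * d))) ^+ 3 - 1)) <= eps.
  apply: (@le_trans _ _ (C' / n%:R)); last first.
    rewrite ler_pdivrMr// mulrC -ler_pdivrMr//.
    by apply: ltW; apply: lt_le_trans (truncnS_gt _) _; rewrite ler_nat.
  have := pow2N_le d0 n1.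
  have : 2 `^ (- (n%:R * d)) <= 1.
    by rewrite -[leRHS](powRr0 2) ler_pow2// oppr_le0 mulr_ge0// ltW.
  have : 0 <= 2 `^ (- (n%:R * d)) by exact: powR_ge0.
  rewrite (_ : C' / n%:R = C / n%:R + 31 * ((d * ln 2)^-1 / n%:R)); last by rewrite /C'; ring.
  move: (2 `^ _) (_^-1 / n%:R) (C / n%:R) => y z c y0 y1 yz.
  have : (1 + y) ^+ 3 - 1 <= 7 * y.
    rewrite -subr_ge0 (_ : _ - _ = y * (1 - y) * (4 + y)); last by ring.
    by rewrite !mulr_ge0//; lra.
  by move=> h; lra.
have [c [a1 a2 b1 b2]] := HC n n1; exists c; split=> //.
  exact: le_trans a1 err.
exact: le_trans a2 err.
Qed.

End Core.

(** * Gibbs inequality and information bounds *)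

Section Gibbs.
Context {R : realType}.

Lemma sum_quadruple {A B C D : finType} (F : A * (B * C * D) -> R) :
  \sum_w F w = \sum_a \sum_b \sum_c \sum_d F (a, (b, c, d)).
Proof.
transitivity (\sum_a \sum_t F (a, t)); first by rewrite [RHS]pair_bigA; apply: eq_bigr => -[].
apply: eq_bigr => a _.
transitivity (\sum_c \sum_d F (a, (c, d))); first by rewrite [RHS]pair_bigA; apply: eq_bigr => -[].
by rewrite [RHS]pair_bigA; apply: eq_bigr => -[].
Qed.

Lemma log2M (x y : R) : 0 < x -> 0 < y -> log2 (x * y) = log2 x + log2 y.
Proof. by move=> x0 y0; rewrite /log2 lnM ?posrE// mulrDl. Qed.

Lemma log2V (x : R) : 0 < x -> log2 x^-1 = - log2 x.
Proof. by move=> x0; rewrite /log2 lnV ?posrE// mulNr. Qed.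

Lemma log2_div (x y : R) : 0 < x -> 0 < y -> log2 (x / y) = log2 x - log2 y.
Proof. by move=> x0 y0; rewrite log2M ?invr_gt0// log2V. Qed.

(** From ln x <= x - 1. Nonnegativity of the common information and data processing both reduce to
    it, [f] being on the support the ratio of a sub-probability to the true law. *)
Lemma gibbs {T : finType} (p f : T -> R) : (forall t, 0 <= p t) ->
  \sum_t p t = 1 -> (forall t, 0 < p t -> 0 < f t) ->
  \sum_t p t * f t <= 1 -> mean_log p f <= 0.
Proof.
move=> p0 p1 f0 pf1; have ln2 : 0 < ln 2 :> R by rewrite ln_gt0// ltr1n.
apply: (@le_trans _ _ ((\sum_t p t * f t - \sum_t p t) / ln 2)); last first.
  by rewrite p1 pmulr_lle0 ?invr_gt0// subr_le0.
rewrite -sumrB mulr_suml; apply: ler_sum => t _.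
have [->|pt] := eqVneq (p t) 0; first by rewrite !mul0r subr0 mul0r.
have ft : 0 < f t by apply: f0; rewrite lt0r pt p0.
rewrite (_ : p t * f t - p t = p t * (f t - 1)); last by ring.
rewrite -mulrA; apply: ler_wpM2l => //; apply: ler_wpM2r; first by rewrite invr_ge0 ltW.
by rewrite -[in leLHS](subrK 1 (f t)) addrC le_ln1Dx// ltrBrDl subrr.
Qed.

Lemma mean_logB {T : finType} (p f g : T -> R) :
  (forall t, 0 <= p t) -> (forall t, 0 < p t -> 0 < f t /\ 0 < g t) ->
  mean_log p f - mean_log p g = mean_log p (fun t => f t / g t).
Proof.
move=> p0 fg; rewrite -sumrB; apply: eq_bigr => t _.
have [->|pt] := eqVneq (p t) 0; first by rewrite !mul0r subr0.
by have [|f0 g0] := fg t; rewrite ?lt0r ?pt ?p0// log2_div// mulrBr.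
Qed.

Lemma mean_logD {T : finType} (p f g : T -> R) :
  (forall t, 0 <= p t) -> (forall t, 0 < p t -> 0 < f t /\ 0 < g t) ->
  mean_log p f + mean_log p g = mean_log p (fun t => f t * g t).
Proof.
move=> p0 fg; rewrite -big_split; apply: eq_bigr => t _.
have [->|pt] := eqVneq (p t) 0; first by rewrite /= !mul0r addr0.
by have [|f0 g0] := fg t; rewrite ?lt0r ?pt ?p0// log2M//= mulrDr.
Qed.

Lemma sum_claw {T TY TZ : finType} (p : finpmf R T) (Y : T -> TY) (Z : T -> TZ)
    (phi : TY -> R) z :
  \sum_(t | Z t == z) p t * phi (Y t) =
  law p Z z * \sum_y claw p Y Z y z * phi y.
Proof.
rewrite (partition_big Y xpredT)//= mulr_sumr; apply: eq_bigr => y _.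
transitivity (law p (fun t => (Y t, Z t)) (y, z) * phi y).
  rewrite mulr_suml; apply: eq_big => [t|t /andP[_ /eqP ->]//].
  by rewrite xpair_eqE andbC.
rewrite mulrA; congr (_ * _); rewrite /claw mulrC.
have [z0|nz] := eqVneq (law p Z z) 0; last by rewrite divfK.
by rewrite (law_pair0 _ _ z0) !mul0r.
Qed.

(** The sum is the mass of drawing z from its law, (u, v) from the kernels of the receiver and y
    from P(y | z) reweighted by [tau]. Summing y out first, where [tau] has mean at most 1, leaves
    only the kernels. *)
Lemma side_mass {T TY TZ U V : finType} (p : finpmf R T) (Y : T -> TY) (Z : T -> TZ)
    (k0 : TZ -> U -> R) (k1 : TZ -> U -> V -> R) (tau : TY -> TZ -> V -> R) :
  side_kernels p Y Z k0 k1 tau ->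
  \sum_t p t * \sum_u \sum_v k0 (Z t) u * k1 (Z t) u v * tau (Y t) (Z t) v <= 1.
Proof.
move=> sk; rewrite (partition_big Z xpredT)//= -(law_sum1 p Z); apply: ler_sum => z _.
have -> : \sum_(t | Z t == z) p t *
      (\sum_u \sum_v k0 (Z t) u * k1 (Z t) u v * tau (Y t) (Z t) v) =
    \sum_u \sum_v k0 z u * k1 z u v * (\sum_(t | Z t == z) p t * tau (Y t) z v).
  transitivity (\sum_(t | Z t == z) \sum_u \sum_v
      k0 z u * k1 z u v * (p t * tau (Y t) z v)).
    apply: eq_bigr => t /eqP ->; rewrite mulr_sumr; apply: eq_bigr => u _.
    by rewrite mulr_sumr; apply: eq_bigr => v _; ring.
  rewrite exchange_big/=; apply: eq_bigr => u _.
  by rewrite exchange_big/=; apply: eq_bigr => v _; rewrite mulr_sumr.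
have k0p := subpmf_ge0 (side_sub0 sk z).
have k1p u := subpmf_ge0 (side_sub1 sk z u).
apply: (@le_trans _ _ (\sum_u \sum_v k0 z u * k1 z u v * law p Z z)).
  apply: ler_sum => u _; apply: ler_sum => v _; rewrite ler_wpM2l ?mulr_ge0//.
  rewrite (sum_claw p Y Z (fun y => tau y z v)) -[leRHS]mulr1 ler_wpM2l ?law_ge0//.
  exact: (side_tau_mean sk).
under eq_bigr => u _ do rewrite -mulr_suml -mulr_sumr.
rewrite -mulr_suml -[leRHS]mul1r ler_wpM2r ?law_ge0//.
apply: le_trans (subpmf_le1 (side_sub0 sk z)); apply: ler_sum => u _.
by rewrite -[leRHS]mulr1 ler_wpM2l//; exact: (subpmf_le1 (side_sub1 sk z u)).
Qed.

End Gibbs.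

Section InformationBounds.
Context {R : realType} {TX TY1 TY2 TZ1 TZ2 U V1 V2 : finType}.
Local Notation S := (TX * TY1 * TY2 * TZ1 * TZ2)%type.
Context {P : finpmf R S} {q0 : TX -> U -> R} {q1 : TX -> U -> V1 -> R}
  {q2 : TX -> U -> V2 -> R}
  {k01 : TZ1 -> U -> R} {k11 : TZ1 -> U -> V1 -> R} {tau1 : TY1 -> TZ1 -> V1 -> R}
  {k02 : TZ2 -> U -> R} {k12 : TZ2 -> U -> V2 -> R} {tau2 : TY2 -> TZ2 -> V2 -> R}.
Hypothesis tc : test_channel P q0 q1 q2 k01 k11 tau1 k02 k12 tau2.
Local Notation J := (joint_law P q0 q1 q2).
Local Notation M := (mean_log J).

Let q1p x u := subpmf_ge0 (channel_sub1 tc x u).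
Let q2p x u := subpmf_ge0 (channel_sub2 tc x u).
Let J0 := joint_law_ge0 P (channel_sub0 tc) (channel_sub1 tc) (channel_sub2 tc).
Let Jpos := joint_law_pos (channel_sub0 tc) (channel_sub1 tc) (channel_sub2 tc) (P := P).

(** Multiplying by k / q0 draws u from z instead of x, so the total mass stays at most 1 and Gibbs
    applies. For the true conditional laws the quantity is I(U_0 ; X | Z), and the rate allocation
    relies on its sign. *)
Lemma info0_ge0 {TZ : finType} (Z : S -> TZ) (k : TZ -> U -> R) :
  (forall z, subpmf (k z)) -> (forall w, 0 < J w -> 0 < k (Z w.1) w.2.1.1) ->
  0 <= M (lq0 q0) - M (fun w => k (Z w.1) w.2.1.1).
Proof.
move=> ks kpos; rewrite -oppr_le0 opprB mean_logB//; last first.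
  by move=> w Jw; split; [exact: kpos|case: (Jpos Jw)].
apply: gibbs => //; first exact: channel_sum1 tc.
  by move=> w Jw; rewrite divr_gt0 ?kpos//; case: (Jpos Jw).
pose cw (s : S) t := channel_weight (fun s u => k (Z s) u) (fun s => q1 (rvX s))
  (fun s => q2 (rvX s)) s t.
apply: (@le_trans _ _ (\sum_s \sum_t P s * cw s t)).
  rewrite pair_bigA; apply: ler_sum => w _ /=.
  rewrite /joint_law /channel_weight /lq0 /cw /channel_weight.
  have [->|nz] := eqVneq (q0 (rvX w.1) w.2.1.1) 0.
    rewrite invr0 !mulr0 !mulr_ge0 ?mass_ge0 ?q1p ?q2p//.
    exact: subpmf_ge0 (ks _) _.
  by rewrite le_eqVlt; apply/orP; left; apply/eqP; field.
rewrite -(mass_sum1 P); apply: ler_sum => s _; rewrite -mulr_sumr.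
rewrite -[leRHS]mulr1 ler_wpM2l ?mass_ge0//.
apply: channel_weight_le1 => [s'|s' u|s' u]; [exact: ks|exact: channel_sub1 tc _ _|exact: channel_sub2 tc _ _].
Qed.

(** Gibbs for tau1 k01 k11 / (q0 q1): the other private auxiliary sums out and the remaining mass is
    that of [side_mass]. Its purpose is that a positive exponent forces R0 + R1 > 0. *)
Lemma data_processing1 :
  M (ltau1 tau1) <= (M (lq0 q0) - M (lk01 k01)) + (M (lq1 q1) - M (lk11 k11)).
Proof.
have pos w (Jw : 0 < J w) := And3 (Jpos Jw) (channel_pos1 tc Jw) I.
rewrite !mean_logB//; [|by move=> w /pos[[? ? ? ?] [? ? ?] _]..].
rewrite mean_logD//; last first.
  by move=> w /pos[[? ? ? ?] [? ? ?] _]; split; rewrite divr_gt0.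
rewrite -subr_le0 mean_logB//; last first.
  by move=> w /pos[[? ? ? ?] [? ? ?] _]; split; rewrite // !(divr_gt0, mulr_gt0).
apply: gibbs => //; first exact: channel_sum1 tc.
  by move=> w /pos[[? ? ? ?] [? ? ?] _]; rewrite !(divr_gt0, mulr_gt0).
apply: le_trans (side_mass (channel_side1 tc)).
rewrite sum_quadruple; apply: ler_sum => s _.
rewrite mulr_sumr; apply: ler_sum => u _; rewrite mulr_sumr; apply: ler_sum => v _.
have k0p := subpmf_ge0 (side_sub0 (channel_side1 tc) (rvZ1 s)) u.
have k1p := subpmf_ge0 (side_sub1 (channel_side1 tc) (rvZ1 s) u) v.
have tp := side_tau_ge0 (channel_side1 tc) (rvY1 s) (rvZ1 s) v.
rewrite -[leRHS]mulr1.
apply: le_trans (ler_wpM2l _ (subpmf_le1 (channel_sub2 tc (rvX s) u))); last first.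
  by rewrite !mulr_ge0 ?mass_ge0.
rewrite mulr_sumr; apply: ler_sum => v2 _.
rewrite /joint_law /channel_weight /ltau1 /lq0 /lq1 /lk01 /lk11 /=.
have rhs0 : 0 <= P s * (k01 (rvZ1 s) u * k11 (rvZ1 s) u v * tau1 (rvY1 s) (rvZ1 s) v) *
  q2 (rvX s) u v2 by rewrite !mulr_ge0 ?mass_ge0 ?q2p.
have [->|n0] := eqVneq (q0 (rvX s) u) 0; first by rewrite !(mul0r, mulr0).
have [->|n1] := eqVneq (q1 (rvX s) u v) 0; first by rewrite !(mul0r, mulr0).
have [->|m0] := eqVneq (k01 (rvZ1 s) u) 0.
  by rewrite ?(invr0, mul0r, mulr0).
have [->|m1] := eqVneq (k11 (rvZ1 s) u v) 0.
  by rewrite ?(invr0, mul0r, mulr0).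
by rewrite le_eqVlt; apply/orP; left; apply/eqP; field; rewrite n0 n1 m0 m1.
Qed.

Lemma data_processing2 :
  M (ltau2 tau2) <= (M (lq0 q0) - M (lk02 k02)) + (M (lq2 q2) - M (lk12 k12)).
Proof.
have pos w (Jw : 0 < J w) := And3 (Jpos Jw) (channel_pos2 tc Jw) I.
rewrite !mean_logB//; [|by move=> w /pos[[? ? ? ?] [? ? ?] _]..].
rewrite mean_logD//; last first.
  by move=> w /pos[[? ? ? ?] [? ? ?] _]; split; rewrite divr_gt0.
rewrite -subr_le0 mean_logB//; last first.
  by move=> w /pos[[? ? ? ?] [? ? ?] _]; split; rewrite // !(divr_gt0, mulr_gt0).
apply: gibbs => //; first exact: channel_sum1 tc.
  by move=> w /pos[[? ? ? ?] [? ? ?] _]; rewrite !(divr_gt0, mulr_gt0).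
apply: le_trans (side_mass (channel_side2 tc)).
rewrite sum_quadruple; apply: ler_sum => s _.
rewrite mulr_sumr; apply: ler_sum => u _; rewrite mulr_sumr exchange_big/=.
apply: ler_sum => v _.
have k0p := subpmf_ge0 (side_sub0 (channel_side2 tc) (rvZ2 s)) u.
have k1p := subpmf_ge0 (side_sub1 (channel_side2 tc) (rvZ2 s) u) v.
have tp := side_tau_ge0 (channel_side2 tc) (rvY2 s) (rvZ2 s) v.
rewrite -[leRHS]mulr1.
apply: le_trans (ler_wpM2l _ (subpmf_le1 (channel_sub1 tc (rvX s) u))); last first.
  by rewrite !mulr_ge0 ?mass_ge0.
rewrite mulr_sumr; apply: ler_sum => v1 _.
rewrite /joint_law /channel_weight /ltau2 /lq0 /lq2 /lk02 /lk12 /=.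
have rhs0 : 0 <= P s * (k02 (rvZ2 s) u * k12 (rvZ2 s) u v * tau2 (rvY2 s) (rvZ2 s) v) *
  q1 (rvX s) u v1 by rewrite !mulr_ge0 ?mass_ge0 ?q1p.
have [->|n0] := eqVneq (q0 (rvX s) u) 0; first by rewrite !(mul0r, mulr0).
have [->|n1] := eqVneq (q2 (rvX s) u v) 0; first by rewrite !(mul0r, mulr0).
have [->|m0] := eqVneq (k02 (rvZ2 s) u) 0.
  by rewrite ?(invr0, mul0r, mulr0).
have [->|m1] := eqVneq (k12 (rvZ2 s) u v) 0.
  by rewrite ?(invr0, mul0r, mulr0).
by rewrite le_eqVlt; apply/orP; left; apply/eqP; field; rewrite n0 n1 m0 m1.
Qed.

End InformationBounds.

(** * Erasing the auxiliaries *)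

Section Erasure.
Context {R : realType}.
Variable lam : R.
Hypotheses (lam_gt0 : 0 < lam) (lam_lt1 : lam < 1).

(** [lam] is the probability that the auxiliaries survive. It is the same in the kernels of the
    encoder and of the receivers, because the erasure is independent of the source. *)
Definition erase0 {A U : finType} (k : A -> U -> R) (a : A) (ou : option U) : R :=
  if ou is Some u then lam * k a u else 1 - lam.

(** There is one erasure event for all three auxiliaries: surviving and erased outcomes never mix,
    which makes every rate and exponent scale by exactly [lam]. *)
Definition erase1 {A U V : finType} (k : A -> U -> V -> R) (a : A) (ou : option U)
    (ov : option V) : R :=
  match ou, ov with
  | Some u, Some v => k a u v
  | None, None => 1
  | _, _ => 0
  end.

Definition erase_tau {Y Z V : finType} (t : Y -> Z -> V -> R) (y : Y) (z : Z)
    (ov : option V) : R := if ov is Some v then t y z v else 1.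

Lemma big_option {T : finType} (F : option T -> R) :
  \sum_o F o = F None + \sum_t F (Some t).
Proof.
rewrite (bigD1 None)//=; congr (_ + _).
rewrite (reindex_omap Some id); last by case.
by apply: eq_bigl => t; rewrite /= eqxx.
Qed.

Lemma erase0_sub {A U : finType} (k : A -> U -> R) a :
  subpmf (k a) -> subpmf (erase0 k a).
Proof.
move=> ks; split=> [[u|]|] /=; rewrite ?subr_ge0 ?(ltW lam_lt1)//.
  by rewrite mulr_ge0 ?(ltW lam_gt0)// subpmf_ge0.
rewrite big_option /= -mulr_sumr.
have : lam * \sum_u k a u <= lam * 1 by rewrite ler_wpM2l ?subpmf_le1// ltW.
by rewrite mulr1; lra.
Qed.

Lemma erase1_sub {A U V : finType} (k : A -> U -> V -> R) a ou :
  (forall u, subpmf (k a u)) -> subpmf (erase1 k a ou).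
Proof.
move=> ks; split=> [ov|].
  by case: ou ov => [u|] [v|]; rewrite /= ?ler01//; exact: subpmf_ge0.
rewrite big_option; case: ou => [u|] /=.
  by rewrite add0r; exact: subpmf_le1.
by rewrite big1 ?addr0.
Qed.

Context {TX TY1 TY2 TZ1 TZ2 U V1 V2 : finType}.
Local Notation S := (TX * TY1 * TY2 * TZ1 * TZ2)%type.
Context {P : finpmf R S} {q0 : TX -> U -> R} {q1 : TX -> U -> V1 -> R}
  {q2 : TX -> U -> V2 -> R}
  {k01 : TZ1 -> U -> R} {k11 : TZ1 -> U -> V1 -> R} {tau1 : TY1 -> TZ1 -> V1 -> R}
  {k02 : TZ2 -> U -> R} {k12 : TZ2 -> U -> V2 -> R} {tau2 : TY2 -> TZ2 -> V2 -> R}.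
Hypothesis tc : test_channel P q0 q1 q2 k01 k11 tau1 k02 k12 tau2.
Local Notation J := (joint_law P q0 q1 q2).
Local Notation J' := (joint_law P (erase0 q0) (erase1 q1) (erase1 q2)).

Lemma sum_erased (F : S * (option U * option V1 * option V2) -> R) :
  \sum_w J' w * F w =
  lam * (\sum_w J w * F (w.1, (Some w.2.1.1, Some w.2.1.2, Some w.2.2))) +
  (1 - lam) * (\sum_s P s * F (s, (None, None, None))).
Proof.
rewrite !sum_quadruple !mulr_sumr -big_split/=; apply: eq_bigr => s _.
rewrite /joint_law /channel_weight /=.
rewrite !big_option /=.
rewrite [X in _ + X + _ + _]big1 ?addr0; last by move=> v2 _; rewrite !(mulr0, mul0r).
rewrite [X in _ + X + _]big1 ?addr0; last first.
  by move=> v1 _; rewrite big1// => v2 _; rewrite !(mulr0, mul0r).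
rewrite [RHS]addrC; congr (_ + _); first by ring.
rewrite !mulr_sumr; apply: eq_bigr => u _.
rewrite big_option /= big1 ?add0r; last by move=> v2 _; rewrite !(mulr0, mul0r).
rewrite mulr_sumr; apply: eq_bigr => v1 _.
rewrite big_option /= !(mulr0, mul0r) add0r.
by rewrite mulr_sumr; apply: eq_bigr => v2 _; ring.
Qed.

Lemma erased_support w : 0 < J' w ->
  (exists u v1 v2, w.2 = (Some u, Some v1, Some v2) /\ 0 < J (w.1, (u, v1, v2))) \/
  w.2 = (None, None, None).
Proof.
case: w => s [[[u|] [v1|]] [v2|]] /=;
  rewrite /joint_law /channel_weight /= ?(mulr0, mul0r) ?ltxx//; last by right.
move=> pos; left; exists u, v1, v2; split=> //.
have : 0 < lam * (P s * (q0 (rvX s) u * q1 (rvX s) u v1 * q2 (rvX s) u v2)).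
  by apply: lt_le_trans pos _; rewrite le_eqVlt; apply/orP; left; apply/eqP; ring.
by rewrite pmulr_rgt0.
Qed.

Lemma erased_channel : test_channel P (erase0 q0) (erase1 q1) (erase1 q2)
  (erase0 k01) (erase1 k11) (erase_tau tau1) (erase0 k02) (erase1 k12) (erase_tau tau2).
Proof.
have side (TY TZ V : finType) (Y : S -> TY) (Z : S -> TZ) (k0 : TZ -> U -> R)
    (k1 : TZ -> U -> V -> R) (tau : TY -> TZ -> V -> R) :
    side_kernels P Y Z k0 k1 tau ->
    side_kernels P Y Z (erase0 k0) (erase1 k1) (erase_tau tau).
  move=> sk; split.
  - by move=> z; apply/erase0_sub/(side_sub0 sk).
  - by move=> z ou; apply/erase1_sub => u; exact: (side_sub1 sk).
  - by move=> y z [v|] //=; exact: (side_tau_ge0 sk).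
  - move=> z [v|] /=; first exact: (side_tau_mean sk).
    under eq_bigr => y _ do rewrite mulr1.
    exact: (subpmf_le1 (claw_subpmf P Y Z z)).
split.
- by move=> x; apply/erase0_sub/(channel_sub0 tc).
- by move=> x ou; apply/erase1_sub => u; exact: (channel_sub1 tc).
- by move=> x ou; apply/erase1_sub => u; exact: (channel_sub2 tc).
- under eq_bigr => w _ do rewrite -[joint_law _ _ _ _ _]mulr1.
  rewrite (sum_erased (fun _ => 1)).
  under eq_bigr => w _ do rewrite mulr1.
  under [X in _ + _ * X]eq_bigr => w _ do rewrite mulr1.
  by rewrite (channel_sum1 tc) mass_sum1; ring.
- exact: side (channel_side1 tc).
- exact: side (channel_side2 tc).
- case=> s t /erased_support[[u [v1 [v2 [/= -> Jw]]]]|/= ->].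
    by have [? ? ?] := channel_pos1 tc Jw; split=> //; rewrite /lk01 /= mulr_gt0.
  by rewrite /lk01 /lk11 /ltau1 /= subr_gt0 lam_lt1 ltr01.
- case=> s t /erased_support[[u [v1 [v2 [/= -> Jw]]]]|/= ->].
    by have [? ? ?] := channel_pos2 tc Jw; split=> //; rewrite /lk02 /= mulr_gt0.
  by rewrite /lk02 /lk12 /ltau2 /= subr_gt0 lam_lt1 ltr01.
Qed.

Let J0 := joint_law_ge0 P (channel_sub0 tc) (channel_sub1 tc) (channel_sub2 tc).
Let Jpos := joint_law_pos (channel_sub0 tc) (channel_sub1 tc) (channel_sub2 tc) (P := P).

Lemma log2_1 : log2 1 = 0 :> R.
Proof. by rewrite /log2 ln1 mul0r. Qed.

(** On erased outcomes the two functions agree; on the others [c] cancels in the difference of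
    logarithms. It is [lam] for the kernels of U_0 and 1 for those of U_1 and U_2. *)
Lemma erased_gap (k k' : S * (option U * option V1 * option V2) -> R)
    (l l' : S * (U * V1 * V2) -> R) (c : R) :
  0 < c ->
  (forall w, k (w.1, (Some w.2.1.1, Some w.2.1.2, Some w.2.2)) = c * l w) ->
  (forall w, k' (w.1, (Some w.2.1.1, Some w.2.1.2, Some w.2.2)) = c * l' w) ->
  (forall s, k (s, (None, None, None)) = k' (s, (None, None, None))) ->
  (forall w, 0 < J w -> 0 < l w /\ 0 < l' w) ->
  mean_log J' k - mean_log J' k' = lam * (mean_log J l - mean_log J l').
Proof.
move=> c0 kl kl' kk pos; rewrite -!sumrB.
under eq_bigr => w _ do rewrite -mulrBr.
rewrite (sum_erased (fun w => log2 (k w) - log2 (k' w))).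
rewrite [X in _ + _ * X]big1 ?mulr0 ?addr0; last first.
  by move=> s _; rewrite kk subrr mulr0.
congr (_ * _); apply: eq_bigr => w _; rewrite -mulrBr kl kl'.
have [->|Jw] := eqVneq (J w) 0; first by rewrite !mul0r.
have [|l0 l0'] := pos w; first by rewrite lt0r Jw J0.
by rewrite !log2M//; ring.
Qed.

Lemma erased_gap0 {TZ : finType} (Z : S -> TZ) (k : TZ -> U -> R) :
  (forall w, 0 < J w -> 0 < k (Z w.1) w.2.1.1) ->
  mean_log J' (lq0 (erase0 q0)) - mean_log J' (fun w => erase0 k (Z w.1) w.2.1.1) =
  lam * (mean_log J (lq0 q0) - mean_log J (fun w => k (Z w.1) w.2.1.1)).
Proof.
move=> kpos; apply: (@erased_gap _ _ _ _ lam) => // w Jw.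
by split; [case: (Jpos Jw)|exact: kpos].
Qed.

Lemma erased_gap1 : mean_log J' (lq1 (erase1 q1)) - mean_log J' (lk11 (erase1 k11)) =
  lam * (mean_log J (lq1 q1) - mean_log J (lk11 k11)).
Proof.
apply: (@erased_gap _ _ _ _ 1) => //; try by move=> w; rewrite mul1r.
by move=> w Jw; case: (Jpos Jw) (channel_pos1 tc Jw) => ? ? ? ? [].
Qed.

Lemma erased_gap2 : mean_log J' (lq2 (erase1 q2)) - mean_log J' (lk12 (erase1 k12)) =
  lam * (mean_log J (lq2 q2) - mean_log J (lk12 k12)).
Proof.
apply: (@erased_gap _ _ _ _ 1) => //; try by move=> w; rewrite mul1r.
by move=> w Jw; case: (Jpos Jw) (channel_pos2 tc Jw) => ? ? ? ? [].
Qed.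

Lemma erased_tau1 :
  mean_log J' (ltau1 (erase_tau tau1)) = lam * mean_log J (ltau1 tau1).
Proof.
rewrite /mean_log (sum_erased (fun w => log2 (ltau1 (erase_tau tau1) w))).
by rewrite [X in _ + _ * X]big1 ?mulr0 ?addr0// => s _; rewrite /ltau1 /= log2_1 mulr0.
Qed.

Lemma erased_tau2 :
  mean_log J' (ltau2 (erase_tau tau2)) = lam * mean_log J (ltau2 tau2).
Proof.
rewrite /mean_log (sum_erased (fun w => log2 (ltau2 (erase_tau tau2) w))).
by rewrite [X in _ + _ * X]big1 ?mulr0 ?addr0// => s _; rewrite /ltau2 /= log2_1 mulr0.
Qed.

End Erasure.

(** * The test channel of an auxiliary law *)

Section Laws.
Context {R : realType} {T : finType} (p : finpmf R T).

Lemma law_reindex {TA TB : finType} (A : T -> TA) (B : T -> TB) t :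
  (forall t', (A t' == A t) = (B t' == B t)) -> law p A (A t) = law p B (B t).
Proof. by move=> AB; apply: eq_bigl. Qed.

Lemma law_gt0 {TA : finType} (A : T -> TA) t : 0 < p t -> 0 < law p A (A t).
Proof.
move=> pt; apply: lt_le_trans pt _; rewrite /law /prob (bigD1 t)//= lerDl.
by rewrite sumr_ge0// => t' _; exact: mass_ge0.
Qed.

(** An expectation over outcomes, instead of a sum over values, lets the identities for informations
    be checked pointwise on the support, where all the laws involved are positive. *)
Lemma cond_mutual_infoE {TA TB TC : finType} (A : T -> TA) (B : T -> TB) (C : T -> TC) :
  cond_mutual_info p A B C = mean_log p (fun t =>
    law p [% A, B, C] (A t, B t, C t) * law p C (C t) /
    (law p [% A, C] (A t, C t) * law p [% B, C] (B t, C t))).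
Proof.
pose F (r : TA * TB * TC) := log2 (law p [% A, B, C] r * law p C r.2 /
  (law p [% A, C] (r.1.1, r.2) * law p [% B, C] (r.1.2, r.2))).
transitivity (\sum_r law p [% A, B, C] r * F r).
  rewrite /cond_mutual_info.
  rewrite (pair_bigA _ (fun a b => \sum_c law p [% A, B, C] (a, b, c) * F (a, b, c)))/=.
  rewrite (pair_bigA _ (fun ab c => law p [% A, B, C] (ab.1, ab.2, c) * F (ab.1, ab.2, c)))/=.
  by apply: eq_bigr => -[[a b] c].
rewrite /mean_log [RHS](partition_big [% A, B, C] xpredT)//=.
apply: eq_bigr => r _; rewrite /law /prob mulr_suml; apply: eq_bigr => t /eqP tr.
by rewrite -tr.
Qed.

End Laws.

Section Auxiliary.
Context {R : realType} {TX TY1 TY2 TZ1 TZ2 TU U : finType}.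
Local Notation S := (TX * TY1 * TY2 * TZ1 * TZ2)%type.
Local Notation O := (TU * S)%type.
Variables (P : finpmf R S) (Q : finpmf R O) (u0 : TU -> U).
Local Notation X := (fun w : O => rvX w.2).
Local Notation U0 := (fun w : O => u0 w.1).
Hypothesis Q_source : forall s, law Q (fun w : O => w.2) s = P s.
Hypothesis Q_markov : markov_chain Q (fun w : O => w.1) X
  (fun w : O => (rvY1 w.2, rvY2 w.2, rvZ1 w.2, rvZ2 w.2)).

Lemma law_source {TB : finType} (B : S -> TB) b : law Q (fun w => B w.2) b = law P B b.
Proof.
rewrite /law /prob (partition_big (fun w : O => w.2) (fun s => B s == b))//=.
apply: eq_bigr => s /eqP sb; rewrite -Q_source /law /prob; apply: eq_bigl => w.
by apply: andb_idl => /eqP ->; rewrite sb.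
Qed.

(** Cross-multiplied form of the Markov chain, which also covers a null x because P s vanishes
    there. *)
Lemma markov_point u s :
  Q (u, s) * law Q X (rvX s) = law Q (fun w => (w.1, rvX w.2)) (u, rvX s) * P s.
Proof.
have [x0|nx] := eqVneq (law Q X (rvX s)) 0.
  have -> : P s = 0.
    apply/eqP; rewrite eq_le mass_ge0 andbT -x0 law_source /law /prob.
    by rewrite (bigD1 s)//= lerDl sumr_ge0// => t' _; exact: mass_ge0.
  by rewrite x0 !mulr0.
have xpos : 0 < law Q X (rvX s) by rewrite lt0r nx law_ge0.
have := Q_markov xpos u (rvY1 s, rvY2 s, rvZ1 s, rvZ2 s).
rewrite /claw.
have -> : law Q (fun t => (t.1, (rvY1 t.2, rvY2 t.2, rvZ1 t.2, rvZ2 t.2), rvX t.2))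
    (u, (rvY1 s, rvY2 s, rvZ1 s, rvZ2 s), rvX s) = Q (u, s).
  rewrite /law /prob (big_pred1 (u, s))// => -[u' [[[[x y1] y2] z1] z2]] /=.
  case: s {nx xpos} => [[[[a b] c] d] e]; rewrite /= !xpair_eqE.
  by do !case: eqP => //=.
have -> : law Q (fun t => (rvY1 t.2, rvY2 t.2, rvZ1 t.2, rvZ2 t.2, rvX t.2))
    (rvY1 s, rvY2 s, rvZ1 s, rvZ2 s, rvX s) = P s.
  rewrite -Q_source /law /prob; apply: eq_bigl => -[u' [[[[x y1] y2] z1] z2]] /=.
  case: s {nx xpos} => [[[[a b] c] d] e]; rewrite !xpair_eqE /=.
  by do !case: eqP => //=.
move=> H.
have -> : Q (u, s) = (Q (u, s) / law Q X (rvX s)) * law Q X (rvX s) by rewrite divfK.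
by rewrite H; field.
Qed.

Lemma markov_law {A C : finType} (f : TU -> A) (g : S -> C) a x c :
  law Q (fun w => (f w.1, rvX w.2, g w.2)) (a, x, c) * law Q X x =
  law Q (fun w => (f w.1, rvX w.2)) (a, x) * law Q (fun w => (rvX w.2, g w.2)) (x, c).
Proof.
have -> : law Q (fun w => (rvX w.2, g w.2)) (x, c) = law P (fun s => (rvX s, g s)) (x, c).
  exact: (law_source (fun s => (rvX s, g s))).
have -> : law Q (fun w => (f w.1, rvX w.2)) (a, x) =
    \sum_(u | f u == a) law Q (fun w => (w.1, rvX w.2)) (u, x).
  rewrite /law /prob (partition_big (fun w : O => w.1) (fun u => f u == a))/=; last first.
    by move=> w; rewrite xpair_eqE => /andP[].
  apply: eq_bigr => u /eqP fu; apply: eq_bigl => w; rewrite !xpair_eqE.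
  by case: (eqVneq w.1 u) => [->|]; rewrite ?fu ?eqxx ?andbT ?andbF.
rewrite /law /prob mulr_suml big_distrl/=.
transitivity (\sum_(u | f u == a) \sum_(s | (rvX s, g s) == (x, c))
    Q (u, s) * law Q X x).
  rewrite pair_big/=; apply: eq_big => [[u s]|[u s] _] //=.
  by rewrite !xpair_eqE andbA.
apply: eq_bigr => u _; rewrite mulr_sumr; apply: eq_bigr => s.
by rewrite xpair_eqE => /andP[/eqP xs _]; rewrite -xs markov_point.
Qed.

(* The auxiliaries [u0] and [v0] are coordinates of the joint auxiliary in [TU];
   [v0] is U_1 for receiver 1 and U_2 for receiver 2. *)
Definition ker0 (x : TX) (u : U) : R := claw Q U0 X u x.

Section Receiver.
Context {TY TZ V : finType} (v0 : TU -> V) (fY : S -> TY) (fZ : S -> TZ).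
Local Notation V0 := (fun w : O => v0 w.1).
Local Notation Y := (fun w : O => fY w.2).
Local Notation Z := (fun w : O => fZ w.2).

Definition ker1 (x : TX) (u : U) (v : V) : R := claw Q V0 [% U0, X] v (u, x).
Definition back0 (z : TZ) (u : U) : R := claw Q U0 Z u z.
Definition back1 (z : TZ) (u : U) (v : V) : R := claw Q V0 [% U0, Z] v (u, z).
Definition posterior_ratio (y : TY) (z : TZ) (v : V) : R :=
  claw Q Y [% V0, Z] y (v, z) / claw P fY fZ y z.

Lemma receiver_side : side_kernels P fY fZ back0 back1 posterior_ratio.
Proof.
split.
- by move=> z; exact: claw_subpmf.
- by move=> z u; exact: claw_subpmf.
- by move=> y z v; rewrite divr_ge0 ?claw_ge0.
move=> z v; apply: le_trans (subpmf_le1 (claw_subpmf Q Y [% V0, Z] (v, z))).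
apply: ler_sum => y _; rewrite /posterior_ratio mulrC.
have [->|nz] := eqVneq (claw P fY fZ y z) 0; first by rewrite mulr0 claw_ge0.
by rewrite divfK.
Qed.

Let L {TA : finType} (A : O -> TA) (w : O) : R := law Q A (A w).

Lemma clawP_source w : claw P fY fZ (fY w.2) (fZ w.2) = L [% Y, Z] w / L Z w.
Proof.
by rewrite /claw /L -(law_source fZ) -(law_source (fun s => (fY s, fZ s))).
Qed.

Lemma receiver_pos w : 0 < Q w ->
  [/\ 0 < back0 (fZ w.2) (u0 w.1), 0 < back1 (fZ w.2) (u0 w.1) (v0 w.1) &
      0 < posterior_ratio (fY w.2) (fZ w.2) (v0 w.1)].
Proof.
move=> Qw; rewrite /posterior_ratio clawP_source /back0 /back1 /claw; split.
- by rewrite divr_gt0// (law_gt0 [% U0, Z] Qw, law_gt0 Z Qw).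
- by rewrite divr_gt0// (law_gt0 [% V0, [% U0, Z]] Qw, law_gt0 [% U0, Z] Qw).
- rewrite !divr_gt0//.
  + exact: (law_gt0 [% Y, [% V0, Z]] Qw).
  + exact: (law_gt0 [% V0, Z] Qw).
  + exact: (law_gt0 [% Y, Z] Qw).
  + exact: (law_gt0 Z Qw).
Qed.

Lemma ker_pos w : 0 < Q w ->
  0 < ker0 (rvX w.2) (u0 w.1) /\ 0 < ker1 (rvX w.2) (u0 w.1) (v0 w.1).
Proof.
move=> Qw; rewrite /ker0 /ker1 /claw; split.
- by rewrite divr_gt0// (law_gt0 [% U0, X] Qw, law_gt0 X Qw).
- by rewrite divr_gt0// (law_gt0 [% V0, [% U0, X]] Qw, law_gt0 [% U0, X] Qw).
Qed.

Lemma mean_log_eq (f g : O -> R) : (forall w, 0 < Q w -> f w = g w) ->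
  mean_log Q f = mean_log Q g.
Proof.
move=> fg; apply: eq_bigr => w _; have [->|nz] := eqVneq (Q w) 0; first by rewrite !mul0r.
by rewrite fg// lt0r nz mass_ge0.
Qed.

Lemma info_common : cond_mutual_info Q U0 X Z =
  mean_log Q (fun w => ker0 (rvX w.2) (u0 w.1)) -
  mean_log Q (fun w => back0 (fZ w.2) (u0 w.1)).
Proof.
rewrite mean_logB; [|exact: mass_ge0|]; last first.
  by move=> w Qw; have [? _] := ker_pos Qw; have [? _ _] := receiver_pos Qw.
rewrite cond_mutual_infoE; apply: mean_log_eq => w Qw; rewrite /ker0 /back0 /claw.
have := markov_law u0 fZ (u0 w.1) (rvX w.2) (fZ w.2).
have h1 := law_gt0 X Qw; have h2 := law_gt0 Z Qw; have h3 := law_gt0 [% U0, Z] Qw.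
have h4 := law_gt0 [% X, Z] Qw.
move=> /= H.
have -> : law Q [% U0, X, Z] (u0 w.1, rvX w.2, fZ w.2) =
    law Q [% U0, X] (u0 w.1, rvX w.2) * law Q [% X, Z] (rvX w.2, fZ w.2) / law Q X (rvX w.2).
  by rewrite -H mulfK// gt_eqF.
by field; rewrite !gt_eqF.
Qed.

(** The Markov chain is used for u0 and for the pair (u0, v0), which together give P(v0 | u0, x, z)
    = P(v0 | u0, x). *)
Lemma info_private : cond_mutual_info Q V0 X [% U0, Z] =
  mean_log Q (fun w => ker1 (rvX w.2) (u0 w.1) (v0 w.1)) -
  mean_log Q (fun w => back1 (fZ w.2) (u0 w.1) (v0 w.1)).
Proof.
rewrite mean_logB; [|exact: mass_ge0|]; last first.
  by move=> w Qw; have [_ ?] := ker_pos Qw; have [_ ? _] := receiver_pos Qw.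
rewrite cond_mutual_infoE; apply: mean_log_eq => w Qw; rewrite /ker1 /back1 /claw.
have H1 := markov_law u0 fZ (u0 w.1) (rvX w.2) (fZ w.2).
have H2 := markov_law (fun u => (u0 u, v0 u)) fZ (u0 w.1, v0 w.1) (rvX w.2) (fZ w.2).
have h1 := law_gt0 X Qw; have h3 := law_gt0 [% U0, Z] Qw.
have h4 := law_gt0 [% X, Z] Qw; have h5 := law_gt0 [% U0, X] Qw.
have h6 := law_gt0 [% V0, [% U0, Z]] Qw; have h7 := law_gt0 [% U0, X, Z] Qw.
have e1 : law Q [% X, [% U0, Z]] (rvX w.2, (u0 w.1, fZ w.2)) =
    law Q [% U0, X, Z] (u0 w.1, rvX w.2, fZ w.2).
  by apply: (@law_reindex _ _ Q _ _ [% X, [% U0, Z]] [% U0, X, Z] w) => ?;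
    rewrite !xpair_eqE; do !case: eqP => //=.
have e2 : law Q [% V0, X, [% U0, Z]] (v0 w.1, rvX w.2, (u0 w.1, fZ w.2)) =
    law Q (fun w => ((u0 w.1, v0 w.1), rvX w.2, fZ w.2)) ((u0 w.1, v0 w.1), rvX w.2, fZ w.2).
  by apply: (@law_reindex _ _ Q _ _ [% V0, X, [% U0, Z]]
    (fun w => ((u0 w.1, v0 w.1), rvX w.2, fZ w.2)) w) => ?;
    rewrite !xpair_eqE; do !case: eqP => //=.
have e3 : law Q [% V0, [% U0, X]] (v0 w.1, (u0 w.1, rvX w.2)) =
    law Q (fun w => ((u0 w.1, v0 w.1), rvX w.2)) ((u0 w.1, v0 w.1), rvX w.2).
  by apply: (@law_reindex _ _ Q _ _ [% V0, [% U0, X]]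
    (fun w => ((u0 w.1, v0 w.1), rvX w.2)) w) => ?;
    rewrite !xpair_eqE; do !case: eqP => //=.
rewrite e1 e2 e3.
have -> : law Q (fun w => ((u0 w.1, v0 w.1), rvX w.2, fZ w.2))
    ((u0 w.1, v0 w.1), rvX w.2, fZ w.2) =
    law Q (fun w => ((u0 w.1, v0 w.1), rvX w.2)) ((u0 w.1, v0 w.1), rvX w.2) *
    law Q [% X, Z] (rvX w.2, fZ w.2) / law Q X (rvX w.2).
  by rewrite -H2 mulfK// gt_eqF.
have -> : law Q [% U0, X, Z] (u0 w.1, rvX w.2, fZ w.2) =
    law Q [% U0, X] (u0 w.1, rvX w.2) * law Q [% X, Z] (rvX w.2, fZ w.2) / law Q X (rvX w.2).
  by rewrite -H1 mulfK// gt_eqF.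
by field; rewrite !gt_eqF.
Qed.

Lemma info_chain : cond_mutual_info Q [% U0, V0] X Z =
  cond_mutual_info Q U0 X Z + cond_mutual_info Q V0 X [% U0, Z].
Proof.
rewrite !cond_mutual_infoE mean_logD; [|exact: mass_ge0|]; last first.
  move=> w Qw; split; rewrite divr_gt0// mulr_gt0//.
  - exact: (law_gt0 [% U0, X, Z] Qw).
  - exact: (law_gt0 Z Qw).
  - exact: (law_gt0 [% U0, Z] Qw).
  - exact: (law_gt0 [% X, Z] Qw).
  - exact: (law_gt0 [% V0, X, [% U0, Z]] Qw).
  - exact: (law_gt0 [% U0, Z] Qw).
  - exact: (law_gt0 [% V0, [% U0, Z]] Qw).
  - exact: (law_gt0 [% X, [% U0, Z]] Qw).
apply: mean_log_eq => w Qw.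
have h2 := law_gt0 Z Qw; have h3 := law_gt0 [% U0, Z] Qw.
have h4 := law_gt0 [% X, Z] Qw.
have h6 := law_gt0 [% V0, [% U0, Z]] Qw; have h7 := law_gt0 [% U0, X, Z] Qw.
have e1 : law Q [% X, [% U0, Z]] (rvX w.2, (u0 w.1, fZ w.2)) =
    law Q [% U0, X, Z] (u0 w.1, rvX w.2, fZ w.2).
  by apply: (@law_reindex _ _ Q _ _ [% X, [% U0, Z]] [% U0, X, Z] w) => ?;
    rewrite !xpair_eqE; do !case: eqP => //=.
have e2 : law Q [% V0, X, [% U0, Z]] (v0 w.1, rvX w.2, (u0 w.1, fZ w.2)) =
    law Q [% [% U0, V0], X, Z] ((u0 w.1, v0 w.1), rvX w.2, fZ w.2).
  by apply: (@law_reindex _ _ Q _ _ [% V0, X, [% U0, Z]] [% [% U0, V0], X, Z] w) => ?;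
    rewrite !xpair_eqE; do !case: eqP => //=.
have e3 : law Q [% V0, [% U0, Z]] (v0 w.1, (u0 w.1, fZ w.2)) =
    law Q [% [% U0, V0], Z] ((u0 w.1, v0 w.1), fZ w.2).
  by apply: (@law_reindex _ _ Q _ _ [% V0, [% U0, Z]] [% [% U0, V0], Z] w) => ?;
    rewrite !xpair_eqE; do !case: eqP => //=.
rewrite e1 e2 e3; rewrite e3 in h6; field; rewrite !gt_eqF//.
Qed.

Lemma info_exponent : cond_mutual_info Q V0 Y Z =
  mean_log Q (fun w => posterior_ratio (fY w.2) (fZ w.2) (v0 w.1)).
Proof.
rewrite cond_mutual_infoE; apply: mean_log_eq => w Qw.
rewrite /posterior_ratio clawP_source /claw /L.
have h1 := law_gt0 Z Qw; have h2 := law_gt0 [% V0, Z] Qw; have h3 := law_gt0 [% Y, Z] Qw.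
have -> : law Q [% V0, Y, Z] (v0 w.1, fY w.2, fZ w.2) =
    law Q [% Y, [% V0, Z]] (fY w.2, (v0 w.1, fZ w.2)).
  by apply: (@law_reindex _ _ Q _ _ [% V0, Y, Z] [% Y, [% V0, Z]] w) => ?;
    rewrite !xpair_eqE; do !case: eqP => //=.
have arith (a b c d : R) : 0 < b -> 0 < c -> 0 < d -> a * b / (c * d) = a / c / (d / b).
  by move=> ? ? ?; field; rewrite !gt_eqF.
exact: arith.
Qed.

End Receiver.
End Auxiliary.

(** * Splitting the common message *)

Section RateAllocation.
Context {R : realFieldType}.

(** A receiver short of private rate is given s_i just above b_i - R_i, and [rho] takes the rest of
    R0; the sum constraints keep the total of the other receiver large enough. A single active
    receiver takes all of R0 as its s_i. *)
Lemma rate_allocation (R0 R1 R2 a1 a2 b1 b2 : R) (on1 on2 : bool) :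
  0 <= R0 -> 0 <= R1 -> 0 <= R2 -> 0 <= a1 -> 0 <= a2 ->
  (on1 -> a1 + b1 < R0 + R1) -> (on2 -> a2 + b2 < R0 + R2) ->
  (on1 || on2 -> a1 + b1 + b2 < R0 + R1 + R2 /\ a2 + b1 + b2 < R0 + R1 + R2) ->
  exists rho s1 s2 : R, [/\ 0 <= rho, 0 <= s1, 0 <= s2, rho + s1 + s2 <= R0 &
    (on1 -> a1 + b1 < rho + (s1 + R1) /\ b1 < s1 + R1) /\
    (on2 -> a2 + b2 < rho + (s2 + R2) /\ b2 < s2 + R2)].
Proof.
move=> R00 R10 R20 a10 a20.
case: on1 on2 => [] [] H1 H2 H3; rewrite ?orbT ?orbF /= in H3.
- have {}H1 := H1 isT; have {}H2 := H2 isT; have [h3 h3'] := H3 isT.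
  have [c1|c1] := ltP b1 R1; have [c2|c2] := ltP b2 R2.
  + by exists R0, 0, 0; split=> //; [lra|split=> _; split; lra].
  (* [g] is the smallest slack that the excess of s2 may consume; half of it preserves the strict
     inequalities, and rho >= 0 follows from a2 >= 0. *)
  + pose g := Num.min (R0 + R2 - a2 - b2) (R0 + R1 + R2 - (a1 + b1 + b2)).
    have g0 : 0 < g by rewrite lt_min; apply/andP; split; lra.
    have gl1 : g <= R0 + R2 - a2 - b2 by rewrite ge_min lexx.
    have gl2 : g <= R0 + R1 + R2 - (a1 + b1 + b2) by rewrite ge_min lexx orbT.
    exists (R0 - (b2 - R2 + g / 2)), 0, (b2 - R2 + g / 2).
    by split=> //; [lra|lra|lra|split=> _; split; lra].
  + pose g := Num.min (R0 + R1 - a1 - b1) (R0 + R1 + R2 - (a2 + b1 + b2)).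
    have g0 : 0 < g by rewrite lt_min; apply/andP; split; lra.
    have gl1 : g <= R0 + R1 - a1 - b1 by rewrite ge_min lexx.
    have gl2 : g <= R0 + R1 + R2 - (a2 + b1 + b2) by rewrite ge_min lexx orbT.
    exists (R0 - (b1 - R1 + g / 2)), (b1 - R1 + g / 2), 0.
    by split=> //; [lra|lra|lra|split=> _; split; lra].
  (* Both excesses are now taken out of [rho], hence thirds. *)
  + pose g := Num.min (R0 + R1 + R2 - (a1 + b1 + b2)) (R0 + R1 + R2 - (a2 + b1 + b2)).
    have g0 : 0 < g by rewrite lt_min; apply/andP; split; lra.
    have gl1 : g <= R0 + R1 + R2 - (a1 + b1 + b2) by rewrite ge_min lexx.
    have gl2 : g <= R0 + R1 + R2 - (a2 + b1 + b2) by rewrite ge_min lexx orbT.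
    exists (R0 - (b1 - R1 + g / 3) - (b2 - R2 + g / 3)), (b1 - R1 + g / 3), (b2 - R2 + g / 3).
    by split=> //; [lra|lra|lra|lra|split=> _; split; lra].
- have {}H1 := H1 isT; exists 0, R0, 0.
  by split=> //; [lra|split=> // _; split; lra].
- have {}H2 := H2 isT; exists 0, 0, R0.
  by split=> //; [lra|split=> // _; split; lra].
- by exists 0, 0, 0; split=> //; lra.
Qed.

Lemma rate_between (d : R) : 0 < d -> d < 1 ->
  exists lam : R, 0 < lam < 1 /\ 1 - d < lam.
Proof.
by move=> ? ?; exists (1 - d / 2); split; [apply/andP; split|]; lra.
Qed.

(** For y > 0, x <= y gives lam x < y whatever the sign of x; strictness is therefore obtained
    exactly where the total rate is positive, which is asked of the active receivers. *)
Lemma scaled_rate_allocation (R0 R1 R2 a1 a2 b1 b2 lam : R) (on1 on2 : bool) :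
  0 <= R0 -> 0 <= R1 -> 0 <= R2 -> 0 <= a1 -> 0 <= a2 -> 0 < lam < 1 ->
  a1 + b1 <= R0 + R1 -> a2 + b2 <= R0 + R2 ->
  Num.max a1 a2 + b1 + b2 <= R0 + R1 + R2 ->
  (on1 -> 0 < R0 + R1) -> (on2 -> 0 < R0 + R2) ->
  exists rho s1 s2 : R, [/\ 0 <= rho, 0 <= s1, 0 <= s2, rho + s1 + s2 <= R0 &
    (on1 -> lam * a1 + lam * b1 < rho + (s1 + R1) /\ lam * b1 < s1 + R1) /\
    (on2 -> lam * a2 + lam * b2 < rho + (s2 + R2) /\ lam * b2 < s2 + R2)].
Proof.
move=> R00 R10 R20 a10 a20 /andP[l0 l1] h1 h2 h3 o1 o2.
have scale x y : x <= y -> 0 < y -> lam * x < y.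
  by move: l0 l1; clear => ? ? ? ?; nra.
have m1 : a1 <= Num.max a1 a2 by rewrite le_max lexx.
have m2 : a2 <= Num.max a1 a2 by rewrite le_max lexx orbT.
apply: rate_allocation => //; rewrite ?mulr_ge0 ?(ltW l0)//.
- by move=> /o1 ?; rewrite -mulrDr; exact: scale.
- by move=> /o2 ?; rewrite -mulrDr; exact: scale.
- move=> on; have pos : 0 < R0 + R1 + R2 by case/orP: on => [/o1|/o2] ?; lra.
  by split; rewrite -!mulrDr; apply: scale => //; lra.
Qed.

End RateAllocation.

Section AuxiliaryChannel.
Context {R : realType} {TX TY1 TY2 TZ1 TZ2 TU0 TU1 TU2 : finType}.
Local Notation S := (TX * TY1 * TY2 * TZ1 * TZ2)%type.
Local Notation TU := (TU0 * TU1 * TU2)%type.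
Local Notation O := (TU * S)%type.
Variables (P : finpmf R S) (Q : finpmf R O).
Hypothesis Q_source : forall s, law Q (fun w : O => w.2) s = P s.
Hypothesis Q_markov : markov_chain Q (fun w : O => w.1) (fun w : O => rvX w.2)
  (fun w : O => (rvY1 w.2, rvY2 w.2, rvZ1 w.2, rvZ2 w.2)).

Definition coord0 (u : TU) := u.1.1.
Definition coord1 (u : TU) := u.1.2.
Definition coord2 (u : TU) := u.2.
Local Notation q0 := (ker0 Q coord0).
Local Notation q1 := (ker1 Q coord0 coord1).
Local Notation q2 := (ker1 Q coord0 coord2).
Local Notation J := (joint_law P q0 q1 q2).

(** Reconstructing the law as P(s) P(u | x) P(v | u, x) is exact for one private auxiliary at a
    time. A null x and a null (u, x) are separate cases because [claw] is zero there. *)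
Lemma pair_law {V : finType} (v0 : TU -> V) s u v :
  P s * (q0 (rvX s) u * ker1 Q coord0 v0 (rvX s) u v) =
  law Q (fun w => (coord0 w.1, v0 w.1, w.2)) (u, v, s).
Proof.
set x := rvX s.
have key := markov_law Q_source Q_markov (fun t => (coord0 t, v0 t)) id (u, v) x s.
have e1 : law Q (fun w => ((coord0 w.1, v0 w.1), rvX w.2, id w.2)) ((u, v), x, s) =
    law Q (fun w => (coord0 w.1, v0 w.1, w.2)) (u, v, s).
  rewrite /law /prob; apply: eq_bigl => w; rewrite !xpair_eqE /=.
  by case: (eqVneq w.2 s) => [->|]; rewrite ?eqxx ?andbT ?andbF.
have e2 : law Q (fun w => (rvX w.2, id w.2)) (x, s) = P s.
  rewrite -Q_source /law /prob; apply: eq_bigl => w; rewrite !xpair_eqE /=.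
  by case: (eqVneq w.2 s) => [->|]; rewrite ?eqxx ?andbF.
have e3 : law Q (fun w => ((coord0 w.1, v0 w.1), rvX w.2)) ((u, v), x) =
    law Q [% (fun w : O => v0 w.1), [% (fun w : O => coord0 w.1), (fun w : O => rvX w.2)]]
      (v, (u, x)).
  by rewrite /law /prob; apply: eq_bigl => w; rewrite !xpair_eqE /=; do !case: eqP.
rewrite e1 e2 e3 in key; rewrite /ker0 /ker1 /claw -/x.
have [x0|nx] := eqVneq (law Q (fun w : O => rvX w.2) x) 0.
  rewrite x0 invr0 mulr0 !mul0r mulr0; apply/esym/eqP; rewrite eq_le law_ge0 andbT.
  rewrite -x0 /law /prob [leRHS](bigID (fun w : O => (coord0 w.1, v0 w.1, w.2) == (u, v, s)))/=.
  rewrite (eq_bigl (fun w : O => (rvX w.2 == x) && ((coord0 w.1, v0 w.1, w.2) == (u, v, s)))).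
    by rewrite lerDl sumr_ge0// => t' _; exact: mass_ge0.
  move=> w; rewrite !xpair_eqE; case: (eqVneq w.2 s) => [->|].
    by rewrite eqxx.
  by rewrite !andbF.
apply: (mulIf nx); rewrite key.
have [u0|nu] := eqVneq (law Q (fun w : O => (coord0 w.1, rvX w.2)) (u, x)) 0.
  by rewrite (law_pair0 _ _ u0) !mul0r !mulr0 mul0r.
by field; rewrite nx nu.
Qed.

Lemma sum_pair_law {V : finType} (v0 : TU -> V) (F : S -> TU0 -> V -> R) :
  \sum_s \sum_u \sum_v P s * (q0 (rvX s) u * ker1 Q coord0 v0 (rvX s) u v) * F s u v =
  \sum_w Q w * F w.2 (coord0 w.1) (v0 w.1).
Proof.
under eq_bigr => s _ do under eq_bigr => u _ do under eq_bigr => v _ do rewrite pair_law.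
rewrite [RHS](partition_big (fun w : O => w.2) xpredT)//=; apply: eq_bigr => s _.
rewrite [RHS](partition_big (fun w : O => coord0 w.1) xpredT)//=; apply: eq_bigr => u _.
rewrite [RHS](partition_big (fun w : O => v0 w.1) xpredT)//=; apply: eq_bigr => v _.
rewrite /law /prob mulr_suml; apply: eq_big => [w|w /eqP[<- <- <-]//].
by rewrite !xpair_eqE; do !case: eqP.
Qed.

Lemma ker1_sum {V : finType} (v0 : TU -> V) x u (c : R) :
  c * q0 x u * (\sum_v ker1 Q coord0 v0 x u v) = c * q0 x u.
Proof.
rewrite /ker1 claw_sum; have [z|nz] := eqVneq; last by rewrite mulr1.
by rewrite /ker0 /claw z mul0r !mulr0.
Qed.

(** [J] need not have the same joint law of (U_1, U_2) as [Q]; what survives is the law of U_0, one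
    private auxiliary and the source, after the other kernel sums out. *)
Lemma sum_joint1 (F : S -> TU0 -> TU1 -> R) :
  \sum_w J w * F w.1 w.2.1.1 w.2.1.2 = \sum_w Q w * F w.2 (coord0 w.1) (coord1 w.1).
Proof.
rewrite -(sum_pair_law coord1) sum_quadruple; apply: eq_bigr => s _.
apply: eq_bigr => u _; apply: eq_bigr => v _; rewrite /joint_law /channel_weight /=.
transitivity (P s * q1 (rvX s) u v * F s u v * q0 (rvX s) u *
    \sum_v2 q2 (rvX s) u v2).
  by rewrite mulr_sumr; apply: eq_bigr => v2 _; ring.
by rewrite ker1_sum; ring.
Qed.

Lemma sum_joint2 (F : S -> TU0 -> TU2 -> R) :
  \sum_w J w * F w.1 w.2.1.1 w.2.2 = \sum_w Q w * F w.2 (coord0 w.1) (coord2 w.1).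
Proof.
rewrite -(sum_pair_law coord2) sum_quadruple; apply: eq_bigr => s _.
apply: eq_bigr => u _; rewrite exchange_big/=.
apply: eq_bigr => v _; rewrite /joint_law /channel_weight /=.
transitivity (P s * q2 (rvX s) u v * F s u v * q0 (rvX s) u *
    \sum_v1 q1 (rvX s) u v1).
  by rewrite mulr_sumr; apply: eq_bigr => v1 _; ring.
by rewrite ker1_sum; ring.
Qed.

Lemma law_gt0_witness {T TA : finType} (p : finpmf R T) (A : T -> TA) a :
  0 < law p A a -> exists2 t, A t = a & 0 < p t.
Proof.
move=> pos; have [/existsP[t /andP[/eqP At pt]]|] := boolP [exists t, (A t == a) && (0 < p t)].
  by exists t.
rewrite negb_exists => /forallP none; move: pos; rewrite /law /prob big1 ?ltxx// => t At.
by have := none t; rewrite At /= lt0r mass_ge0 andbT negbK => /eqP.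
Qed.

Let ker0_sub x : subpmf (q0 x). Proof. exact: claw_subpmf. Qed.
Let ker1_sub x u : subpmf (q1 x u). Proof. exact: claw_subpmf. Qed.
Let ker2_sub x u : subpmf (q2 x u). Proof. exact: claw_subpmf. Qed.

Lemma joint_support1 w : 0 < J w -> exists2 t,
  [/\ t.2 = w.1, coord0 t.1 = w.2.1.1 & coord1 t.1 = w.2.1.2] & 0 < Q t.
Proof.
move=> /(joint_law_pos ker0_sub ker1_sub ker2_sub)[Pw l0 l1 _].
have : 0 < P w.1 * (q0 (rvX w.1) w.2.1.1 * q1 (rvX w.1) w.2.1.1 w.2.1.2).
  by apply: mulr_gt0 => //; apply: mulr_gt0.
by rewrite pair_law => /law_gt0_witness[t [E0 E1 E2] Qt]; exists t.
Qed.

Lemma joint_support2 w : 0 < J w -> exists2 t,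
  [/\ t.2 = w.1, coord0 t.1 = w.2.1.1 & coord2 t.1 = w.2.2] & 0 < Q t.
Proof.
move=> /(joint_law_pos ker0_sub ker1_sub ker2_sub)[Pw l0 _ l2].
have : 0 < P w.1 * (q0 (rvX w.1) w.2.1.1 * q2 (rvX w.1) w.2.1.1 w.2.2).
  by apply: mulr_gt0 => //; apply: mulr_gt0.
by rewrite pair_law => /law_gt0_witness[t [E0 E1 E2] Qt]; exists t.
Qed.

Lemma auxiliary_channel : test_channel P q0 q1 q2
  (back0 Q coord0 rvZ1) (back1 Q coord0 coord1 rvZ1) (posterior_ratio P Q coord1 rvY1 rvZ1)
  (back0 Q coord0 rvZ2) (back1 Q coord0 coord2 rvZ2) (posterior_ratio P Q coord2 rvY2 rvZ2).
Proof.
split=> //.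
- transitivity (\sum_w J w * 1); first by apply: eq_bigr => w _; rewrite mulr1.
  rewrite (sum_joint1 (fun _ _ _ => 1)) -[RHS](mass_sum1 Q).
  by apply: eq_bigr => w _; rewrite mulr1.
- exact: receiver_side.
- exact: receiver_side.
- move=> w /joint_support1[t [E0 E1 E2] Qt].
  by rewrite /lk01 /lk11 /ltau1 -E0 -E1 -E2; exact: receiver_pos.
- move=> w /joint_support2[t [E0 E1 E2] Qt].
  by rewrite /lk02 /lk12 /ltau2 -E0 -E1 -E2; exact: receiver_pos.
Qed.

End AuxiliaryChannel.

Section ScaledAchievability.
Context {R : realType} {TX TY1 TY2 TZ1 TZ2 U V1 V2 : finType}.
Local Notation S := (TX * TY1 * TY2 * TZ1 * TZ2)%type.
Context {P : finpmf R S} {q0 : TX -> U -> R} {q1 : TX -> U -> V1 -> R}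
  {q2 : TX -> U -> V2 -> R}
  {k01 : TZ1 -> U -> R} {k11 : TZ1 -> U -> V1 -> R} {tau1 : TY1 -> TZ1 -> V1 -> R}
  {k02 : TZ2 -> U -> R} {k12 : TZ2 -> U -> V2 -> R} {tau2 : TY2 -> TZ2 -> V2 -> R}.
Hypothesis tc : test_channel P q0 q1 q2 k01 k11 tau1 k02 k12 tau2.
Local Notation M := (mean_log (joint_law P q0 q1 q2)).
Local Notation A1 := (M (lq0 q0) - M (lk01 k01)).
Local Notation A2 := (M (lq0 q0) - M (lk02 k02)).
Local Notation B1 := (M (lq1 q1) - M (lk11 k11)).
Local Notation B2 := (M (lq2 q2) - M (lk12 k12)).

(* Erasing the auxiliaries with probability [d / 2] turns the weak rate
   constraints into strict ones. A receiver whose exponent vanishes ignores its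
   messages, which covers the case where its total rate is zero. *)
Lemma scaled_achievability (R0 R1 R2 t1 t2 d eps : R) :
  0 <= R0 -> 0 <= R1 -> 0 <= R2 -> 0 <= t1 -> 0 <= t2 ->
  A1 + B1 <= R0 + R1 -> A2 + B2 <= R0 + R2 ->
  Num.max A1 A2 + B1 + B2 <= R0 + R1 + R2 ->
  t1 <= M (ltau1 tau1) -> t2 <= M (ltau2 tau2) ->
  0 < d < 1 -> 0 < eps ->
  eps_achievable P eps ((1 - d) * t1) ((1 - d) * t2) R0 R1 R2.
Proof.
move=> hR0 hR1 hR2 t10 t20 r1 r2 r3 e1 e2 /andP[d0 d1] eps0.
have A1_ge0 : 0 <= A1.
  apply: (info0_ge0 tc) => [z|w Jw]; first exact: (side_sub0 (channel_side1 tc)).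
  by have [] := channel_pos1 tc Jw.
have A2_ge0 : 0 <= A2.
  apply: (info0_ge0 tc) => [z|w Jw]; first exact: (side_sub0 (channel_side2 tc)).
  by have [] := channel_pos2 tc Jw.
have on1 : 0 < t1 -> 0 < R0 + R1.
  move=> tp; apply: lt_le_trans tp (le_trans e1 (le_trans _ r1)).
  exact: data_processing1 tc.
have on2 : 0 < t2 -> 0 < R0 + R2.
  move=> tp; apply: lt_le_trans tp (le_trans e2 (le_trans _ r2)).
  exact: data_processing2 tc.
have [lam [/andP[lam0 lam1] lamd]] : exists lam : R, 0 < lam < 1 /\ 1 - d < lam.
  exact: rate_between.
have lamI : 0 < lam < 1 by rewrite lam0 lam1.
have [rho [s1 [s2 [rho0 s10 s20 srho [c1 c2]]]]] :=
  scaled_rate_allocation hR0 hR1 hR2 A1_ge0 A2_ge0 lamI r1 r2 r3 on1 on2.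
have scale (t m : R) : 0 < t -> t <= m -> (1 - d) * t < lam * m.
  move=> tp tm; apply: (@lt_le_trans _ _ (lam * t)); last by rewrite ler_wpM2l// ltW.
  by rewrite ltr_pM2r.
have d1' : 0 <= 1 - d by rewrite subr_ge0 ltW.
apply: (core_achievability (erased_channel lam0 lam1 tc) (on1 := 0 < t1) (on2 := 0 < t2)
  eps0 rho0 s10 s20 srho).
- move=> on; have [? ?] := c1 on.
  rewrite (erased_gap1 lam tc) erased_tau1.
  rewrite (erased_gap0 lam0 tc (Z := rvZ1) (k := k01)); last first.
    by move=> w Jw; have [] := channel_pos1 tc Jw.
  by split=> //; exact: scale.
- by rewrite -leNgt => ?; rewrite mulr_ge0_le0.
- move=> on; have [? ?] := c2 on.
  rewrite (erased_gap2 lam tc) erased_tau2.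
  rewrite (erased_gap0 lam0 tc (Z := rvZ2) (k := k02)); last first.
    by move=> w Jw; have [] := channel_pos2 tc Jw.
  by split=> //; exact: scale.
- by rewrite -leNgt => ?; rewrite mulr_ge0_le0.
Qed.

End ScaledAchievability.

(** * Inclusion of the regions *)

Lemma closure_scaled {R : realType} (A : set (R * R)) (t1 t2 : R) :
  0 <= t1 -> 0 <= t2 ->
  (forall d, 0 < d < 1 -> A ((1 - d) * t1, (1 - d) * t2)) -> closure A (t1, t2).
Proof.
move=> t10 t20 HA B /nbhs_ballP[e /= e0 eB].
(* 1 / 2 keeps d below 1, the added 1 keeps the denominator positive when t1 = t2 = 0, and each
   coordinate moves by less than e. *)
pose d := Num.min (1 / 2) (e / (2 * (t1 + t2 + 1))).
have t_gt0 : 0 < 2 * (t1 + t2 + 1) by lra.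
have d0 : 0 < d by rewrite lt_min divr_gt0//= divr_gt0.
have d1 : d < 1 by rewrite gt_min; apply/orP; left; lra.
have de : d * (2 * (t1 + t2 + 1)) <= e.
  by rewrite -ler_pdivlMr// ge_min lexx orbT.
exists ((1 - d) * t1, (1 - d) * t2); split; first by apply: HA; rewrite d0 d1.
apply: eB; split => /=; rewrite /ball /=.
  rewrite (_ : t1 - _ = d * t1); last by ring.
  by rewrite ger0_norm ?mulr_ge0 ?(ltW d0)//; nra.
rewrite (_ : t2 - _ = d * t2); last by ring.
by rewrite ger0_norm ?mulr_ge0 ?(ltW d0)//; nra.
Qed.

Theorem theorem1 (R : realType) (X Y1 Y2 Z1 Z2 : finType)
    (P : finpmf R (X * Y1 * Y2 * Z1 * Z2)%type) (R0 R1 R2 : R)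
    (hR0 : 0 <= R0) (hR1 : 0 <= R1) (hR2 : 0 <= R2) :
  inner_region P R0 R1 R2 `<=` exponents_region P R0 R1 R2.
Proof.
move=> [t1 t2] /= [t10 [t20 [TU0 [TU1 [TU2 [Q]]]]]] /=.
rewrite /= in t10 t20; move=> [Q_law [Q_markov' [r1 [r2 [r3 [e1 e2]]]]]].
have Q_source s : law Q (fun w => w.2) s = P s.
  rewrite -Q_law /law /prob; apply: eq_bigl => -[u [[[[x y1] y2] z1] z2]] /=.
  by case: s => [[[[a b] c] d] e].
have Q_markov : markov_chain Q (fun w => w.1) (fun w => rvX w.2)
    (fun w => (rvY1 w.2, rvY2 w.2, rvZ1 w.2, rvZ2 w.2)).
  move=> b b0 a c; apply: etrans (etrans (Q_markov' b b0 a c) _).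
    by rewrite /claw /law /prob; congr (_ / _); apply: eq_bigl => -[[[u0 u1] u2] s].
  by congr (_ * _); rewrite /claw /law /prob; congr (_ / _);
    apply: eq_bigl => -[[[u0 u1] u2] s].
have tc := auxiliary_channel Q_source Q_markov.
pose J := joint_law P (ker0 Q coord0) (ker1 Q coord0 coord1) (ker1 Q coord0 coord2).
(* Each quantity in the region depends on one private auxiliary only, so its mean is the same under
   [J] and [Q]. *)
have M1 (k : X * Y1 * Y2 * Z1 * Z2 -> TU0 -> TU1 -> R) :
    mean_log J (fun w => k w.1 w.2.1.1 w.2.1.2) =
    mean_log Q (fun w => k w.2 (coord0 w.1) (coord1 w.1)).
  exact: (sum_joint1 Q_source Q_markov (fun s u v => log2 (k s u v))).
have M2 (k : X * Y1 * Y2 * Z1 * Z2 -> TU0 -> TU2 -> R) :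
    mean_log J (fun w => k w.1 w.2.1.1 w.2.2) =
    mean_log Q (fun w => k w.2 (coord0 w.1) (coord2 w.1)).
  exact: (sum_joint2 Q_source Q_markov (fun s u v => log2 (k s u v))).
pose A1 := mean_log J (lq0 (ker0 Q coord0)) - mean_log J (lk01 (back0 Q coord0 rvZ1)).
pose A2 := mean_log J (lq0 (ker0 Q coord0)) - mean_log J (lk02 (back0 Q coord0 rvZ2)).
pose B1 := mean_log J (lq1 (ker1 Q coord0 coord1)) -
  mean_log J (lk11 (back1 Q coord0 coord1 rvZ1)).
pose B2 := mean_log J (lq2 (ker1 Q coord0 coord2)) -
  mean_log J (lk12 (back1 Q coord0 coord2 rvZ2)).
have A1E : cond_mutual_info Q (fun w => coord0 w.1) (fun w => rvX w.2) (fun w => rvZ1 w.2) = A1.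
  rewrite (info_common coord0 Q_source Q_markov coord1 rvY1 rvZ1).
  by congr (_ - _); apply/esym; [exact: (M1 (fun s u _ => ker0 Q coord0 (rvX s) u))|
    exact: (M1 (fun s u _ => back0 Q coord0 rvZ1 (rvZ1 s) u))].
have A2E : cond_mutual_info Q (fun w => coord0 w.1) (fun w => rvX w.2) (fun w => rvZ2 w.2) = A2.
  rewrite (info_common coord0 Q_source Q_markov coord2 rvY2 rvZ2).
  by congr (_ - _); apply/esym; [exact: (M2 (fun s u _ => ker0 Q coord0 (rvX s) u))|
    exact: (M2 (fun s u _ => back0 Q coord0 rvZ2 (rvZ2 s) u))].
have B1E : cond_mutual_info Q (fun w => coord1 w.1) (fun w => rvX w.2)
    (fun w => (coord0 w.1, rvZ1 w.2)) = B1.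
  rewrite (info_private coord0 Q_source Q_markov coord1 rvY1 rvZ1).
  by congr (_ - _); apply/esym; [exact: (M1 (fun s u v => ker1 Q coord0 coord1 (rvX s) u v))|
    exact: (M1 (fun s u v => back1 Q coord0 coord1 rvZ1 (rvZ1 s) u v))].
have B2E : cond_mutual_info Q (fun w => coord2 w.1) (fun w => rvX w.2)
    (fun w => (coord0 w.1, rvZ2 w.2)) = B2.
  rewrite (info_private coord0 Q_source Q_markov coord2 rvY2 rvZ2).
  by congr (_ - _); apply/esym; [exact: (M2 (fun s u v => ker1 Q coord0 coord2 (rvX s) u v))|
    exact: (M2 (fun s u v => back1 Q coord0 coord2 rvZ2 (rvZ2 s) u v))].
have T1E : cond_mutual_info Q (fun w => coord1 w.1) (fun w => rvY1 w.2) (fun w => rvZ1 w.2) =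
    mean_log J (ltau1 (posterior_ratio P Q coord1 rvY1 rvZ1)).
  rewrite (info_exponent Q_source coord1 rvY1 rvZ1); apply/esym.
  exact: (M1 (fun s _ v => posterior_ratio P Q coord1 rvY1 rvZ1 (rvY1 s) (rvZ1 s) v)).
have T2E : cond_mutual_info Q (fun w => coord2 w.1) (fun w => rvY2 w.2) (fun w => rvZ2 w.2) =
    mean_log J (ltau2 (posterior_ratio P Q coord2 rvY2 rvZ2)).
  rewrite (info_exponent Q_source coord2 rvY2 rvZ2); apply/esym.
  exact: (M2 (fun s _ v => posterior_ratio P Q coord2 rvY2 rvZ2 (rvY2 s) (rvZ2 s) v)).
apply: closure_scaled => // d d01; split; [|split] => /=.
- by rewrite mulr_ge0// subr_ge0 ltW//; case/andP: d01.
- by rewrite mulr_ge0// subr_ge0 ltW//; case/andP: d01.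
(* The scaled pair is fixed before eps, so it belongs to the set whose closure is taken. *)
move=> eps /andP[eps0 _]; apply: (scaled_achievability tc) => //.
- by rewrite -/J -/A1 -/B1 -A1E -B1E -info_chain.
- by rewrite -/J -/A2 -/B2 -A2E -B2E -info_chain.
- by rewrite -/J -/A1 -/A2 -/B1 -/B2 -A1E -A2E -B1E -B2E.
- by rewrite -/J -T1E.
- by rewrite -/J -T2E.
Qed.
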